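(* Let $d\ge1$. There is a constant $c>0$, independent of $u$, such that the following holds. Let $u_0\in L^\infty(\mathbb{T}^d)$ be positive (with $\operatorname{ess\,inf}u_0>0$), and let $u\in L^\infty(\mathbb{T}^d\times[0,\infty))$ be a weak solution to $$u_t - u\,|\nabla| u + |\nabla|(u^2) = 0$$ with initial condition $u_0$, having the properties (P) listed in the context. Let $A(t)=\max_{x\in\mathbb{T}^d}u(x,t)-\min_{x\in\mathbb{T}^d}u(x,t)$, $A_0=A(0)$ and $m_0=\min u_0$. Then $$A(t)\le A_0e^{-c\,m_0t}\qquad\text{for all }t>0 .$$
   Context: $\mathbb{T}^d=(\mathbb{R}/2\pi\mathbb{Z})^d$ and $\mathbb{R}_+=[0,\infty)$. $|\nabla|=(-\Delta)^{1/2}$ is the Fourier multiplier with symbol $|\xi|$. Let $c_d>0$ be the dimensional constant such that on $\mathbb{R}^d$, $|\nabla|f(x)=\mathrm{p.v.}\int_{\mathbb{R}^d}\frac{c_d}{|x-y|^{d+1}}(f(x)-f(y))\,dy$, and set $K_{\mathrm{per}}(z)=\sum_{j\in\mathbb{Z}^d}\frac{c_d}{|z+2\pi j|^{d+1}}$. The seminorm is $\|f\|_{\dot H^{1/2}(\mathbb{T}^d)}^2=\int_{\mathbb{T}^d}f\,|\nabla|f\,dx$. Weak solution with initial value $u_0$: for every $\phi\in C^\infty(\mathbb{R}_+\times\mathbb{T}^d)$ and every $t\ge 0$, $$\int_{\mathbb{T}^d}u(x,t)\phi(x,t)\,dx-\int_{\mathbb{T}^d}u_0(x)\phi(x,0)\,dx-\int_0^t\!\!\int_{\mathbb{T}^d}u\,\partial_t\phi\,dx\,ds$$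 $$=\frac12\int_0^t\!\!\iint\phi(x,s)(u(y,s)-u(x,s))^2K_{\mathrm{per}}(y-x)\,dy\,dx\,ds$$ $$+\frac12\int_0^t\!\!\iint u(x,s)(\phi(x,s)-\phi(y,s))(u(y,s)-u(x,s))K_{\mathrm{per}}(y-x)\,dy\,dx\,ds,$$ the double integrals being over $\mathbb{T}^d\times\mathbb{T}^d$. Properties (P) (those of the weak solutions whose existence the paper establishes for every such $u_0$): $u\in L^\infty(\mathbb{R}_+\times\mathbb{T}^d)\cap L^2(\mathbb{R}_+;\dot H^{1/2})\cap C^0(\mathbb{R}_+;L^2)$; as $t\to0^+$, $u(t)\to u_0$ weakly$^*$ in $L^\infty$ and strongly in $L^2$; $\|u(t)\|_{L^2}=\|u_0\|_{L^2}$ for all $t\geq 0$; the momentum $\int_{\mathbb{T}^d}u(x,t)\,dx$ is continuous on $\mathbb{R}_+$ and $\int_{\mathbb{T}^d} u(x,t')dx=\int_{\mathbb{T}^d} u(x,t)dx+\int_t^{t'}\|u(s)\|_{\dot H^{1/2}}^2ds$ for all $t,t'\ge0$; for every $T>0$ and $k\in\mathbb{N}$ there is $\alpha_k\in(0,1)$ such that for all $0<t_0<T$ the norms $\|u\|_{C^{k+\alpha_k,\alpha_k}_{x,t}(\mathbb{T}^d\times(t_0,T))}$ and $\|\nabla_x^ku\|_{\mathrm{Lip}(\mathbb{T}^d\times(t_0,T))}$ are bounded by constants depending only on $d,k,t_0,T,\min u_0,\max u_0$; and for $t>0$ the equation holds in the classical sense. Here $C^{k+\alpha,\alpha}_{x,t}$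 is the Hölder space of functions $C^{k+\alpha}$ in $x$ uniformly in $t$ and $C^\alpha$ in $t$ uniformly in $x$, and $\mathrm{Lip}$ is the space of bounded functions Lipschitz in $(x,t)$. At $t=0$, $\min$ and $\max$ mean the essential infimum and supremum of $u_0$. *)

(* Defs.v *)
From HB Require Import structures.
From mathcomp Require Import all_boot all_order all_algebra.
From mathcomp Require Import all_classical all_reals all_analysis.
From mathcomp Require Import ess_sup_inf.
From mathcomp Require summability.

Set Implicit Arguments.
Unset Strict Implicit.
Unset Printing Implicit Defensive.

Import Order.TTheory GRing.Theory Num.Theory.
Import numFieldNormedType.Exports.

Local Open Scope classical_set_scope.
Local Open Scope ring_scope.

Definition row_display : measure_display.
Proof. exact: default_measure_display. Qed.

(* The Borel sigma-algebra of R^n, generated by the n coordinates. *)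
Section measurable_row.
Context {R : realType}.
Variable n : nat.

Let coors : 'I_n -> 'rV[R]_n -> measurableTypeR R := fun i x => x ord0 i.

Let row_set0 : g_sigma_preimage coors set0.
Proof. exact: sigma_algebra0. Qed.

Let row_setC A : g_sigma_preimage coors A -> g_sigma_preimage coors (~` A).
Proof. exact: sigma_algebraC. Qed.

Let row_bigcup (F : _^nat) : (forall i, g_sigma_preimage coors (F i)) ->
  g_sigma_preimage coors (\bigcup_i (F i)).
Proof. exact: sigma_algebra_bigcup. Qed.

HB.instance Definition _ :=
  @isMeasurable.Build row_display 'rV[R]_n
    (g_sigma_preimage coors) row_set0 row_setC row_bigcup.

Lemma measurable_coord (i : 'I_n) :
  measurable_fun [set: 'rV[R]_n] (fun x : 'rV[R]_n => x ord0 i : measurableTypeR R).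
Proof.
move=> _ Y mY; rewrite setTI; apply: sub_sigma_algebra => /=.
rewrite -bigcup_seq/=; exists i => /=; first by rewrite mem_index_enum.
by exists Y => //; rewrite setTI.
Qed.

Lemma measurable_fun_rowP d (T : measurableType d) (f : T -> 'rV[R]_n) :
  (forall i, measurable_fun [set: T] (fun t => f t ord0 i : measurableTypeR R)) ->
  measurable_fun [set: T] f.
Proof.
move=> mf; suff : g_sigma_preimage (fun (i : 'I_n) t =>
    f t ord0 i : measurableTypeR R) `<=` measurable.
  rewrite (_ : (fun i t => _) = (fun i => coors i \o f)) // g_sigma_preimage_comp.
  by move=> prefS _ A mA; apply: prefS; exists A.
apply: smallest_sub; first exact: sigma_algebra_measurable.
case: n f mf => [|m] f mf; first by rewrite big_ord0.
rewrite -bigcup_mkord_ord; apply: bigcup_sub => i Ii.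
by move=> A [B mB <-]; exact: mf.
Qed.

End measurable_row.

Lemma sigma_finite_product (R : realType) d1 d2 (T1 : measurableType d1)
    (T2 : measurableType d2) (m1 : {sigma_finite_measure set T1 -> \bar R})
    (m2 : {sigma_finite_measure set T2 -> \bar R}) :
  sigma_finite setT (m1 \x m2)%E.
Proof.
have /sigma_finiteP[F [TF ndF Foo]] := sigma_finiteT m1.
have /sigma_finiteP[G [TG ndG Goo]] := sigma_finiteT m2.
exists (fun n => F n `*` G n).
  rewrite -setXTT TF TG predeqE => -[x y]; split.
    move=> [/= [n _ Fnx] [k _ Gky]]; exists (maxn n k) => //; split.
    - by move: x Fnx; exact/subsetPset/ndF/leq_maxl.
    - by move: y Gky; exact/subsetPset/ndG/leq_maxr.
  by move=> [n _ []/= ? ?]; split; exists n.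
move=> k; have [? ?] := Foo k; have [? ?] := Goo k.
split; first exact: measurableX.
by rewrite product_measure1E// lte_mul_pinfty// ge0_fin_numE.
Qed.

Section lebesgue_row.
Context {R : realType}.

Definition cons_row n (p : measurableTypeR R * 'rV[R]_n) : 'rV[R]_n.+1 :=
  row_mx (p.1%:M : 'rV[R]_1) p.2.

Lemma cons_row0 n (p : measurableTypeR R * 'rV[R]_n) :
  cons_row p ord0 ord0 = p.1.
Proof.
rewrite /cons_row (_ : ord0 = lshift n (ord0 : 'I_1)); last exact/val_inj.
by rewrite (@row_mxEl R 1 1 n) mxE eqxx mulr1n.
Qed.

Lemma cons_rowS n (p : measurableTypeR R * 'rV[R]_n) i :
  cons_row p ord0 (lift ord0 i) = p.2 ord0 i.
Proof.
rewrite /cons_row (_ : lift ord0 i = rshift 1 i); last exact/val_inj.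
by rewrite (@row_mxEr R 1 1 n).
Qed.

Lemma measurable_cons_row n : measurable_fun setT (@cons_row n).
Proof.
apply: measurable_fun_rowP => i.
case: (unliftP ord0 i) => [j ->|->].
  under eq_fun do rewrite cons_rowS.
  exact: measurableT_comp (measurable_coord j) measurable_snd.
under eq_fun do rewrite cons_row0.
exact: measurable_fst.
Qed.

Section step.
Variables (n : nat) (mu : {sigma_finite_measure set 'rV[R]_n -> \bar R}).

Definition lebesgue_row_step : set 'rV[R]_n.+1 -> \bar R :=
  pushforward (lebesgue_measure \x mu)%E (@cons_row n).

Let step0 : lebesgue_row_step set0 = 0%E.
Proof. by rewrite /lebesgue_row_step /pushforward preimage_set0 measure0. Qed.

Let step_ge0 A : (0 <= lebesgue_row_step A)%E.
Proof. by rewrite /lebesgue_row_step /pushforward; exact: measure_ge0. Qed.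

Let step_sigma_additive : semi_sigma_additive lebesgue_row_step.
Proof.
move=> F mF tF mUF; rewrite /lebesgue_row_step /pushforward preimage_bigcup.
have mc A : measurable A -> measurable (@cons_row n @^-1` A).
  by move=> mA; rewrite -[X in measurable X]setTI; exact: measurable_cons_row.
apply: measure_semi_sigma_additive.
- by move=> k; exact: mc.
- apply/trivIsetP => /= i j _ _ ij; rewrite -preimage_setI.
  by move/trivIsetP : tF => /(_ _ _ _ _ ij) ->//; rewrite preimage_set0.
- by rewrite -preimage_bigcup; exact: mc.
Qed.

HB.instance Definition _ := isMeasure.Build _ _ _ lebesgue_row_step
  step0 step_ge0 step_sigma_additive.

Let uncons (x : 'rV[R]_n.+1) : measurableTypeR R * 'rV[R]_n :=
  (x ord0 ord0, \row_(i < n) x ord0 (lift ord0 i)).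

Let consK : cancel (@cons_row n) uncons.
Proof.
move=> [a x]; rewrite /uncons cons_row0; congr pair.
by apply/rowP => i; rewrite mxE cons_rowS.
Qed.

Let measurable_uncons : measurable_fun setT uncons.
Proof.
apply: measurable_fun_pair; first exact: measurable_coord.
apply: measurable_fun_rowP => i.
rewrite (_ : (fun t => _) =
  (fun x : 'rV[R]_n.+1 => x ord0 (lift ord0 i) : measurableTypeR R)).
  exact: measurable_coord.
by apply/funext => x; rewrite mxE.
Qed.

Let step_sigma_finite : sigma_finite setT lebesgue_row_step.
Proof.
have [F TF Foo] :=
  sigma_finite_product (@lebesgue_measure R) mu.
exists (fun k => uncons @^-1` F k).
  by rewrite -preimage_bigcup -TF preimage_setT.
move=> k; have [mF Fk] := Foo k; split.
  by rewrite -[X in measurable X]setTI; exact: measurable_uncons.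
rewrite /lebesgue_row_step /pushforward -comp_preimage.
by rewrite (_ : uncons \o _ = id) //; apply/funext => x; exact: consK.
Qed.

HB.instance Definition _ := Measure_isSigmaFinite.Build _ _ _ lebesgue_row_step
  step_sigma_finite.

End step.

Fixpoint lebesgue_row n : {sigma_finite_measure set 'rV[R]_n -> \bar R} :=
  match n with
  | 0 => dirac (0 : 'rV[R]_0)
  | m.+1 => lebesgue_row_step (lebesgue_row m)
  end.

Lemma measurable_box n (A : 'I_n -> set (measurableTypeR R)) :
  (forall i, measurable (A i)) ->
  measurable [set x : 'rV[R]_n | forall i, A i (x ord0 i)].
Proof.
move=> mA; rewrite (_ : [set x | _] = \bigcap_(i in [set: 'I_n])
    ((fun x : 'rV[R]_n => x ord0 i : measurableTypeR R) @^-1` A i)).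
  apply: fin_bigcap_measurable => // i _.
  by rewrite -[X in measurable X]setTI; exact: measurable_coord.
by apply/seteqP; split => [x Ax i _|x Ax i]; exact: Ax.
Qed.

Lemma lebesgue_row_box n (A : 'I_n -> set (measurableTypeR R)) :
  (forall i, measurable (A i)) ->
  (lebesgue_row n [set x : 'rV[R]_n | forall i, A i (x ord0 i)] =
   \prod_(i < n) lebesgue_measure (A i))%E.
Proof.
elim: n A => [|n IH] A mA.
  by rewrite big_ord0 /= diracE mem_set //=; case.
rewrite big_ord_recl -IH // -product_measure1E //=; last first.
  exact: (@measurable_box n (fun i => A (lift ord0 i))).
rewrite /lebesgue_row_step /pushforward; congr (product_measure1 _ _ _).
apply/seteqP; split => [p Ap|p [A0 AS] i].
  by split => [|i]; [rewrite -cons_row0|rewrite -cons_rowS]; exact: Ap.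
by case: (unliftP ord0 i) => [j ->|->]; rewrite ?cons_rowS ?cons_row0 //; exact: AS.
Qed.

End lebesgue_row.

Section torus_measure.
Context {R : realType}.
Variable d : nat.

(* Functions on T^d = (R / 2 pi Z)^d are represented by periodic functions on
   R^d, and T^d is integrated over its fundamental cell [0, 2 pi)^d. *)
Definition torus_cell : set 'rV[R]_d :=
  [set x | forall i, `[0, 2 * pi[%classic (x ord0 i)].

Lemma measurable_torus_cell : measurable torus_cell.
Proof.
by apply: (@measurable_box R d (fun=> `[0, 2 * pi[%classic)) => i;
  exact: measurable_itv.
Qed.

Definition torus : set 'rV[R]_d -> \bar R :=
  mrestr (lebesgue_row d) measurable_torus_cell.

HB.instance Definition _ := Measure.on torus.

Let torus_finite : fin_num_fun torus.
Proof.
move=> A mA; rewrite ge0_fin_numE //.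
apply: (@le_lt_trans _ _ (lebesgue_row d torus_cell)).
  apply: le_measure; rewrite ?inE; last exact: subIsetr.
    exact: measurableI mA measurable_torus_cell.
  exact: measurable_torus_cell.
rewrite /torus_cell.
rewrite (@lebesgue_row_box R d (fun=> `[0, 2 * pi[%classic)) //.
under eq_bigr => i _.
  rewrite lebesgue_measure_itv /= lte_fin mulr_gt0 ?pi_gt0 // -EFinB subr0.
  over.
by rewrite prodEFin ltry.
Qed.

HB.instance Definition _ := Measure_isFinite.Build _ _ _ torus torus_finite.

End torus_measure.
Arguments torus {R} d.

Section calculus.
Context {R : realType}.

Definition dot d (x y : 'rV[R]_d) : R := \sum_(i < d) x ord0 i * y ord0 i.

(* The norm of the normed module 'rV[R]_d is the sup norm, hence this one. *)
Definition enorm d (x : 'rV[R]_d) : R := Num.sqrt (dot x x).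

Definition lattice d (k : 'rV[int]_d) : 'rV[R]_d := map_mx intr k.

Definition periodic d (f : 'rV[R]_d -> R) : Prop :=
  forall x (j : 'rV[int]_d), f (x + (2 * pi) *: lattice j) = f x.

Fixpoint Ck (V : normedModType R) (k : nat) (f : V -> R) : Prop :=
  continuous f /\
  match k with
  | 0 => True
  | k'.+1 => forall v, (forall x, derivable (f : V -> R^o) x v) /\
                       Ck k' (fun x => 'D_v (f : V -> R^o) x)
  end.

Definition smooth (V : normedModType R) (f : V -> R) : Prop :=
  forall k, Ck k f.

Definition pderiv d (s : seq 'I_d) (f : 'rV[R]_d -> R) : 'rV[R]_d -> R :=
  foldr (fun i g x => 'D_(delta_mx ord0 i) (g : 'rV[R]_d -> R^o) x) f s.

Definition oriented_integral (f : R -> R) (a b : R) : R :=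
  if a <= b then \int[lebesgue_measure]_(s in `[a, b]) f s
  else - \int[lebesgue_measure]_(s in `[b, a]) f s.

End calculus.

Section half_laplacian.
Context {R : realType}.
Variable d : nat.
Implicit Types f : 'rV[R]_d -> R.

(* |nabla| on R^d: with f^(xi) = \int f(y) exp(-i xi.y) dy, this is
   (2 pi)^-d \int |xi| f^(xi) exp(i xi.x) dxi; f is real, so the imaginary parts
   of the integrand at xi and -xi cancel and only its real part is written. *)
Definition half_laplacian_space f (x : 'rV[R]_d) : R :=
  ((2 * pi) ^+ d)^-1 * \int[lebesgue_row d]_xi (enorm xi *
    ((\int[lebesgue_row d]_y (f y * cos (dot xi y))) * cos (dot xi x) +
     (\int[lebesgue_row d]_y (f y * sin (dot xi y))) * sin (dot xi x))).

(* |nabla| on T^d, the Fourier multiplier with symbol |k|, k in Z^d, written in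
   the same real form; the sum is the unconditional one. *)
Definition half_laplacian f (x : 'rV[R]_d) : R :=
  ((2 * pi) ^+ d)^-1 * summability.sum (fun k : 'rV[int]_d => (enorm (lattice k) *
    ((\int[torus d]_y (f y * cos (dot (lattice k) y))) * cos (dot (lattice k) x) +
     (\int[torus d]_y (f y * sin (dot (lattice k) y))) * sin (dot (lattice k) x))
    : R^o)).

Definition hdot_half_sq f : R :=
  \int[torus d]_x (f x * half_laplacian f x).

(* c is the constant c_d: the singular integral with kernel c / |x - y|^(d+1)
   is the Fourier multiplier |xi| on R^d, tested on C_c^oo functions. *)
Definition is_kernel_constant (c : R) : Prop :=
  0 < c /\
  forall f, smooth f -> (exists r : R, forall x, r < enorm x -> f x = 0) ->
  forall x : 'rV[R]_d,
    (fun e : R => \int[lebesgue_row d]_(y in [set y | e < enorm (x - y)])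
       (c / enorm (x - y) ^+ d.+1 * (f x - f y)))
      @ 0^'+ --> half_laplacian_space f x.

(* On the null set 2 pi Z^d, where the series diverges, the singular term counts
   as 0 because 0^-1 = 0. *)
Definition K_per (c : R) (z : 'rV[R]_d) : R :=
  fine (\esum_(j in [set: 'rV[int]_d])
    (c / enorm (z + (2 * pi) *: lattice j) ^+ d.+1)%:E).

End half_laplacian.

Section solutions.
Context {R : realType}.
Variable d : nat.
Implicit Types (u : R -> 'rV[R]_d -> R).

Definition Linfty_torus (u0 : 'rV[R]_d -> R) : Prop :=
  periodic u0 /\ u0 \in Lfun (torus d) +oo%E.

Definition ess_min (u0 : 'rV[R]_d -> R) : R :=
  fine (ess_inf (torus d) (EFin \o u0)).

Definition ess_max (u0 : 'rV[R]_d -> R) : R :=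
  fine (ess_sup (torus d) (EFin \o u0)).

Definition L2_norm (f : 'rV[R]_d -> R) : \bar R :=
  'N[torus d]_2%:E[EFin \o f]%E.

(* A test function in C^oo(R_+ x T^d) is the restriction to t >= 0 of a smooth
   function on R x T^d. *)
Definition weak_solution (c : R) (u0 : 'rV[R]_d -> R) u : Prop :=
  forall phi : R * 'rV[R]_d -> R,
  smooth phi -> (forall t : R, periodic (fun x => phi (t, x))) ->
  forall t : R, 0 <= t ->
    \int[torus d]_x (u t x * phi (t, x))
    - \int[torus d]_x (u0 x * phi (0, x))
    - \int[lebesgue_measure]_(s in `[0, t])
        (\int[torus d]_x (u s x * derive1 (fun r => phi (r, x) : R^o) s))
    = 2^-1 * \int[lebesgue_measure]_(s in `[0, t])
        (\int[(torus d \x torus d)%E]_p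
          (phi (s, p.1) * (u s p.2 - u s p.1) ^+ 2 * K_per c (p.2 - p.1)))
    + 2^-1 * \int[lebesgue_measure]_(s in `[0, t])
        (\int[(torus d \x torus d)%E]_p
          (u s p.1 * (phi (s, p.1) - phi (s, p.2)) * (u s p.2 - u s p.1)
           * K_per c (p.2 - p.1))).

(* The norm of C^{k+alpha,alpha}_{x,t}(T^d x (t0,T)). *)
Definition holder_norm (k : nat) (alpha t0 T : R) u : \bar R :=
  (\sum_(n < k.+1)
     ereal_sup [set e | exists (s : n.-tuple 'I_d) (t : R) (x : 'rV[R]_d),
       `]t0, T[%classic t /\ e = (`|pderiv s (u t) x|)%:E]
   + ereal_sup [set e | exists (s : k.-tuple 'I_d) (t : R) (x y : 'rV[R]_d),
       `]t0, T[%classic t /\ x != y /\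
       e = (`|pderiv s (u t) x - pderiv s (u t) y| / enorm (x - y) `^ alpha)%:E]
   + ereal_sup [set e | exists (t t' : R) (x : 'rV[R]_d),
       `]t0, T[%classic t /\ `]t0, T[%classic t' /\ t != t' /\
       e = (`|u t x - u t' x| / `|t - t'| `^ alpha)%:E])%E.

(* The norm of nabla_x^k u in Lip(T^d x (t0,T)). *)
Definition lip_norm (k : nat) (t0 T : R) u : \bar R :=
  (ereal_sup [set e | exists (s : k.-tuple 'I_d) (t : R) (x : 'rV[R]_d),
     `]t0, T[%classic t /\ e = (`|pderiv s (u t) x|)%:E]
   + ereal_sup [set e |
       exists (s : k.-tuple 'I_d) (t t' : R) (x y : 'rV[R]_d),
       `]t0, T[%classic t /\ `]t0, T[%classic t' /\ (t, x) != (t', y) /\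
       e = (`|pderiv s (u t) x - pderiv s (u t') y|
            / Num.sqrt ((t - t') ^+ 2 + enorm (x - y) ^+ 2))%:E])%E.

(* C k t0 T m M bounds the norms of order k on (t0, T) for all the solutions
   with min u0 = m and max u0 = M. *)
Record properties_P (C : nat -> R -> R -> R -> R -> R)
    (u0 : 'rV[R]_d -> R) u : Prop := {
  P_periodic : forall t : R, 0 <= t -> periodic (u t) ;
  P_measurable : measurable_fun ([set t : measurableTypeR R | 0 <= t] `*` setT)
    (fun p : measurableTypeR R * 'rV[R]_d => u p.1 p.2 : measurableTypeR R) ;
  P_bounded : exists M : R,
    {ae (lebesgue_measure \x torus d)%E,
      forall p : R * 'rV[R]_d, 0 <= p.1 -> `|u p.1 p.2| <= M} ;
  P_hdot_half : lebesgue_measure.-integrable `[0, +oo[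
    (fun s => (hdot_half_sq (u s))%:E) ;
  P_L2 : forall t : R, 0 <= t -> u t \in Lfun (torus d) 2%:E ;
  P_L2_continuous : forall t : R, 0 <= t ->
    L2_norm (u s \- u t)
      @[s --> within [set s | 0 <= s] (nbhs t)] --> 0%E ;
  P_initial_weak_star : forall g : 'rV[R]_d -> R, g \in Lfun (torus d) 1%E ->
    \int[torus d]_x (u t x * g x) @[t --> 0^'+] -->
    \int[torus d]_x (u0 x * g x) ;
  P_initial_L2 :
    L2_norm (u t \- u0) @[t --> 0^'+] --> 0%E ;
  P_L2_norm : forall t : R, 0 <= t ->
    L2_norm (u t) = L2_norm u0 ;
  P_momentum_continuous :
    {within [set t : R | 0 <= t], continuous (fun t : R => \int[torus d]_x u t x)} ;
  P_momentum : forall t t' : R, 0 <= t -> 0 <= t' ->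
    \int[torus d]_x u t' x = \int[torus d]_x u t x
      + oriented_integral (fun s => hdot_half_sq (u s)) t t' ;
  P_regular : forall (T : R) (k : nat), 0 < T ->
    exists alpha : R, 0 < alpha < 1 /\
    forall t0 : R, 0 < t0 < T ->
      [/\ (forall t : R, t0 < t < T -> Ck k (u t)),
          (holder_norm k alpha t0 T u
             <= (C k t0 T (ess_min u0) (ess_max u0))%:E)%E &
          (lip_norm k t0 T u
             <= (C k t0 T (ess_min u0) (ess_max u0))%:E)%E] ;
  P_classical : forall (t : R) (x : 'rV[R]_d), 0 < t ->
    is_derive t (1 : R) (fun s => u s x : R^o)
      (u t x * half_laplacian (u t) x
       - half_laplacian (fun y => u t y ^+ 2) x)
}.

Definition amplitude u (t : R) : R := sup (range (u t)) - inf (range (u t)).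

End solutions.

(* Main.v *)
From HB Require Import structures.
Require Import Defs.
From mathcomp Require Import all_boot all_order all_algebra.
From mathcomp Require Import all_classical all_reals all_analysis.
From mathcomp Require Import measurable_realfun ess_sup_inf finmap ring lra zify.
From mathcomp Require summability.

Set Implicit Arguments.
Unset Strict Implicit.
Unset Printing Implicit Defensive.

Import Order.TTheory GRing.Theory Num.Theory.
Import numFieldNormedType.Exports.

Local Open Scope classical_set_scope.
Local Open Scope ring_scope.

(** At a maximum [x] of [u t] with value [M], the right-hand side of the equation
    is [|nabla| h x] where [h := u (M - u)] is nonnegative and vanishes at [x], and
    [|nabla| h x <= - c \int h <= - c m \int (M - u)] as soon as [m <= u].  With the
    symmetric bound at a minimum, the amplitude [A] satisfies
    [A' <= - c m (2 pi)^d A] at the points where it is differentiable.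

    The bound on [|nabla| h x] holds because [|nabla|] is a limit of operators
    [f |-> \sum_z w_z (f x - f (x + z))] with symmetric nonnegative weights.  Let
    [p] be the symbol of a lazy random walk of mesh [s]; then [|k|] is the limit of
    [(2 sqrt d / s) sqrt (1 - p k)] as [s] tends to 0, and [sqrt (1 - p)] is a sum of
    terms [b_n (1 - p^n)] with [b_n >= 0].  After about [s^-2] steps the walk is
    equidistributed up to a factor 2, and these steps carry a mass bounded below
    of the weights [w_z], hence [\sum_z w_z h (x + z) >= c \int h].

    The same representation shows that [\int (m - u)_+^2] and [\int (u - M)_+^2] are
    nonincreasing for [t > 0].  They tend to 0 as [t] tends to 0 when [m] and [M] are
    the essential bounds of [u0], since [u t] tends to [u0] in [L^2].  Thus
    [m <= u t <= M] for all [t > 0], and the amplitude is at most [M - m] near 0. *)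

(** * Translation invariance on the torus *)

(** The half Laplacian is given by its Fourier series, from which no sign can be read, so positivity
    has to enter through an approximation. With random walks each approximation is a finite sum of
    translates: nonnegativity and symmetry of the weights are visible, and no singular integral has
    to be estimated. The errors are controlled on the Fourier side: the coefficients of a smooth
    function are bounded by a multiple of [omega k ^+ 2], where one factor [omega k] absorbs |k| and
    the other is summable, so that the errors are uniform in space. The way back from coefficients
    to values is Fourier inversion, obtained from positive Fejer means. The b_n are differences of
    the coefficients of (1 - x)^(-1/2); their total between q^2 and 16 q^2 is of order 1/q, which
    compensates the factor of order 1/s when q is of order 1/s. The volume (2 pi)^d enters the rate
    because the integrals of M - u and u - m add up to (2 pi)^d A. The amplitude need not be
    differentiable in time, and its differential inequality is used only through differentiable
    functions touching it from below. *)

Section torus_translation.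
Context {R : realType}.

Lemma lebesgue_measure_shift (a : R) (A : set (measurableTypeR R)) :
  measurable A ->
  pushforward (@lebesgue_measure R)
    ((fun x => x + a) : measurableTypeR R -> measurableTypeR R) A =
  lebesgue_measure A.
Proof.
move=> mA; apply/esym.
have ms : measurable_fun setT
    ((fun x => x + a) : measurableTypeR R -> measurableTypeR R).
  exact: measurable_funD.
pose ps : {mfun measurableTypeR R >-> measurableTypeR R} :=
  HB.pack ((fun x => x + a) : measurableTypeR R -> measurableTypeR R)
    (isMeasurableFun.Build _ _ _ _ _ ms).
apply: (@lebesgue_measure_unique R (pushforward (@lebesgue_measure R) ps)) => //.
move=> _ [[x y]] _ <-; rewrite /pushforward.
have E : ps @^-1` `]x, y]%classic = `]x - a, y - a]%classic.
  by apply/seteqP; split => z /=; rewrite !in_itv/= ltrBlDr lerBrDr.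
transitivity (lebesgue_measure `]x - a, y - a]%classic); last by rewrite -E.
rewrite !lebesgue_measure_itv/= !lte_fin ltrD2r.
by case: ifPn => // _; rewrite -!EFinB; congr (_%:E); ring.
Qed.

Lemma ge0_integral_shift (a : R) (D : set (measurableTypeR R))
    (f : measurableTypeR R -> \bar R) :
  measurable D -> measurable_fun setT f -> (forall x, 0 <= f x)%E ->
  (\int[lebesgue_measure]_(x in (fun x => x + a)%R @^-1` D) f (x + a)%R =
   \int[lebesgue_measure]_(x in D) f x)%E.
Proof.
move=> mD mf f0.
have ms : measurable_fun setT
    ((fun x => x + a) : measurableTypeR R -> measurableTypeR R).
  exact: measurable_funD.
rewrite -(@ge0_integral_pushforward _ _ _ _ R _ ms lebesgue_measure D f) //;
  last exact: measurable_funTS.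
by apply: eq_measure_integral => //= A mA AS; exact: lebesgue_measure_shift.
Qed.

(** Modulo the period the shift is some [r] in [0, 2 pi), and translating by [r] only moves the
    piece [0, r) of the cell to [2 pi, 2 pi + r). *)
Lemma ge0_integral_period (a : R) (f : measurableTypeR R -> \bar R) :
  measurable_fun setT f -> (forall x, 0 <= f x)%E ->
  (forall x (k : int), f (x + 2 * pi * k%:~R) = f x) ->
  (\int[lebesgue_measure]_(x in `[0%R, (2 * pi)%R[) f (x + a)%R =
   \int[lebesgue_measure]_(x in `[0%R, (2 * pi)%R[) f x)%E.
Proof.
move=> mf f0 pf.
have p0 : 0 < 2 * pi :> R by rewrite mulr_gt0 ?pi_gt0.
set k := Num.floor (a / (2 * pi)); set r := a - 2 * pi * k%:~R.
have r0 : 0 <= r.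
  by rewrite subr_ge0 mulrC -ler_pdivlMr //; exact: floor_le.
have rp : r < 2 * pi.
  rewrite ltrBlDr -{1}(mulr1 (2 * pi)) -mulrDr mulrC -ltr_pdivrMr // addrC.
  by have := Num.Theory.floorD1_gt (a / (2 * pi)); rewrite intrD.
transitivity (\int[lebesgue_measure]_(x in `[0%R, (2 * pi)%R[) f (x + r)%R)%E.
  apply: eq_integral => x _; rewrite -(pf (x + r) k) /r; congr f; ring.
have IU (x y z : R) : x <= y -> y <= z ->
    `[x, z[%classic = `[x, y[%classic `|` `[y, z[%classic :> set R.
  move=> xy yz; apply/seteqP; split => t /=; rewrite !in_itv/=.
    by case/andP => -> ->; case: (ltP t y) => ty; [left|right].
  case=> /andP[H1 H2]; first by rewrite H1 (lt_le_trans H2 yz).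
  by rewrite H2 (le_trans xy H1).
have IUd (x y z : R) : [disjoint `[x, y[%classic & `[y, z[%classic].
  apply/disj_setPS => t /= []; rewrite !in_itv /= => /andP[_ ty] /andP[yt _].
  by rewrite ltNge yt in ty.
have split_int (g : measurableTypeR R -> \bar R) (x y z : R) : x <= y -> y <= z ->
    measurable_fun setT g -> (forall t, 0 <= g t)%E ->
    (\int[lebesgue_measure]_(t in `[x, z[) g t =
     \int[lebesgue_measure]_(t in `[x, y[) g t +
     \int[lebesgue_measure]_(t in `[y, z[) g t)%E.
  move=> xy yz mg g0; rewrite (IU _ _ _ xy yz) ge0_integral_setU //.
  exact: measurable_funTS.
have sh (x y b : R) : (\int[lebesgue_measure]_(t in `[x, y[) f (t + b)%R =
    \int[lebesgue_measure]_(t in `[(x + b)%R, (y + b)%R[) f t)%E.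
  rewrite -[RHS](@ge0_integral_shift b) //; congr (integral _ _ _).
  by apply/seteqP; split => t /=; rewrite !in_itv/= lerD2r ltrD2r.
have r2 : 2 * pi <= 2 * pi + r by rewrite lerDl.
rewrite sh add0r (split_int f r (2 * pi) (2 * pi + r) (ltW rp) r2) //.
rewrite (split_int f 0 r (2 * pi) r0 (ltW rp)) // addeC; congr (_ + _)%E.
rewrite -[X in `[X, _[]add0r [(2 * pi + r)%R]addrC -sh.
by apply: eq_integral => x _; rewrite -[in RHS](pf x 1%Z) mulr1.
Qed.

Lemma ge0_integral_mrestr d (T : measurableType d)
    (mu : {measure set T -> \bar R}) (D : set T) (mD : measurable D)
    (f : T -> \bar R) : measurable_fun setT f -> (forall x, 0 <= f x)%E ->
  (\int[mrestr mu mD]_x f x = \int[mu]_(x in D) f x)%E.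
Proof.
move=> mf f0.
rewrite (@ge0_negligible_integral _ _ _ _ setT (~` D)) //; first last.
- by rewrite /= /mrestr setICl measure0.
- exact: measurableC.
rewrite setTD setCK; apply: eq_measure_integral => A mA AD.
by rewrite /= /mrestr setIidl.
Qed.

Lemma ge0_integral_torus_cell n (f : 'rV[R]_n -> \bar R) :
  measurable_fun setT f -> (forall x, 0 <= f x)%E ->
  (\int[torus n]_x f x = \int[lebesgue_row n]_(x in @torus_cell R n) f x)%E.
Proof. by move=> mf f0; exact: ge0_integral_mrestr. Qed.

Lemma ge0_integral_torusS n (f : 'rV[R]_n.+1 -> \bar R) :
  measurable_fun setT f -> (forall x, 0 <= f x)%E ->
  (\int[torus n.+1]_x f x =
   \int[lebesgue_measure]_(x in `[0%R, (2 * pi)%R[)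
     \int[torus n]_y f (cons_row (x, y)))%E.
Proof.
move=> mf f0; rewrite ge0_integral_torus_cell //.
have mc := @measurable_cons_row R n.
have mfc : measurable_fun setT (f \o @cons_row R n).
  exact: measurableT_comp.
have mcell : measurable (@cons_row R n @^-1` @torus_cell R n.+1).
  rewrite -[X in measurable X]setTI; apply: mc => //.
  exact: measurable_torus_cell.
transitivity (\int[(lebesgue_measure \x lebesgue_row n)%E]_(p in
    @cons_row R n @^-1` @torus_cell R n.+1) (f \o @cons_row R n) p)%E.
  rewrite -(@ge0_integral_pushforward _ _ _ _ R _ mc _ (@torus_cell R n.+1) f) //.
    exact: measurable_torus_cell.
  exact: measurable_funTS.
rewrite integral_mkcond fubini_tonelli1; first last.
- by move=> x; apply: erestrict_ge0 => ? _; exact: f0.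
- apply/(measurable_restrictT _ _).1 => //; exact: measurable_funTS.
rewrite [RHS]integral_mkcond; apply: eq_integral => x _.
rewrite /fubini_F patchE; case: ifPn => [xI|xI].
  rewrite ge0_integral_torus_cell //; last first.
    apply: (@measurableT_comp _ _ _ _ _ _ (f \o @cons_row R n)) => //.
  rewrite [RHS]integral_mkcond; apply: eq_integral => y _.
  rewrite !patchE; congr (if _ then _ else _).
  apply/idP/idP => /set_mem H0; apply/mem_set; move: H0;
      rewrite /preimage /torus_cell /=.
    by move=> H i; rewrite -(cons_rowS (x, y)); exact: H.
  move=> H i; case: (unliftP ord0 i) => [j ->|->].
    by rewrite cons_rowS; exact: H.
  by rewrite cons_row0; exact: (set_mem xI).
rewrite integral0_eq // => y _; rewrite patchE; case: ifPn => //.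
move=> /set_mem /= /(_ ord0); rewrite cons_row0 => H.
by case/negP: xI; exact/mem_set.
Qed.

Lemma cons_row_lattice n (x : R) (y : 'rV[R]_n) (k : int) (j : 'rV[int]_n) :
  cons_row (x + 2 * pi * k%:~R, y + (2 * pi) *: lattice j) =
  cons_row (x, y) + (2 * pi) *: lattice (row_mx k%:M j).
Proof.
apply/rowP => i; rewrite [RHS]mxE [X in _ = _ + X]mxE [X in _ = _ + _ * X]mxE.
case: (unliftP ord0 i) => [l ->|->].
  rewrite !cons_rowS /= [LHS]mxE [X in _ + X = _]mxE [X in _ + _ * X = _]mxE;
    congr (_ + _ * _%:~R).
  rewrite (_ : lift ord0 l = rshift 1 l); last exact/val_inj.
  by rewrite (@row_mxEr int 1 1 n).
rewrite !cons_row0 /=; congr (_ + _ * _%:~R).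
rewrite (_ : ord0 = lshift n (ord0 : 'I_1)); last exact/val_inj.
by rewrite (@row_mxEl int 1 1 n) mxE eqxx mulr1n.
Qed.

(** By Tonelli one coordinate is split off and treated by the one-dimensional case, the others by
    induction. Values in [0, +oo] spare integrability conditions along the induction. *)
Lemma ge0_integral_torus_shift n (f : 'rV[R]_n -> \bar R) (a : 'rV[R]_n) :
  measurable_fun setT f -> (forall x, 0 <= f x)%E ->
  (forall x (j : 'rV[int]_n), f (x + (2 * pi) *: lattice j) = f x) ->
  (\int[torus n]_x f (x + a)%R = \int[torus n]_x f x)%E.
Proof.
elim: n f a => [|n IH] f a mf f0 pf.
  by apply: eq_integral => x _; congr f; apply/rowP; case.
have ma m (b : 'rV[R]_m) : measurable_fun setT (fun x : 'rV[R]_m => x + b).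
  apply: measurable_fun_rowP => i; under eq_fun do rewrite mxE.
  by apply: measurable_funD => //; exact: measurable_coord.
have mc := @measurable_cons_row R n.
have mfc : measurable_fun setT (f \o @cons_row R n).
  exact: measurableT_comp.
have p0 m (x : 'rV[R]_m) : x = x + (2 * pi) *: lattice (0 : 'rV[int]_m).
  by apply/rowP => i; rewrite !mxE /= mulr0z mulr0 addr0.
have mfa : measurable_fun setT (fun x : 'rV[R]_n.+1 => f (x + a)).
  exact: (measurableT_comp mf (ma n.+1 a)).
rewrite !ge0_integral_torusS //.
pose g : measurableTypeR R -> \bar R :=
  fun x => (\int[torus n]_y f (cons_row (x, y)))%E.
rewrite -(@ge0_integral_period (a ord0 ord0) g).
- apply: eq_integral => x _.
  rewrite -[RHS](IH _ (\row_(i < n) a ord0 (lift ord0 i))) //.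
  + apply: eq_integral => y _; congr f; apply/rowP => i.
    rewrite mxE; case: (unliftP ord0 i) => [j ->|->].
      by rewrite !cons_rowS /= !mxE.
    by rewrite !cons_row0.
  + by apply: (@measurableT_comp _ _ _ _ _ _ (f \o @cons_row R n)).
  + move=> y j; have := cons_row_lattice (x + a ord0 ord0) y 0 j.
    by rewrite mulr0z mulr0 addr0 => ->; rewrite pf.
- apply: (@measurable_fun_fubini_tonelli_F _ _ _ _ R (torus n)
    (f \o @cons_row R n)) => // x; exact: f0.
- by move=> x; apply: integral_ge0 => y _; exact: f0.
move=> x k; rewrite /g; apply: eq_integral => y _.
by rewrite [in LHS](p0 _ y) cons_row_lattice pf.
Qed.

End torus_translation.

(** * Continuous periodic functions and their integrals *)

Section torus_functions.
Context {R : realType} {d : nat}.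
Implicit Types f g : 'rV[R]_d -> R.

Lemma rV_norm_le (x : 'rV[R]_d) (e : R) :
  0 <= e -> (forall i, `|x ord0 i| <= e) -> `|x| <= e.
Proof.
move=> e0 H; rewrite /Num.norm /= mx_normrE; apply: bigmax_le => //= -[i j] _ /=.
by rewrite (ord1 i); exact: H.
Qed.

(** The sigma-algebra is generated by the coordinates, not by the open sets, so measurability comes
    from approximation: [r n] rounds each coordinate down to a multiple of 1/(n+1), and [f \o r n]
    is constant on each of the countably many boxes of this grid. *)
Lemma continuous_measurable_row f : continuous f ->
  measurable_fun setT (f : 'rV[R]_d -> measurableTypeR R).
Proof.
move=> cf.
pose r (n : nat) (x : 'rV[R]_d) : 'rV[R]_d :=
  \row_i ((Num.floor (n.+1%:R * x ord0 i))%:~R / n.+1%:R).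
apply: (@measurable_fun_cvg _ _ R setT (fun n x => f (r n x))) => [n|x _].
  move=> _ B mB; rewrite setTI.
  pose Q (k : 'rV[int]_d) := \row_i ((k ord0 i)%:~R / n.+1%:R : R).
  pose S (k : 'rV[int]_d) : set 'rV[R]_d :=
    [set x | forall i, [set t : R | Num.floor (n.+1%:R * t) = k ord0 i] (x ord0 i)].
  rewrite (_ : _ @^-1` _ = \bigcup_k (if `[< B (f (Q k)) >] then S k else set0)).
    apply: countable_bigcupT_measurable => [|k]; first exact: countableP.
    case: ifPn => // _.
    apply: (@measurable_box R d (fun i => [set t : R | Num.floor (n.+1%:R * t) = k ord0 i])) => i.
    rewrite (_ : [set _ | _] = `[(k ord0 i)%:~R / n.+1%:R,
        (k ord0 i + 1)%:~R / n.+1%:R[%classic).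
      exact: measurable_itv.
    apply/seteqP; split => t /=; rewrite in_itv /= ler_pdivrMr ?ltr_pdivlMr //.
      by move=> <-; rewrite (mulrC t); exact: floor_itv.
    by rewrite mulrC => /andP[? ?]; apply/floor_def/andP.
  apply/seteqP; split => y /=.
    move=> Bf; exists (\row_i Num.floor (n.+1%:R * y ord0 i)) => //.
    rewrite (_ : Q _ = r n y); last by apply/rowP => i; rewrite !mxE.
    by case: asboolP => // _ i; rewrite /= mxE.
  case=> k _; case: asboolP => // BQ Sk.
  by rewrite (_ : r n y = Q k) //; apply/rowP => i; rewrite !mxE Sk.
have : r n x @[n --> \oo] --> x.
  apply/cvgrPdist_le => e e0; near=> n.
  apply: rV_norm_le => [|i]; first exact: ltW.
  rewrite !mxE.
  have n0 : 0 < n.+1%:R :> R by [].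
  have /andP[h1 h2] := floor_itv (n.+1%:R * x ord0 i).
  rewrite intrD in h2.
  rewrite -(ler_pM2l n0) -{1}(ger0_norm (ltW n0)) -normrM mulrBr.
  rewrite [n.+1%:R * (_ / _)]mulrC divfK ?gt_eqF // ger0_norm ?subr_ge0 //.
  apply: (@le_trans _ _ 1); first by rewrite lerBlDl; exact: ltW.
  rewrite -ler_pdivrMl // mulr1 ltW //.
  by near: n; exact: (near_infty_natSinv_lt (PosNum e0)).
by move=> /(cvg_comp _ _)/(_ (cf x)).
Unshelve. all: end_near. Qed.

Lemma torus_cellP (x : 'rV[R]_d) :
  exists j : 'rV[int]_d, torus_cell (x + (2 * pi) *: lattice j).
Proof.
have p0 : 0 < 2 * pi :> R by rewrite mulr_gt0 ?pi_gt0.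
exists (\row_i (- Num.floor (x ord0 i / (2 * pi)))) => i /=.
rewrite !mxE in_itv /= intrN mulrN.
have /andP[h1 h2] := floor_itv (x ord0 i / (2 * pi)).
rewrite subr_ge0 mulrC -ler_pdivlMr // h1 /=.
by rewrite ltrBlDr -{1}(mulr1 (2 * pi)) [X in _ + X]mulrC -mulrDr mulrC
  -ltr_pdivrMr // addrC -[1]/(1%:~R) -intrD.
Qed.

Definition cper f := continuous f /\ Defs.periodic f.

Lemma cper_max f : cper f -> exists x, forall y, f y <= f x.
Proof.
move=> [cf pf].
pose A : set 'rV[R]_d := [set x | forall i, `[0, 2 * pi]%classic (x ord0 i)].
have p0 : 0 < 2 * pi :> R by rewrite mulr_gt0 ?pi_gt0.
have cA : compact A.
  by apply: (@rV_compact R d (fun=> `[0, 2 * pi]%classic)) => i; exact: segment_compact.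
have A0 : A !=set0.
  by exists 0 => i; rewrite /= mxE in_itv /= lexx ltW.
have [|x _ xm] := EVT_max_rV A0 cA (f := f).
  exact: continuous_subspaceT.
exists x => y; have [j cj] := torus_cellP y; rewrite -(pf y j); apply: xm.
by apply/mem_set => i; have := cj i; rewrite /= !in_itv /= => /andP[-> /ltW ->].
Qed.

Lemma cper_cst (c : R) : cper (fun=> c).
Proof. by split => [|x j //]; exact: cst_continuous. Qed.

Lemma cperD f g : cper f -> cper g -> cper (fun x => f x + g x).
Proof.
move=> [cf pf] [cg pg]; split => [x|x j]; last by rewrite pf pg.
exact: (cvgD (cf x) (cg x)).
Qed.

Lemma cperM f g : cper f -> cper g -> cper (fun x => f x * g x).
Proof.
move=> [cf pf] [cg pg]; split => [x|x j]; last by rewrite pf pg.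
exact: (cvgM (cf x) (cg x)).
Qed.

Lemma cper_comp (h : R -> R) f : continuous h -> cper f -> cper (fun x => h (f x)).
Proof.
move=> ch [cf pf]; split => [x|x j]; last by rewrite pf.
exact: (cvg_comp f h (cf x) (ch _)).
Qed.

Lemma cperN f : cper f -> cper (fun x => - f x).
Proof. by apply: cper_comp => x; exact: opp_continuous. Qed.

Lemma cperB f g : cper f -> cper g -> cper (fun x => f x - g x).
Proof. by move=> cf /cperN; exact: cperD. Qed.

Lemma cperZ (c : R) f : cper f -> cper (fun x => c * f x).
Proof. by apply: cperM; exact: cper_cst. Qed.

Lemma cper_sum (I : Type) (s : seq I) (F : I -> 'rV[R]_d -> R) :
  (forall i, cper (F i)) -> cper (fun x => \sum_(i <- s) F i x).
Proof.
move=> cF; elim: s => [|i s IH].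
  by under eq_fun do rewrite big_nil; exact: cper_cst.
by under eq_fun do rewrite big_cons; exact: cperD.
Qed.

Lemma cper_shift f a : cper f -> cper (fun x => f (x + a)).
Proof.
move=> [cf pf]; split => [x|x j]; last by rewrite addrAC pf.
have ca : (y + a) @[y --> x] --> x + a.
  by apply: (@cvgD _ _ _ (nbhs x) _ (fun y => y) (fun=> a));
    [exact: cvg_id|exact: cvg_cst].
exact: (cvg_comp _ f ca (cf (x + a))).
Qed.

Lemma cper_bounded f : cper f -> exists M : R, 0 <= M /\ forall x, `|f x| <= M.
Proof.
move=> cf; have [x xm] := cper_max (cper_comp (@norm_continuous _ _) cf).
by exists `|f x|; split.
Qed.

Lemma torus_setT : torus d setT = ((2 * pi : R) ^+ d)%:E.
Proof.
rewrite /torus /mrestr setTI /torus_cell.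
rewrite (@lebesgue_row_box R d (fun=> `[0, 2 * pi[%classic)) //.
under eq_bigr => i _.
  rewrite lebesgue_measure_itv /= lte_fin mulr_gt0 ?pi_gt0 // -EFinB subr0.
  over.
by rewrite prodEFin prodr_const card_ord.
Qed.

Lemma cper_integrable f : cper f -> (torus d).-integrable setT (EFin \o f).
Proof.
move=> cf; have [M [M0 fM]] := cper_bounded cf.
apply: measurable_bounded_integrable => //.
- have H : (torus d [set: 'rV[R]_d] < +oo)%E by rewrite torus_setT ltry.
  exact: H.
- by case: cf => + _; exact: continuous_measurable_row.
by exists M; split => [|y My x _]; [exact: num_real|exact: le_trans (fM x) (ltW My)].
Qed.

Lemma tintegral_cst (c : R) : \int[torus d]_x c = c * (2 * pi) ^+ d.
Proof.
have H := @Rintegral_cst _ _ R (torus d) setT measurableT c.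
by rewrite H -[(2 * pi) ^+ d]/(fine ((2 * pi) ^+ d)%:E) -torus_setT.
Qed.

Lemma tintegralD f g : cper f -> cper g ->
  \int[torus d]_x (f x + g x) = \int[torus d]_x f x + \int[torus d]_x g x.
Proof. by move=> /cper_integrable cf /cper_integrable cg; exact: RintegralD. Qed.

Lemma tintegralB f g : cper f -> cper g ->
  \int[torus d]_x (f x - g x) = \int[torus d]_x f x - \int[torus d]_x g x.
Proof. by move=> /cper_integrable cf /cper_integrable cg; exact: RintegralB. Qed.

Lemma tintegralZ (c : R) f : cper f ->
  \int[torus d]_x (c * f x) = c * \int[torus d]_x f x.
Proof. by move=> /cper_integrable cf; exact: RintegralZl. Qed.

Lemma tintegral_sum (I : Type) (s : seq I) (F : I -> 'rV[R]_d -> R) :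
  (forall i, cper (F i)) ->
  \int[torus d]_x (\sum_(i <- s) F i x) = \sum_(i <- s) \int[torus d]_x F i x.
Proof.
move=> cF; elim: s => [|i s IH].
  by under eq_Rintegral do rewrite big_nil; rewrite tintegral_cst mul0r big_nil.
under eq_Rintegral do rewrite big_cons.
by rewrite tintegralD ?IH ?big_cons //; exact: cper_sum.
Qed.

Lemma le_tintegral f g : cper f -> cper g -> (forall x, f x <= g x) ->
  \int[torus d]_x f x <= \int[torus d]_x g x.
Proof.
by move=> /cper_integrable cf /cper_integrable cg fg; exact: le_Rintegral.
Qed.

Lemma tintegral_norm_le f (M : R) : cper f -> (forall x, `|f x| <= M) ->
  `|\int[torus d]_x f x| <= M * (2 * pi) ^+ d.
Proof.
move=> cf fM; rewrite -tintegral_cst ler_norml -mulN1r -tintegralZ; last exact: cper_cst.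
apply/andP; split; apply: le_tintegral => //; try exact: cper_cst.
- by move=> x; rewrite mulN1r; have := fM x; rewrite ler_norml => /andP[].
- by move=> x; have := fM x; rewrite ler_norml => /andP[].
Qed.

Lemma tintegral_shift f a : cper f ->
  \int[torus d]_x f (x + a) = \int[torus d]_x f x.
Proof.
move=> cf; have [M [M0 fM]] := cper_bounded cf.
(* Adding the bound [M] makes the integrand nonnegative, the case in which translation invariance is
   available. *)
have cfM := cperD cf (cper_cst M).
have : \int[torus d]_x (f (x + a) + M) = \int[torus d]_x (f x + M).
  rewrite /Rintegral; congr fine.
  have := @ge0_integral_torus_shift R d (fun x => (f x + M)%:E) a; apply.
  - by apply/measurable_EFinP; apply: continuous_measurable_row; case: cfM.
  - move=> x; rewrite lee_fin -lerBlDr sub0r.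
    by have := fM x; rewrite ler_norml => /andP[].
  - by move=> x j; rewrite (proj2 cf).
rewrite !tintegralD //; try exact: cper_cst; try exact: cper_shift.
exact: addIr.
Qed.

(** By translation invariance the integral of [f (y + s *: v)] does not depend on [s]; its
    derivative at [s = 0], taken under the integral sign, is the left-hand side. Integration by
    parts on the torus rests on this. *)
Lemma tintegral_derive f v : cper f ->
  (forall x, derivable (f : 'rV[R]_d -> R^o) x v) ->
  cper (fun x => 'D_v (f : 'rV[R]_d -> R^o) x) ->
  \int[torus d]_x ('D_v (f : 'rV[R]_d -> R^o) x) = 0.
Proof.
move=> cf df cDf; have [M [M0 fM]] := cper_bounded cDf.
pose F (s : R) (y : 'rV[R]_d) : R := f (y + s *: v).
have isd s y : is_derive s (1 : R) (F ^~ y : R -> R^o) ('D_v (f : 'rV[R]_d -> R^o) (y + s *: v)).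
  have E : (fun h : R => h^-1 *: ((F ^~ y \o shift s) (h *: (1 : R)) - F s y : R^o)) =
      (fun h : R => h^-1 *: ((f \o shift (y + s *: v)) (h *: v) - f (y + s *: v) : R^o)).
    apply/funext => h; rewrite /F /= [h *: 1]mulr1 scalerDl; congr (_ *: (f _ - _)).
    by rewrite addrCA.
  have dF := df (y + s *: v).
  by split; rewrite /derivable /derive E.
have pE s y : partial1of2 F s y = 'D_v (f : 'rV[R]_d -> R^o) (y + s *: v).
  by rewrite partial1of2E; have := isd s y => -[_ ->].
have I0 : (`]-1, 1[%classic : set R) 0 by rewrite /= in_itv /=; apply/andP; split; lra.
have H := @differentiation_under_integral R _ _ (torus d) F setT measurableT
  0 (-1) 1 I0 _ _ (fun=> M) _ _ _.
have : derive1 (fun s => \int[torus d]_y F s y) 0 = 0.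
  rewrite (_ : (fun s => _) = cst (\int[torus d]_y f y)).
    exact: derive1_cst.
  by apply/funext => s; rewrite /F tintegral_shift.
rewrite H => [<-|s _|s y _ _|//||s y _ _].
- by apply: eq_Rintegral => y _; rewrite pE scale0r addr0.
- by apply: cper_integrable; exact: cper_shift.
- by have := isd s y => -[].
- by apply: cper_integrable; exact: cper_cst.
- by rewrite pE.
Qed.

End torus_functions.

(** * Smooth periodic functions and their Fourier coefficients *)

Section smooth_functions.
Context {R : realType}.

Lemma is_derive_line (V : normedModType R) (f : V -> R^o) (x v : V) (df : R^o) :
  is_derive (0 : R) (1 : R) (fun h : R => f (x + h *: v)) df -> is_derive x v f df.
Proof.
have E : (fun h : R => h^-1 *: (((fun h : R => f (x + h *: v)) \o shift 0)
      (h *: (1 : R)) - f (x + (0 : R) *: v))) =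
    (fun h : R => h^-1 *: ((f \o shift x) (h *: v) - f x)).
  apply/funext => h /=; rewrite [h *: 1]mulr1 addr0 scale0r addr0.
  by rewrite [x + _]addrC.
by case; rewrite /derivable /derive E => h1 h2; split.
Qed.

Section Ck_theory.
Context {V : normedModType R}.
Implicit Types f g : V -> R.

Lemma Ck_continuous k f : Ck k f -> continuous f.
Proof. by case: k => [[]|k []]. Qed.
Arguments Ck_continuous {k f} _ _.

Lemma Ck_derivable k f x v : Ck k.+1 f -> derivable (f : V -> R^o) x v.
Proof. by move=> [_ /(_ v) []]. Qed.
Arguments Ck_derivable {k f} x v _.

Lemma Ck_derive k f v : Ck k.+1 f -> Ck k (fun x => 'D_v (f : V -> R^o) x).
Proof. by move=> [_ /(_ v) []]. Qed.

Lemma CkW k f : Ck k.+1 f -> Ck k f.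
Proof.
elim: k f => [|k IH] f [cf H]; first by split.
by split => // v; have [dv Cv] := H v; split => //; exact: IH.
Qed.

Lemma CkD k f g : Ck k f -> Ck k g -> Ck k (fun x => f x + g x).
Proof.
elim: k f g => [|k IH] f g Cf Cg.
  split => // x.
  exact: (cvgD (Ck_continuous Cf x) (Ck_continuous Cg x)).
split=> [x|v].
  exact: (cvgD (Ck_continuous Cf x) (Ck_continuous Cg x)).
split=> [x|].
  by apply: (@derivableD _ _ R^o f g);
    [exact: Ck_derivable Cf|exact: Ck_derivable Cg].
rewrite (_ : (fun x => _) = (fun x => 'D_v (f : V -> R^o) x + 'D_v (g : V -> R^o) x)).
  by apply: IH; exact: Ck_derive.
apply/funext => x; rewrite -(@deriveD _ _ R^o f g) //.
  exact: Ck_derivable Cf.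
exact: Ck_derivable Cg.
Qed.

Lemma CkM k f g : Ck k f -> Ck k g -> Ck k (fun x => f x * g x).
Proof.
elim: k f g => [|k IH] f g Cf Cg.
  split => // x.
  exact: (cvgM (Ck_continuous Cf x) (Ck_continuous Cg x)).
split=> [x|v].
  exact: (cvgM (Ck_continuous Cf x) (Ck_continuous Cg x)).
split=> [x|].
  by apply: (@derivableM _ _ f g);
    [exact: Ck_derivable Cf|exact: Ck_derivable Cg].
rewrite (_ : (fun x => _) = (fun x => f x * 'D_v (g : V -> R^o) x +
                              g x * 'D_v (f : V -> R^o) x)).
  by apply: CkD; apply: IH; do ?[exact: CkW|exact: Ck_derive].
apply/funext => x; rewrite -(@deriveM _ _ f g) //.
  exact: Ck_derivable Cf.
exact: Ck_derivable Cg.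
Qed.

Lemma Ck_cst k (c : R) : Ck k (fun _ : V => c).
Proof.
elim: k c => [|k IH] c; first by split => // x; exact: cst_continuous.
split=> [x|v]; first exact: cst_continuous.
split=> [x|]; first exact: (@derivable_cst _ _ R^o).
have -> : (fun x => 'D_v ((fun=> c) : V -> R^o) x) = (fun=> 0).
  by apply/funext => x; rewrite (@derive_cst _ _ R^o).
exact: IH.
Qed.

End Ck_theory.
Arguments Ck_continuous {V k f} _ _.
Arguments Ck_derivable {V k f} x v _.
Arguments Ck_derive {V k f} v _.

Context {d : nat}.
Implicit Types f g : 'rV[R]_d -> R.

Definition psmooth f := smooth f /\ Defs.periodic f.

Lemma psmooth_cper f : psmooth f -> cper f.
Proof. by move=> [sf pf]; split => //; exact: (Ck_continuous (sf 0%N)). Qed.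

Lemma psmooth_derivable f x v : psmooth f -> derivable (f : 'rV[R]_d -> R^o) x v.
Proof. by move=> [sf _]; exact: (Ck_derivable x v (sf 1%N)). Qed.

Lemma psmooth_derive f v : psmooth f ->
  psmooth (fun x => 'D_v (f : 'rV[R]_d -> R^o) x).
Proof.
move=> [sf pf]; split=> [k|x j]; first exact (Ck_derive v (sf k.+1)).
have E : (fun h : R => h^-1 *: ((f \o shift (x + (2 * pi) *: lattice j)) (h *: v) -
      f (x + (2 * pi) *: lattice j) : R^o)) =
    (fun h : R => h^-1 *: ((f \o shift x) (h *: v) - f x : R^o)).
  by apply/funext => h /=; rewrite addrA pf pf.
by rewrite /derive E.
Qed.

Lemma psmoothD f g : psmooth f -> psmooth g -> psmooth (fun x => f x + g x).
Proof.
move=> [sf pf] [sg pg]; split=> [k|x j]; last by rewrite pf pg.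
exact: CkD.
Qed.

Lemma psmoothM f g : psmooth f -> psmooth g -> psmooth (fun x => f x * g x).
Proof.
move=> [sf pf] [sg pg]; split=> [k|x j]; last by rewrite pf pg.
exact: CkM.
Qed.

Lemma psmooth_cst (c : R) : psmooth (fun=> c).
Proof. by split => // k; exact: Ck_cst. Qed.

Lemma psmoothZ (c : R) f : psmooth f -> psmooth (fun x => c * f x).
Proof. exact: psmoothM (psmooth_cst c). Qed.

Lemma psmoothB f g : psmooth f -> psmooth g -> psmooth (fun x => f x - g x).
Proof.
move=> sf /(psmoothZ (-1)) sg.
rewrite (_ : (fun x => _) = (fun x => f x + -1 * g x)); first exact: psmoothD.
by apply/funext => x; rewrite mulN1r.
Qed.

End smooth_functions.

(** * Fourier modes of smooth functions and the decay of their coefficients *)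

Section fourier_modes.
Context {R : realType} {d : nat}.
Implicit Types (f g : 'rV[R]_d -> R) (k : 'rV[int]_d).

Lemma dotDr (x y z : 'rV[R]_d) : dot x (y + z) = dot x y + dot x z.
Proof. by rewrite /dot -big_split /=; apply: eq_bigr => i _; rewrite mxE mulrDr. Qed.

Lemma dotZr (a : R) (x y : 'rV[R]_d) : dot x (a *: y) = a * dot x y.
Proof. by rewrite /dot mulr_sumr; apply: eq_bigr => i _; rewrite mxE mulrCA. Qed.

Lemma dotNr (x y : 'rV[R]_d) : dot x (- y) = - dot x y.
Proof. by rewrite -scaleN1r dotZr mulN1r. Qed.

Lemma dotC (x y : 'rV[R]_d) : dot x y = dot y x.
Proof. by apply: eq_bigr => i _; rewrite mulrC. Qed.

Lemma dot_delta (x : 'rV[R]_d) i : dot x (delta_mx ord0 i) = x ord0 i.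
Proof.
rewrite /dot (bigD1 i) //= mxE !eqxx mulr1 big1 ?addr0 // => j ji.
by rewrite mxE eqxx (negbTE ji) mulr0.
Qed.

Lemma dot_lattice (k j : 'rV[int]_d) : exists z : int,
  dot (lattice k) (lattice j) = z%:~R :> R.
Proof.
exists (\sum_i k ord0 i * j ord0 i); rewrite /dot rmorph_sum /=.
by apply: eq_bigr => i _; rewrite !mxE intrM.
Qed.

Lemma cosDpi2z (x : R) (z : int) : cos (x + 2 * pi * z%:~R) = cos x.
Proof.
have H n y : cos (y + 2 * pi * n%:R) = cos y :> R.
  elim: n y => [|n IH] y; first by rewrite mulr0 addr0.
  by rewrite -[n.+1%:R]natr1 mulrDr mulr1 addrA mulr_natl cosD2pi -mulr_natl IH.
case: z => n; first by rewrite H.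
by rewrite NegzE mulrNz mulrN -[in LHS](H n.+1) subrK.
Qed.

Lemma dot_continuous (x : 'rV[R]_d) : continuous (dot x).
Proof.
rewrite (_ : dot x = fun y => \sum_(i < d) x ord0 i * y ord0 i) //.
elim: (index_enum _) => [|i s IH].
  by under eq_fun do rewrite big_nil; exact: cst_continuous.
under eq_fun do rewrite big_cons.
move=> y; have cc : z ord0 i @[z --> y] --> y ord0 i by exact: coord_continuous.
have c1 : x ord0 i @[z --> (y : 'rV[R]_d)] --> x ord0 i.
  exact: (@cst_continuous _ _ (x ord0 i) y).
exact: (cvgD (cvgM c1 cc) (IH y)).
Qed.

Lemma cper_cosmode k (a : R) : cper (fun x : 'rV[R]_d => cos (a + dot (lattice k) x)).
Proof.
split=> [x|x j].
  apply: (cvg_comp _ cos); last exact: continuous_cos.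
  have c1 : a @[z --> (x : 'rV[R]_d)] --> a by exact: (@cst_continuous _ _ a x).
  exact: (cvgD c1 (@dot_continuous (lattice k) x)).
have [z Ez] := dot_lattice k j.
by rewrite dotDr dotZr Ez addrA cosDpi2z.
Qed.

Lemma is_derive_cosmode k (a : R) (x v : 'rV[R]_d) :
  is_derive x v (fun x => cos (a + dot (lattice k) x) : R^o)
    (- sin (a + dot (lattice k) x) * dot (lattice k) v).
Proof.
apply: is_derive_line.
rewrite (_ : (fun h => _) = (fun h : R => cos ((a + dot (lattice k) x) + h * dot (lattice k) v))).
  apply: (@is_derive_eq _ _ _ _ _ _ _ _).
  by rewrite mul0r addr0 scaler0 !add0r mul1r [_%:A]mulr1.
by apply/funext => h; rewrite dotDr dotZr addrA.
Qed.

Lemma cper_sinmode k (a : R) : cper (fun x : 'rV[R]_d => sin (a + dot (lattice k) x)).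
Proof.
under eq_fun do rewrite -cosBpihalf addrAC.
exact: cper_cosmode.
Qed.

Lemma is_derive_sinmode k (a : R) (x v : 'rV[R]_d) :
  is_derive x v (fun x => sin (a + dot (lattice k) x) : R^o)
    (cos (a + dot (lattice k) x) * dot (lattice k) v).
Proof.
under eq_fun do rewrite -cosBpihalf addrAC.
have := is_derive_cosmode k (a - pi / 2) x v.
by rewrite addrAC sinBpihalf opprK.
Qed.

(** The phase [a] keeps everything real and treats both families of modes at once: [a = 0] gives the
    cosine coefficient and [a = - (pi / 2)] the sine coefficient. *)
Definition fmode f k (a : R) : R :=
  \int[torus d]_y (f y * cos (a + dot (lattice k) y)).

(** If k_i is not 0, the cosine mode is the i-th partial derivative of the sine mode divided by
    k_i. *)
Lemma tintegral_cosmode k (a : R) : k != 0 ->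
  \int[torus d]_y cos (a + dot (lattice k) y) = 0.
Proof.
move=> k0; have [i ki] : exists i, k ord0 i != 0.
  apply/existsP; apply: contra_neqT k0 => /existsPn H.
  by apply/rowP => i; rewrite mxE; apply/eqP; rewrite -[_ == _]negbK H.
have ki0 : (k ord0 i)%:~R != 0 :> R by rewrite intr_eq0.
have E : (fun x : 'rV[R]_d => 'D_(delta_mx ord0 i)
    (fun x => sin (a + dot (lattice k) x) : R^o) x) =
    (fun x => (k ord0 i)%:~R * cos (a + dot (lattice k) x)).
  apply/funext => x.
  have [_ ->] := is_derive_sinmode k a x (delta_mx ord0 i).
  by rewrite dot_delta mxE mulrC.
have H := @tintegral_derive R d (fun x => sin (a + dot (lattice k) x)) (delta_mx ord0 i).
move: H; rewrite E tintegralZ; last exact: cper_cosmode.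
move=> H; apply: (mulfI ki0); rewrite mulr0; apply: H.
- exact: cper_sinmode.
- by move=> x; have [] := is_derive_sinmode k a x (delta_mx ord0 i).
- by apply: cperZ; exact: cper_cosmode.
Qed.

Lemma fmode_ibp f k (a : R) i : psmooth f ->
  fmode (fun x => 'D_(delta_mx ord0 i) (f : 'rV[R]_d -> R^o) x) k a =
  (k ord0 i)%:~R * \int[torus d]_y (f y * sin (a + dot (lattice k) y)).
Proof.
move=> sf; have cf := psmooth_cper sf.
have cDf := psmooth_cper (psmooth_derive (delta_mx ord0 i) sf).
have cc := cper_cosmode k a; have cs := cper_sinmode k a.
have isd x : is_derive x (delta_mx ord0 i)
    (f * (fun x => cos (a + dot (lattice k) x)) : 'rV[R]_d -> R^o)
    ('D_(delta_mx ord0 i) (f : 'rV[R]_d -> R^o) x * cos (a + dot (lattice k) x) -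
     (k ord0 i)%:~R * (f x * sin (a + dot (lattice k) x))).
  have df := DeriveDef (@psmooth_derivable R d f x (delta_mx ord0 i) sf) erefl.
  have dc := is_derive_cosmode k a x (delta_mx ord0 i).
  apply: (is_derive_eq (is_deriveM df dc)).
  by rewrite dot_delta mxE /GRing.scale /=; ring.
have E : (fun x => 'D_(delta_mx ord0 i)
    (f * (fun x => cos (a + dot (lattice k) x)) : 'rV[R]_d -> R^o) x) =
   fun x => 'D_(delta_mx ord0 i) (f : 'rV[R]_d -> R^o) x * cos (a + dot (lattice k) x) -
     (k ord0 i)%:~R * (f x * sin (a + dot (lattice k) x)).
  by apply/funext => x; have [_ ->] := isd x.
have := @tintegral_derive R d (f * (fun x => cos (a + dot (lattice k) x))) (delta_mx ord0 i).
rewrite E tintegralB ?tintegralZ; do ?[exact: cperM|apply: cperZ; exact: cperM].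
move=> H; apply/eqP; rewrite -subr_eq0; apply/eqP; apply: H.
- exact: cperM.
- by move=> x; have [] := isd x.
- by apply: cperB; [exact: cperM|apply: cperZ; exact: cperM].
Qed.

Lemma fmode_sinE f k (a : R) :
  \int[torus d]_y (f y * sin (a + dot (lattice k) y)) = fmode f k (a - pi / 2).
Proof. by apply: eq_Rintegral => y _; rewrite addrAC cosBpihalf. Qed.

Lemma fmodeDpi f k (a : R) : cper f -> fmode f k (a + pi) = - fmode f k a.
Proof.
move=> cf; rewrite -mulN1r /fmode -tintegralZ; last first.
  by apply: cperM => //; exact: cper_cosmode.
by apply: eq_Rintegral => y _; rewrite addrAC cosDpi; ring.
Qed.

(* The Fourier multiplier [1 + k_i ^ 2]. *)
Definition bessel i f : 'rV[R]_d -> R := fun x =>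
  f x - 'D_(delta_mx ord0 i) (fun y => 'D_(delta_mx ord0 i) (f : 'rV[R]_d -> R^o) y : R^o) x.

Lemma psmooth_bessel i f : psmooth f -> psmooth (bessel i f).
Proof.
by move=> sf; apply: psmoothB => //; apply: psmooth_derive; exact: psmooth_derive.
Qed.

(** Each integration by parts multiplies by k_i and turns the phase by - pi / 2; after two of them
    the phase has turned by - pi, which is a change of sign. *)
Lemma fmode_bessel i f k (a : R) : psmooth f ->
  fmode (bessel i f) k a = (1 + (k ord0 i)%:~R ^+ 2) * fmode f k a.
Proof.
move=> sf; have sDf := psmooth_derive (delta_mx ord0 i) sf.
have sDDf := psmooth_derive (delta_mx ord0 i) sDf.
have H : fmode (fun x => 'D_(delta_mx ord0 i)
    (fun y => 'D_(delta_mx ord0 i) (f : 'rV[R]_d -> R^o) y : R^o) x) k a =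
    - (k ord0 i)%:~R ^+ 2 * fmode f k a.
  rewrite (fmode_ibp _ _ _ sDf) fmode_sinE (fmode_ibp _ _ _ sf) fmode_sinE.
  rewrite (_ : a - pi / 2 - pi / 2 = a - pi); last by field.
  rewrite -{2}[a](subrK pi) fmodeDpi; last exact: psmooth_cper.
  by ring.
rewrite mulrDl mul1r -[X in _ + X]opprK -mulNr -H -tintegralB.
- by apply: eq_Rintegral => y _; rewrite /bessel mulrBl.
- by apply: cperM; [exact: psmooth_cper|exact: cper_cosmode].
- by apply: cperM; [exact: psmooth_cper|exact: cper_cosmode].
Qed.

(** The inverse of the multiplier obtained by applying [bessel] once in every direction. The product
    form makes its lattice sum factor, and it is at most 1 / (1 + |k|^2). *)
Definition omega k : R := \prod_(i < d) (1 + (k ord0 i)%:~R ^+ 2)^-1.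

(** [bessel] is applied twice in every direction, and the coefficients of the resulting function are
    bounded by its supremum. Two powers of [omega] are wanted: one to absorb the symbol |k|, one to
    sum over the lattice. *)
Lemma fmode_decay f : psmooth f -> exists B : R, 0 <= B /\
  forall k a, `|fmode f k a| <= B * omega k ^+ 2.
Proof.
move=> sf.
have H (l : seq 'I_d) : exists2 B : R, 0 <= B & forall k a, `|fmode f k a| <=
    B * \prod_(i <- l) (1 + (k ord0 i)%:~R ^+ 2)^-1.
  have [sg Eg] : psmooth (foldr bessel f l) /\ forall k a, fmode (foldr bessel f l) k a =
      (\prod_(i <- l) (1 + (k ord0 i)%:~R ^+ 2)) * fmode f k a.
    elim: l => [|i l [IH1 IH2]] /=; first by split => // k a; rewrite big_nil mul1r.
    split => [|k a]; first exact: psmooth_bessel.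
    by rewrite fmode_bessel // IH2 big_cons mulrA.
  have [M [M0 HM]] := cper_bounded (psmooth_cper sg).
  exists (M * (2 * pi) ^+ d); first by rewrite mulr_ge0 // exprn_ge0 // mulr_ge0 // pi_ge0.
  move=> k a; set P := \prod_(i <- l) (1 + (k ord0 i)%:~R ^+ 2) : R.
  have P0 : 0 < P by apply: prodr_gt0 => i _; rewrite ltr_pwDl // sqr_ge0.
  rewrite (_ : \prod_(i <- l) _ = P^-1); last by rewrite prodfV.
  rewrite ler_pdivlMr // -{1}(gtr0_norm P0) -normrM mulrC -Eg.
  apply: tintegral_norm_le => [|y].
    by apply: cperM; [exact: psmooth_cper|exact: cper_cosmode].
  rewrite normrM -[M]mulr1; apply: ler_pM => //.
  by rewrite ler_norml cos_geN1 cos_le1.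
have [B B0 HB] := H (index_enum 'I_d ++ index_enum 'I_d).
exists B; split => // k a; apply: le_trans (HB k a) _.
by rewrite big_cat /= expr2.
Qed.

Lemma omega_gt0 k : 0 < omega k.
Proof. by apply: prodr_gt0 => i _; rewrite invr_gt0 ltr_pwDl // sqr_ge0. Qed.

Lemma enorm_lattice_sqr k : enorm (lattice k) ^+ 2 = \sum_(i < d) (k ord0 i)%:~R ^+ 2 :> R.
Proof.
rewrite /enorm sqr_sqrtr.
  by apply: eq_bigr => i _; rewrite mxE -expr2.
by apply: sumr_ge0 => i _; rewrite -expr2 sqr_ge0.
Qed.

Lemma omega_enorm k : omega k * (1 + enorm (lattice k) ^+ 2) <= 1.
Proof.
rewrite /omega prodfV mulrC ler_pdivrMr; last first.
  by apply: prodr_gt0 => i _; rewrite ltr_pwDl // sqr_ge0.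
rewrite mul1r enorm_lattice_sqr.
suff : 0 <= \sum_(i < d) (k ord0 i)%:~R ^+ 2 :> R /\
  1 + \sum_(i < d) (k ord0 i)%:~R ^+ 2 <= \prod_(i < d) (1 + (k ord0 i)%:~R ^+ 2) :> R by case.
elim/big_ind2 : _ => [|x1 x2 y1 y2 [h1 h2] [h3 h4]|i _].
- by split=> //; rewrite addr0.
- split; first exact: addr_ge0.
  apply: (@le_trans _ _ ((1 + x2) * (1 + y2))); first by nra.
  by apply: ler_pM => //; lra.
- by split; [exact: sqr_ge0|].
Qed.

Lemma omega_le1 k : omega k <= 1.
Proof.
apply: le_trans (omega_enorm k); apply: ler_peMr; first exact/ltW/omega_gt0.
by rewrite lerDl sqr_ge0.
Qed.

Lemma enorm_ge0 (x : 'rV[R]_d) : 0 <= enorm x.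
Proof. exact: sqrtr_ge0. Qed.

End fourier_modes.

(** * Unconditional sums over the lattice *)

Section unconditional_sums.
Context {R : realType} {I : choiceType}.
Implicit Types (a b : I -> R) (F : {fset I}).

(** Convergence along the finite subsets ordered by inclusion, the notion behind [summability.sum],
    spelled out so that estimates can be made on finite sums. *)
Definition has_sum a (l : R) := forall e, 0 < e ->
  exists F0 : {fset I}, forall F, (F0 `<=` F)%fset -> `|l - \sum_(i <- F) a i| <= e.

Definition sum_bounded a (B : R) := forall F, \sum_(i <- F) a i <= B.

Lemma has_sum_sum a l : has_sum a l -> summability.sum (a : I -> R^o) = l.
Proof.
move=> H; have FF := @summability.totally_filter I.
apply/cvg_lim; first exact: norm_hausdorff.
apply/cvgrPdist_le => e e0; have [F0 HF] := H e e0.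
exists F0 => //= F F0F; have := HF F F0F.
by rewrite /summability.partial_sum big_seq_fsetE.
Qed.

Lemma has_sum_uniq a l l' : has_sum a l -> has_sum a l' -> l = l'.
Proof. by move=> /has_sum_sum <- /has_sum_sum. Qed.

Lemma eq_has_sum b a l : a =1 b -> has_sum a l -> has_sum b l.
Proof. by move=> /funext ->. Qed.

Lemma has_sumD a b l m : has_sum a l -> has_sum b m ->
  has_sum (fun i => a i + b i) (l + m).
Proof.
move=> Ha Hb e e0; have e20 : 0 < e / 2 by rewrite divr_gt0.
have [Fa HFa] := Ha _ e20; have [Fb HFb] := Hb _ e20.
exists (Fa `|` Fb)%fset => F; rewrite fsubUset => /andP[aF bF].
rewrite big_split /= opprD addrACA [e]splitr.
by apply: le_trans (ler_normD _ _) _; apply: lerD; [exact: HFa|exact: HFb].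
Qed.

Lemma has_sumZ (c : R) a l : has_sum a l -> has_sum (fun i => c * a i) (c * l).
Proof.
move=> Ha e e0; have c0 : 0 < `|c| + 1 by rewrite ltr_wpDl.
have [Fa HFa] := Ha (e / (`|c| + 1)) (divr_gt0 e0 c0).
exists Fa => F aF; rewrite -mulr_sumr -mulrBr normrM.
apply: le_trans (ler_wpM2l (normr_ge0 c) (HFa F aF)) _.
rewrite mulrA ler_pdivrMr // mulrC ler_pM2l //.
by rewrite lerDl.
Qed.

Lemma has_sumB a b l m : has_sum a l -> has_sum b m ->
  has_sum (fun i => a i - b i) (l - m).
Proof.
move=> Ha /(has_sumZ (-1)) Hb; rewrite -mulN1r.
by apply: (eq_has_sum _ (has_sumD Ha Hb)) => i; rewrite mulN1r.
Qed.

Lemma has_sum0 : has_sum (fun=> 0) 0.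
Proof.
by move=> e e0; exists fset0 => F _; rewrite big1 // subrr normr0 ltW.
Qed.

Lemma has_sum_sumr (J : Type) (s : seq J) (a : J -> I -> R) (l : J -> R) :
  (forall j, has_sum (a j) (l j)) ->
  has_sum (fun i => \sum_(j <- s) a j i) (\sum_(j <- s) l j).
Proof.
move=> H; elim: s => [|j s IH].
  rewrite big_nil; apply: (eq_has_sum _ has_sum0) => i; by rewrite big_nil.
rewrite big_cons; apply: (eq_has_sum _ (has_sumD (H j) IH)) => i.
by rewrite big_cons.
Qed.

Lemma has_sum_norm_le a l C : has_sum a l ->
  (forall F, `|\sum_(i <- F) a i| <= C) -> `|l| <= C.
Proof.
move=> H HC; apply/ler_addgt0Pl => e e0; have [F0 HF] := H e e0.
rewrite -[l](subrK (\sum_(i <- F0) a i)).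
by apply: le_trans (ler_normD _ _) _; apply: lerD => //; exact: HF.
Qed.

Lemma has_sum_fin a F0 : (forall i, i \notin F0 -> a i = 0) ->
  has_sum a (\sum_(i <- F0) a i).
Proof.
move=> a0 e e0; exists F0 => F F0F.
rewrite (_ : \sum_(i <- F) a i = \sum_(i <- F0) a i); first by rewrite subrr normr0 ltW.
apply/esym; apply: big_fset_incl => //= i _; exact: a0.
Qed.

Lemma sum_fsetU a F0 F : \sum_(i <- (F0 `|` F)%fset) a i =
  \sum_(i <- F0) a i + \sum_(i <- F | i \notin F0) a i.
Proof.
rewrite (big_fsetID _ (mem F0)) /=; congr (_ + _).
  congr (bigop _ _ _); congr enum_fset; apply/fsetP => x; rewrite !inE /=.
  by case: (x \in F0); rewrite ?andbF.
rewrite [RHS]big_fset_condE; congr (bigop _ _ _); congr enum_fset; apply/fsetP => x.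
by rewrite !inE /=; case: (x \in F0) => //=; rewrite andbF.
Qed.

(** A finite set whose sum is within [e] of the supremum of all finite sums leaves at most [e] for
    whatever is added to it. *)
Lemma sum_bounded_tail a B : (forall i, 0 <= a i) -> sum_bounded a B ->
  forall e, 0 < e -> exists F0 : {fset I}, forall F,
    \sum_(i <- F | i \notin F0) a i <= e.
Proof.
move=> a0 aB e e0.
pose S := [set \sum_(i <- F) a i | F in [set: {fset I}]].
have hS : has_sup S.
  by split; [exists (\sum_(i <- fset0) a i); exists fset0|exists B => _ [F _ <-]].
have [_ [F0 _ <-] HF0] := sup_adherent e0 hS.
exists F0 => F.
have : \sum_(i <- (F0 `|` F)%fset) a i <= sup S.
  by apply: ub_le_sup; [case: hS|exists (F0 `|` F)%fset].
by rewrite sum_fsetU; lra.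
Qed.

Lemma has_sum_nonneg a B : (forall i, 0 <= a i) -> sum_bounded a B ->
  exists l, has_sum a l.
Proof.
move=> a0 aB; have T := sum_bounded_tail a0 aB.
pose S := [set \sum_(i <- F) a i | F in [set: {fset I}]].
have hS : has_sup S.
  by split; [exists (\sum_(i <- fset0) a i); exists fset0|exists B => _ [F _ <-]].
exists (sup S) => e e0; have [_ [F0 _ <-] HF0] := sup_adherent e0 hS.
exists F0 => F F0F.
have h1 : \sum_(i <- F) a i <= sup S by apply: ub_le_sup; [case: hS|exists F].
have h2 : \sum_(i <- F0) a i <= \sum_(i <- F) a i.
  rewrite -(fsetUidPr _ _ F0F) sum_fsetU lerDl; exact: sumr_ge0.
by rewrite ger0_norm; lra.
Qed.

(** The family [a + b] is nonnegative and at most [2 b], so the signed case follows from the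
    nonnegative one by subtracting [b]. *)
Lemma has_sum_dominated a b B : (forall i, `|a i| <= b i) -> sum_bounded b B ->
  exists l, has_sum a l.
Proof.
move=> ab bB; have b0 i : 0 <= b i by apply: le_trans (ab i).
have [lb Hb] := has_sum_nonneg b0 bB.
have [l Hl] : exists l, has_sum (fun i => a i + b i) l.
  apply: (@has_sum_nonneg _ (2 * B)) => [i|F].
    by have := ab i; rewrite ler_norml => /andP[]; lra.
  apply: le_trans (_ : \sum_(i <- F) 2 * b i <= _).
    apply: ler_sum => i _; have := ab i; rewrite ler_norml => /andP[]; lra.
  by rewrite -mulr_sumr ler_pM2l.
exists (l - lb); apply: (eq_has_sum _ (has_sumB Hl Hb)) => i.
by rewrite addrK.
Qed.

(** Dominated convergence for sums. The tail of [b] outside a finite [F0] is small whatever [n] is,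
    and on [F0] only finitely many limits are involved. The conclusion is uniform in the finite set
    [F], so it can be used before any infinite sum is known to exist. *)
Lemma tannery (b : I -> R) B (c : nat -> I -> R) C :
  (forall i, 0 <= b i) -> sum_bounded b B ->
  (forall n i, `|c n i| <= C) -> (forall i, c n i @[n --> \oo] --> 0) ->
  forall e, 0 < e -> \forall n \near \oo,
    forall F, \sum_(i <- F) `|c n i| * b i <= e.
Proof.
move=> b0 bB cC c0 e e0.
have e1 : 0 < e / 2 / (`|C| + 1) by rewrite !divr_gt0.
have [F0 HF0] := sum_bounded_tail b0 bB e1.
have : \sum_(i <- F0) `|c n i| * b i @[n --> \oo] --> 0.
  elim: (enum_fset F0) => [|i s IH].
    by under eq_fun do rewrite big_nil; exact: cvg_cst.
  under eq_fun do rewrite big_cons.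
  have H1 : `|c n i| * b i @[n --> \oo] --> `|(0 : R)| * b i.
    by apply: cvgMl; apply: cvg_norm; exact: c0.
  have := cvgD H1 IH; rewrite normr0 mul0r addr0; exact.
have e20 : 0 < e / 2 by rewrite divr_gt0.
move=> /cvgrPdist_le /(_ _ e20) H.
near=> n => F.
have T i : 0 <= `|c n i| * b i by rewrite mulr_ge0.
apply: le_trans (_ : \sum_(i <- (F0 `|` F)%fset) `|c n i| * b i <= _).
  by rewrite fsetUC sum_fsetU lerDl sumr_ge0.
rewrite sum_fsetU [e]splitr; apply: lerD.
  have : `|0 - \sum_(i <- F0) `|c n i| * b i| <= e / 2 by near: n.
  by rewrite sub0r normrN; apply: le_trans; exact: ler_norm.
apply: le_trans (_ : \sum_(i <- F | i \notin F0) (`|C| + 1) * b i <= _).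
  apply: ler_sum => i _; apply: ler_wpM2r => //.
  by apply: le_trans (cC n i) _; rewrite ler_wpDr // ler_norm.
by rewrite -mulr_sumr mulrC -ler_pdivlMr //; exact: HF0.
Unshelve. all: end_near. Qed.

End unconditional_sums.

(** * Summability of [omega] *)

Section lattice_sums.
Context {R : realType} {d : nat}.

(** The index [j - N] runs over the integers from -N to N. The term 4 / (N+1) is there for the
    induction: the two new terms 2 / (1 + n^2), with n = N+1, are at most 4/n - 4/(n+1). *)
Lemma sum_bessel1 (N : nat) :
  \sum_(j < N.*2.+1) (1 + (j%:Z - N%:Z)%:~R ^+ 2)^-1 <= 5 - 4 / N.+1%:R :> R.
Proof.
elim: N => [|N IH].
  by rewrite big_ord1 /= subrr expr0n /= addr0 invr1; lra.
rewrite doubleS big_ord_recl big_ord_recr /=.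
have -> : \sum_(i < N.*2.+1) (1 + ((lift ord0 (widen_ord (leqnSn N.*2.+1) i))%:Z
      - N.+1%:Z)%:~R ^+ 2)^-1 =
    \sum_(j < N.*2.+1) (1 + (j%:Z - N%:Z)%:~R ^+ 2)^-1 :> R.
  apply: eq_bigr => i _; rewrite /= /bump /= add1n.
  by congr ((1 + _%:~R ^+ 2)^-1); lia.
have -> : (0 - N.+1%:Z)%:~R ^+ 2 = N.+1%:R ^+ 2 :> R.
  by rewrite sub0r intrN sqrrN.
have -> : ((bump 0 N.*2.+1)%:Z - N.+1%:Z)%:~R ^+ 2 = N.+1%:R ^+ 2 :> R.
  by rewrite /bump /= add1n (_ : _ - _ = N.+1%:Z) //; lia.
have n0 : 0 < N.+1%:R :> R by [].
have -> : N.+2%:R = N.+1%:R + 1 :> R by rewrite -natr1.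
move: IH n0; move: (\sum_(_ < _) _) (N.+1%:R) => S n IH n0.
suff : 2 * (1 + n ^+ 2)^-1 <= 4 / n - 4 / (n + 1) by lra.
rewrite (_ : 4 / n - 4 / (n + 1) = 4 / (n * (n + 1))); last first.
  by field; rewrite !gt_eqF //; lra.
have p1 : 0 < 1 + n ^+ 2 by rewrite ltr_pwDl // sqr_ge0.
rewrite ler_pdivrMr // mulrAC ler_pdivlMr //; nra.
Qed.

(** A finite set of lattice points lies in a cube, over which the sum of products is the product of
    [d] one-dimensional sums, each at most 5. *)
Lemma omega_summable : sum_bounded (@omega R d) (5 ^+ d).
Proof.
move=> F.
have [N HN] : exists N : nat, forall k, k \in F -> forall i : 'I_d, (`|k ord0 i|%N <= N)%N.
  exists (\max_(k <- F) \max_(i < d) `|(k : 'rV[int]_d) ord0 i|%N) => k kF i.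
  apply: leq_trans (_ : \max_(i < d) `|k ord0 i|%N <= _)%N.
    exact: (@leq_bigmax _ (fun i => `|k ord0 i|%N) i).
  by rewrite (big_fsetD1 k) //= leq_maxl.
pose g (f : {ffun 'I_d -> 'I_N.*2.+1}) : 'rV[int]_d := \row_i ((f i)%:Z - N%:Z).
have ginj : injective g.
  move=> f1 f2 /rowP E; apply/ffunP => i; apply/val_inj => /=.
  by have := E i; rewrite !mxE; lia.
pose s := [seq g f | f <- index_enum {ffun 'I_d -> 'I_N.*2.+1}].
have us : uniq s by rewrite map_inj_uniq // index_enum_uniq.
have Fs : {subset F <= s}.
  move=> k kF; apply/mapP; exists [ffun i => inord (absz (k ord0 i + N%:Z))].
    by rewrite mem_index_enum.
  apply/rowP => i; rewrite !mxE ffunE.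
  have := HN k kF i; move: (k ord0 i : int) => z Hz.
  by rewrite inordK; lia.
apply: (@le_trans _ _ (\sum_(k <- s) omega k)).
  have [s' Es] : exists s', perm_eq s (enum_fset F ++ s').
    exists [seq k <- s | k \notin F].
    have : perm_eq (enum_fset F) [seq k <- s | k \in F].
      apply: uniq_perm; [exact: fset_uniq|exact: filter_uniq|].
      move=> k; rewrite mem_filter; case kF : (k \in F) => //=.
      by rewrite (Fs _ kF).
    move=> H; rewrite perm_sym (perm_trans (y := [seq k <- s | k \in F] ++ [seq k <- s | k \notin F])) //.
      by rewrite perm_cat2r.
    by rewrite perm_filterC.
  rewrite (perm_big _ Es) big_cat /= lerDl.
  by apply: sumr_ge0 => k _; exact/ltW/omega_gt0.
rewrite big_map.
rewrite (_ : \sum_(f <- _) _ = \prod_(i < d) \sum_(j < N.*2.+1) (1 + (j%:Z - N%:Z)%:~R ^+ 2)^-1).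
  rewrite -[d in leRHS]card_ord -prodr_const; apply: ler_prod => i _; apply/andP; split.
    by apply: sumr_ge0 => j _; rewrite invr_ge0 addr_ge0 // sqr_ge0.
  by apply: le_trans (sum_bessel1 N) _; rewrite lerBlDr lerDl divr_ge0.
rewrite bigA_distr_bigA /=; apply: eq_bigr => f _.
by apply: eq_bigr => i _; rewrite mxE.
Qed.

End lattice_sums.

(** * Fejer means and Fourier inversion *)

Section fejer.
Context {R : realType} {d : nat}.
Implicit Types (f g : 'rV[R]_d -> R) (k : 'rV[int]_d).

Lemma latticeD k k' : lattice (k + k') = lattice k + lattice k' :> 'rV[R]_d.
Proof. by apply/rowP => i; rewrite !mxE intrD. Qed.

Lemma latticeN k : lattice (- k) = - lattice k :> 'rV[R]_d.
Proof. by apply/rowP => i; rewrite !mxE intrN. Qed.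

Definition gridpt N (a : {ffun 'I_d -> 'I_N.+1}) : 'rV[int]_d := \row_i (a i)%:Z.

Lemma gridpt_inj N : injective (@gridpt N).
Proof.
move=> f1 f2 /rowP E; apply/ffunP => i; apply/val_inj => /=.
by have := E i; rewrite !mxE; lia.
Qed.

(** These are Cesaro means: the pairs with [q - p = k] are counted with multiplicity. If every
    coordinate of [p] is at distance at least [r] from the ends of the grid, the differences [q - p]
    cover [F0] and the inner sum is within [e / 2] of [l]. The other [p] form a vanishing
    proportion, and there the error is at most [2 * B]. *)
Lemma fejer_cesaro (a : 'rV[int]_d -> R) b B l : has_sum a l ->
  (forall k, `|a k| <= b k) -> sum_bounded b B ->
  (N.+1%:R ^+ d)^-1 *
    (\sum_(p : {ffun 'I_d -> 'I_N.+1}) \sum_(q : {ffun 'I_d -> 'I_N.+1})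
      a (gridpt q - gridpt p)) @[N --> \oo] --> l.
Proof.
move=> al ab bB; apply/cvgrPdist_le => e e0.
have e20 : 0 < e / 2 by rewrite divr_gt0.
have [F0 HF0] := al _ e20.
have B0 : 0 <= B.
  by have := bB fset0; rewrite big_nil.
have aB (F : {fset 'rV[int]_d}) : `|\sum_(k <- F) a k| <= B.
  apply: le_trans (ler_norm_sum _ _ _) _; apply: (@le_trans _ _ (\sum_(k <- F) b k)); last exact: (bB F).
  by apply: ler_sum => k _; exact: ab.
have lB : `|l| <= B := has_sum_norm_le al aB.
have [r Hr] : exists r : nat, forall k, k \in F0 -> forall i, (absz (k ord0 i) <= r)%N.
  exists (\max_(k <- F0) \max_(i < d) absz ((k : 'rV[int]_d) ord0 i))%N => k kF i.
  apply: leq_trans (_ : \max_(i < d) absz (k ord0 i) <= _)%N.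
    exact: (@leq_bigmax _ (fun i => absz (k ord0 i)) i).
  by rewrite (big_fsetD1 k) //= leq_maxl.
pose S N (p : {ffun 'I_d -> 'I_N.+1}) := \sum_(q : {ffun 'I_d -> 'I_N.+1})
  a (gridpt q - gridpt p).
pose F N (p : {ffun 'I_d -> 'I_N.+1}) : {fset 'rV[int]_d} :=
  [fset gridpt q - gridpt p | q in {ffun 'I_d -> 'I_N.+1}]%fset.
have SF N (p : {ffun 'I_d -> 'I_N.+1}) : S N p = \sum_(k <- F N p) a k.
  rewrite /S /F big_imfset /=; last by move=> x y _ _ /addIr /gridpt_inj.
  by rewrite big_enum.
pose G N : {pred 'I_N.+1} := [pred j : 'I_N.+1 | (r <= j)%N && (j + r <= N)%N].
have good N (p : {ffun 'I_d -> 'I_N.+1}) : p \in ffun_on (G N) -> `|l - S N p| <= e / 2.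
  move=> /ffun_onP Gp; rewrite SF; apply: HF0; apply/fsubsetP => k kF.
  apply/imfsetP; exists [ffun i => inord (absz (k ord0 i + (p i)%:Z))] => //=.
  apply/rowP => i; rewrite !mxE ffunE.
  have := Gp i; rewrite inE /=; have := Hr k kF i.
  move: (k ord0 i : int) (p i : nat) => z pi Hz Hp.
  by rewrite inordK; lia.
have bad N (p : {ffun 'I_d -> 'I_N.+1}) : `|l - S N p| <= 2 * B.
  by rewrite SF; apply: le_trans (ler_normB _ _) _; have := aB (F N p); lra.
have cardG N : (N.+1 - 2 * r <= #|G N|)%N.
  pose h (j : 'I_(N.+1 - 2 * r)) : 'I_N.+1 := inord (j + r).
  have hE (j : 'I_(N.+1 - 2 * r)) : h j = (j + r)%N :> nat.
    by rewrite /h inordK //; have := ltn_ord j; lia.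
  have hinj : injective h.
    by move=> j1 j2 /(congr1 val) /=; rewrite !hE => /addIn /val_inj.
  rewrite -[(N.+1 - 2 * r)%N]card_ord -(card_codom hinj).
  apply: subset_leq_card; apply/fintype.subsetP => x /codomP[j ->].
  by rewrite !inE hE; have := ltn_ord j; lia.
have total N : #|{ffun 'I_d -> 'I_N.+1}| = (N.+1 ^ d)%N by rewrite card_ffun !card_ord.
have key N : `|l - (N.+1%:R ^+ d)^-1 * \sum_p S N p| <=
    e / 2 + 2 * B * (1 - ((N.+1 - 2 * r)%N%:R / N.+1%:R) ^+ d).
  have Nd : 0 < N.+1%:R ^+ d :> R by rewrite exprn_gt0.
  rewrite -{1}[l](mulKf (lt0r_neq0 Nd)) -mulrBr normrM gtr0_norm ?invr_gt0 //.
  rewrite mulrC ler_pdivrMr //.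
  have -> : N.+1%:R ^+ d * l - \sum_p S N p = \sum_p (l - S N p).
    by rewrite sumrB sumr_const total mulrC -natrX mulr_natr.
  apply: le_trans (ler_norm_sum _ _ _) _.
  rewrite (bigID (mem (ffun_on (G N)))) /= mulrDl; apply: lerD.
    apply: (@le_trans _ _ (\sum_(p : {ffun 'I_d -> 'I_N.+1}) e / 2)); last first.
      by rewrite sumr_const total -natrX mulr_natr.
    rewrite [leRHS](bigID (mem (ffun_on (G N)))) /= ler_wpDr ?sumr_ge0 //.
      by move=> _ _; exact: ltW.
    by apply: ler_sum => p; exact: good.
  apply: (@le_trans _ _ (\sum_(p : {ffun 'I_d -> 'I_N.+1} | p \notin ffun_on (G N)) 2 * B)).
    by apply: ler_sum => p _; exact: bad.
  rewrite sumr_const -[leLHS]mulr_natr -[leRHS]mulrA ler_wpM2l ?mulr_ge0 //.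
  rewrite mulrBl mul1r exprMn -mulrA exprVn mulVf ?gt_eqF // mulr1.
  have E := etrans (cardC (mem (ffun_on (G N)))) (total N).
  have E' := @card_ffun_on (fintype_ordinal__canonical__fintype_Finite d) _ (G N).
  rewrite card_ord in E'.
  have pw m n j : (m <= n)%N -> (m ^ j <= n ^ j)%N.
    by case: j => // j; rewrite leq_exp2r.
  rewrite lerBrDr -!natrX -natrD ler_nat -E [leqRHS]addnC leq_add //.
  by apply: (@leq_trans (#|G N| ^ d)); [exact: pw|rewrite -E'].
have xc : (N.+1 - 2 * r)%N%:R / N.+1%:R @[N --> \oo] --> (1 : R).
  apply/cvgrPdist_le => h h0; near=> N.
  have -> : 1 - (N.+1 - 2 * r)%N%:R / N.+1%:R =
      (N.+1 - (N.+1 - 2 * r))%N%:R / N.+1%:R :> R.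
    by rewrite [in RHS]natrB ?leq_subr // mulrBl divff ?gt_eqF.
  rewrite ger0_norm ?divr_ge0 // ler_pdivrMr // mulrC -ler_pdivrMr //.
  apply: (@le_trans _ _ ((2 * r)%N%:R / h)).
    by apply: ler_wpM2r; [rewrite invr_ge0 ltW|rewrite ler_nat; lia].
  apply: (@le_trans _ _ N%:R); last by rewrite ler_nat.
  by near: N; exact: nbhs_infty_ger.
have yc : 2 * B * (1 - ((N.+1 - 2 * r)%N%:R / N.+1%:R) ^+ d) @[N --> \oo] --> (0 : R).
  have -> : 0 = 2 * B * (1 - 1 ^+ d) :> R by rewrite expr1n subrr mulr0.
  apply: cvgMr; apply: cvgB; first exact: cvg_cst.
  exact: (cvg_comp _ _ xc (@exprn_continuous R d 1)).
move/cvgrPdist_le : yc => /(_ _ e20) yc.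
near=> N; apply: le_trans (key N) _; rewrite [leRHS]splitr lerD2l.
have : `|0 - 2 * B * (1 - ((N.+1 - 2 * r)%N%:R / N.+1%:R) ^+ d)| <= e / 2.
  by near: N.
by rewrite sub0r normrN; apply: le_trans; exact: ler_norm.
Unshelve. all: end_near. Qed.

Lemma has_sum_single k0 (c : R) : has_sum (fun k => if k == k0 then c else 0) c.
Proof.
have := @has_sum_fin R _ (fun k => if k == k0 then c else 0) [fset k0]%fset.
by rewrite big_seq_fset1 eqxx; apply => k; rewrite inE => /negbTE ->.
Qed.

(** The real form of the k-th term of the Fourier series at [x], without the factor (2 pi)^-d: the
    imaginary parts at [k] and [- k] would cancel in the sum. *)
Definition fcoef f k (x : 'rV[R]_d) := fmode f k (- dot (lattice k) x).

Definition fejer_mean N f (x : 'rV[R]_d) : R := (N.+1%:R ^+ d)^-1 *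
  \sum_(p : {ffun 'I_d -> 'I_N.+1}) \sum_(q : {ffun 'I_d -> 'I_N.+1})
    fcoef f (gridpt q - gridpt p) x.

(** The squared modulus of the sum of exp(i p.z) over the grid, that is, (N+1)^d times the usual
    product Fejer kernel; in this form it is visibly nonnegative. *)
Definition fejer_kernel N (z : 'rV[R]_d) : R :=
  (\sum_(p : {ffun 'I_d -> 'I_N.+1}) cos (dot (lattice (gridpt p)) z)) ^+ 2 +
  (\sum_(p : {ffun 'I_d -> 'I_N.+1}) sin (dot (lattice (gridpt p)) z)) ^+ 2.

Lemma fcoefE f k x :
  fcoef f k x = \int[torus d]_y (f y * cos (dot (lattice k) (y - x))).
Proof.
by apply: eq_Rintegral => y _; rewrite dotDr dotNr addrC.
Qed.

Lemma cper_cosdot k x : cper (fun y : 'rV[R]_d => cos (dot (lattice k) (y - x))).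
Proof.
under eq_fun do rewrite dotDr dotNr addrC.
exact: cper_cosmode.
Qed.

Lemma dotDl (x y z : 'rV[R]_d) : dot (y + z) x = dot y x + dot z x.
Proof. by rewrite -!(dotC x) dotDr. Qed.

Lemma dotNl (x y : 'rV[R]_d) : dot (- y) x = - dot y x.
Proof. by rewrite -!(dotC x) dotNr. Qed.

Lemma fejer_kernelE N z : fejer_kernel N z =
  \sum_(p : {ffun 'I_d -> 'I_N.+1}) \sum_(q : {ffun 'I_d -> 'I_N.+1})
    cos (dot (lattice (gridpt q - gridpt p)) z).
Proof.
rewrite /fejer_kernel !expr2 !big_distrlr /= -big_split /=; apply: eq_bigr => p _.
rewrite -big_split /=; apply: eq_bigr => q _.
by rewrite latticeD latticeN dotDl dotNl cosB mulrC [sin _ * _]mulrC.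
Qed.

Lemma fejer_kernel_ge0 N z : 0 <= fejer_kernel N z.
Proof. by rewrite addr_ge0 // sqr_ge0. Qed.

Lemma cper_fejer_kernel N x : cper (fun y => fejer_kernel N (y - x)).
Proof.
under eq_fun do rewrite fejer_kernelE.
by apply: cper_sum => p; apply: cper_sum => q; exact: cper_cosdot.
Qed.

Lemma fejer_meanE N f x : cper f -> fejer_mean N f x =
  (N.+1%:R ^+ d)^-1 * \int[torus d]_y (f y * fejer_kernel N (y - x)).
Proof.
move=> cf; congr (_ * _).
under [RHS]eq_Rintegral do rewrite fejer_kernelE mulr_sumr.
rewrite tintegral_sum; last first.
  move=> p; apply: cperM => //; apply: cper_sum => q; exact: cper_cosdot.
apply: eq_bigr => p _; under [RHS]eq_Rintegral do rewrite mulr_sumr.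
rewrite tintegral_sum; last by move=> q; apply: cperM => //; exact: cper_cosdot.
by apply: eq_bigr => q _; rewrite fcoefE.
Qed.

Lemma fcoef1 k x : fcoef (fun=> 1) k x = if k == 0 then (2 * pi) ^+ d else 0.
Proof.
rewrite /fcoef /fmode; under eq_Rintegral do rewrite mul1r.
case: eqP => [->|/eqP k0]; last exact: tintegral_cosmode.
under eq_Rintegral => y _.
  rewrite (_ : lattice 0 = 0); last by apply/rowP => i; rewrite !mxE.
  by rewrite dotC [dot _ y]dotC -(scale0r y) !dotZr !mul0r oppr0 addr0 cos0; over.
by rewrite tintegral_cst mul1r.
Qed.

Lemma fcoef_cos k0 k x : fcoef (fun y => cos (dot (lattice k0) (y - x))) k x =
  2^-1 * ((if k == k0 then (2 * pi) ^+ d else 0) +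
          (if k == - k0 then (2 * pi) ^+ d else 0)).
Proof.
have E k' : \int[torus d]_y cos (dot (lattice k') (y - x)) =
    if k' == 0 then (2 * pi) ^+ d else 0.
  by rewrite -(fcoef1 k' x) fcoefE; apply: eq_Rintegral => y _; rewrite mul1r.
rewrite -subr_eq0 -[k == - k0]subr_eq0 opprK -!E -tintegralD; do ?exact: cper_cosdot.
rewrite -tintegralZ; last by apply: cperD; exact: cper_cosdot.
rewrite fcoefE; apply: eq_Rintegral => y _.
rewrite !latticeD latticeN !dotDl dotNl cosB cosD.
by field.
Qed.

End fejer.

(** * Convergence of the Fejer means and Fourier inversion *)

Section inversion.
Context {R : realType} {d : nat}.
Implicit Types (f g : 'rV[R]_d -> R) (k : 'rV[int]_d) (x y : 'rV[R]_d).

Lemma fejer_meanD N f g x : cper f -> cper g ->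
  fejer_mean N (fun y => f y + g y) x = fejer_mean N f x + fejer_mean N g x.
Proof.
move=> cf cg; have ck := cper_fejer_kernel N x.
rewrite !fejer_meanE //; last exact: cperD.
rewrite -mulrDr -tintegralD; try exact: cperM.
by congr (_ * _); apply: eq_Rintegral => y _; rewrite mulrDl.
Qed.

Lemma fejer_meanZ N (c : R) f x : cper f ->
  fejer_mean N (fun y => c * f y) x = c * fejer_mean N f x.
Proof.
move=> cf; have ck := cper_fejer_kernel N x.
rewrite !fejer_meanE //; last exact: cperZ.
rewrite [RHS]mulrCA -[X in _ = _ * X]tintegralZ; last exact: cperM.
by congr (_ * _); apply: eq_Rintegral => y _; rewrite mulrA.
Qed.

Lemma fejer_meanB N f g x : cper f -> cper g ->
  fejer_mean N (fun y => f y - g y) x = fejer_mean N f x - fejer_mean N g x.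
Proof.
move=> cf cg; have cg1 : cper (fun y => -1 * g y) by exact: cperZ.
rewrite -mulN1r -(fejer_meanZ _ (-1)) // -fejer_meanD //.
by congr (fejer_mean _ _ _); apply/funext => y; rewrite mulN1r.
Qed.

Lemma fejer_mean_cst N (c : R) (x : 'rV[R]_d) :
  fejer_mean N (fun=> c) x = c * fejer_mean N (fun=> 1) x.
Proof.
rewrite -(@fejer_meanZ N c (fun=> 1) x (cper_cst 1)).
by congr (fejer_mean _ _ _); apply/funext => y; rewrite mulr1.
Qed.

Lemma fejer_mean_sum N (I : Type) (s : seq I) (F : I -> 'rV[R]_d -> R) x :
  (forall i, cper (F i)) ->
  fejer_mean N (fun y => \sum_(i <- s) F i y) x = \sum_(i <- s) fejer_mean N (F i) x.
Proof.
move=> cF; elim: s => [|i s IH].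
  rewrite big_nil -[RHS](mul0r (fejer_mean N (fun=> 1) x)) -fejer_mean_cst.
  by congr (fejer_mean _ _ _); apply/funext => y; rewrite big_nil.
rewrite big_cons -IH -fejer_meanD //; last exact: cper_sum.
by congr (fejer_mean _ _ _); apply/funext => y; rewrite big_cons.
Qed.

Lemma le_fejer_mean N f g x : cper f -> cper g -> (forall y, f y <= g y) ->
  fejer_mean N f x <= fejer_mean N g x.
Proof.
move=> cf cg fg; have ck := cper_fejer_kernel N x.
rewrite !fejer_meanE // ler_wpM2l ?invr_ge0 ?exprn_ge0 //.
apply: le_tintegral; do ?exact: cperM.
by move=> y; apply: ler_wpM2r => //; exact: fejer_kernel_ge0.
Qed.

Lemma sum_bounded_single k0 (c : R) : 0 <= c ->
  sum_bounded (fun k => if k == k0 then c else 0) c.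
Proof.
move=> c0 F; have [kF|kF] := boolP (k0 \in F).
  rewrite (big_fsetD1 k0) //= eqxx big_seq big1 ?addr0 // => k.
  by rewrite !inE => /andP[/negbTE ->].
rewrite big_seq big1 // => k kF'; case: eqP => // E.
by rewrite -E kF' in kF.
Qed.

Lemma fejer_mean1_cvg x : fejer_mean N (fun=> 1) x @[N --> \oo] --> ((2 * pi) ^+ d : R).
Proof.
have c0 : 0 <= (2 * pi) ^+ d :> R by rewrite exprn_ge0 // mulr_ge0 // pi_ge0.
apply: (@fejer_cesaro R d (fun k => fcoef (fun=> 1) k x)
  (fun k => if k == 0 then (2 * pi) ^+ d else 0) ((2 * pi) ^+ d)).
- by apply: (eq_has_sum _ (has_sum_single 0 _)) => k; rewrite fcoef1.
- by move=> k; rewrite fcoef1; case: ifP; rewrite ?normr0 ?ger0_norm.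
- exact: sum_bounded_single.
Qed.

Lemma fejer_mean_cos_cvg k0 x :
  fejer_mean N (fun y => cos (dot (lattice k0) (y - x))) x @[N --> \oo] -->
  ((2 * pi) ^+ d : R).
Proof.
have c0 : 0 <= (2 * pi) ^+ d :> R by rewrite exprn_ge0 // mulr_ge0 // pi_ge0.
pose a k : R := 2^-1 * ((if k == k0 then (2 * pi) ^+ d else 0) +
          (if k == - k0 then (2 * pi) ^+ d else 0)).
have a0 k : 0 <= a k by rewrite mulr_ge0 ?invr_ge0 // addr_ge0 //; case: ifP.
apply: (@fejer_cesaro R d (fun k => fcoef (fun y => cos (dot (lattice k0) (y - x))) k x)
  a ((2 * pi) ^+ d)).
- rewrite (_ : (2 * pi) ^+ d = 2^-1 * ((2 * pi) ^+ d + (2 * pi) ^+ d)); last by field.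
  apply: (eq_has_sum _ (has_sumZ 2^-1 (has_sumD (has_sum_single k0 _) (has_sum_single (- k0) _)))).
  by move=> k; rewrite fcoef_cos.
- by move=> k; rewrite fcoef_cos -/(a k) ger0_norm.
- move=> F; rewrite /a -mulr_sumr big_split /=.
  have := sum_bounded_single k0 c0 F; have := sum_bounded_single (- k0) c0 F.
  by lra.
Qed.

(* As in Korovkin's theorem, convergence of positive means follows from their
   convergence on the constants and on this function. *)
Definition cosdist (x y : 'rV[R]_d) : R :=
  \sum_(i < d) (1 - cos (dot (lattice (delta_mx ord0 i)) (y - x))).

Lemma dot_lattice_delta (x : 'rV[R]_d) i : dot (lattice (delta_mx ord0 i)) x = x ord0 i.
Proof.
have E : lattice (delta_mx ord0 i) = delta_mx ord0 i :> 'rV[R]_d.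
  by apply/rowP => j; rewrite !mxE; case: (_ && _).
by rewrite E dotC dot_delta.
Qed.

(** Close to [x] modulo the lattice, continuity gives [e]. Elsewhere some coordinate is at distance
    more than [dl] from that of [x], so [cosdist] is at least [1 - cos dl], while the left-hand side
    never exceeds [2 * M]. *)
Lemma cosdist_dominates f x e : cper f -> 0 < e ->
  exists2 C, 0 <= C & forall y, `|f y - f x| <= e + C * cosdist x y.
Proof.
move=> cf e0; have [M [M0 fM]] := cper_bounded cf.
have [cf' pf] := cf; have pi0 := pi_gt0 R.
have /cvgrPdist_le /(_ e e0) /nbhs_normP [r /= r0 Hr] := cf' x.
(* Half of [r] gives a strict inequality in the ball of radius [r]; the bound by [pi] keeps [dl] in
   the interval on which [cos] decreases. *)
pose dl := Num.min (r / 2) pi.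
have dl0 : 0 < dl by rewrite lt_min divr_gt0.
have dlr : dl <= r / 2 by rewrite ge_min lexx.
have dlp : dl <= pi by rewrite ge_min lexx orbT.
have cd : cos dl < 1.
  by rewrite -cos0 ltr_cos // ?in_itv /= ?lexx ?(ltW dl0) ?(ltW pi0).
have h0 t : 0 <= 1 - cos t :> R by rewrite subr_ge0 cos_le1.
exists (2 * M / (1 - cos dl)); first by rewrite divr_ge0 ?mulr_ge0.
move=> y.
(* Shifting by [pi] before reducing to the cell yields the translate of [y] whose coordinates differ
   from those of [x] by at most [pi]. *)
have [j Hj] := torus_cellP (y - x + const_mx pi).
pose z := y + (2 * pi) *: lattice j.
have fz : f y = f z by rewrite /z pf.
have cz : cosdist x y = cosdist x z.
  apply: eq_bigr => i _; rewrite /z !dot_lattice_delta !mxE.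
  by rewrite addrAC cosDpi2z.
have zi i : - pi <= z ord0 i - x ord0 i <= pi.
  have := Hj i; rewrite /= in_itv /= /z !mxE => /andP[h1 h2].
  by apply/andP; split; lra.
rewrite fz cz; clearbody z.
have sum0 : 0 <= cosdist x z by apply: sumr_ge0 => i _; exact: h0.
case: (boolP [forall i, `|z ord0 i - x ord0 i| <= dl]) => [/forallP H|/forallPn[i Hi]].
  apply: (@le_trans _ _ e); last by rewrite lerDl mulr_ge0 ?divr_ge0 ?mulr_ge0.
  rewrite distrC; apply: Hr => /=; apply: (@le_lt_trans _ _ dl); last by lra.
  apply: rV_norm_le => [|i]; first exact: ltW.
  have := H i; rewrite distrC; congr (`|_| <= _).
  by rewrite [RHS]mxE [X in _ = _ + X]mxE.
apply: (@le_trans _ _ (2 * M)).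
  by apply: le_trans (ler_normB _ _) _; have := fM z; have := fM x; lra.
apply: (@le_trans _ _ (2 * M / (1 - cos dl) * cosdist x z)); last by rewrite lerDr ltW.
rewrite mulrAC ler_pdivlMr ?subr_gt0 // ler_wpM2l ?mulr_ge0 //.
rewrite /cosdist (bigD1 i) //= ler_wpDr ?sumr_ge0 //.
  rewrite dot_lattice_delta !mxE lerD2l lerN2.
  rewrite -ltNge in Hi.
  have -> : cos (z ord0 i - x ord0 i) = cos `|z ord0 i - x ord0 i|.
    by case: (ger0P (z ord0 i - x ord0 i)) => // _; rewrite cosN.
  apply: ltW; rewrite ltr_cos // in_itv /= ?(ltW dl0) //.
  by rewrite normr_ge0 ler_norml zi.
Qed.

Lemma fejer_mean_cvg f x : cper f ->
  fejer_mean N f x @[N --> \oo] --> (2 * pi) ^+ d * f x.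
Proof.
move=> cf; have [K0 c1] : 0 < (2 * pi) ^+ d :> R /\ cper (fun _ : 'rV[R]_d => 1 : R).
  by split; [rewrite exprn_gt0 // mulr_gt0 // pi_gt0|exact: cper_cst].
set K := (2 * pi) ^+ d in K0 *.
suff : fejer_mean N f x - f x * fejer_mean N (fun=> 1) x @[N --> \oo] --> 0.
  move=> H; have H1 : f x * fejer_mean N (fun=> 1) x @[N --> \oo] --> f x * K.
    by apply: cvgMr; exact: fejer_mean1_cvg.
  have -> : (fun N => fejer_mean N f x) = (fun N => (fejer_mean N f x -
      f x * fejer_mean N (fun=> 1) x) + f x * fejer_mean N (fun=> 1) x).
    by apply/funext => N; rewrite subrK.
  by have := cvgD H H1; rewrite add0r [f x * K]mulrC; exact.
apply/cvgrPdist_le => e e0.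
(* The mean of the constant 1 is eventually at most [K + 1], so the constant part of the domination
   contributes at most [e / 2]. *)
have e1 : 0 < e / (2 * (K + 1)) by rewrite divr_gt0 // mulr_gt0 // ltr_wpDl // ltW.
have [C C0 HC] := cosdist_dominates x cf e1.
pose ci (i : 'I_d) y : R := cos (dot (lattice (delta_mx ord0 i)) (y - x)).
have key N : `|fejer_mean N f x - f x * fejer_mean N (fun=> 1) x| <=
    e / (2 * (K + 1)) * fejer_mean N (fun=> 1) x +
    C * \sum_(i < d) (fejer_mean N (fun=> 1) x - fejer_mean N (ci i) x).
  have cdist : cper (fun y => cosdist x y).
    by apply: cper_sum => i; apply: cperB; [exact: c1|exact: cper_cosdot].
  have cg : cper (fun y => e / (2 * (K + 1)) + C * cosdist x y).
    by apply: cperD; [exact: cper_cst|exact: cperZ].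
  have E : e / (2 * (K + 1)) * fejer_mean N (fun=> 1) x +
    C * \sum_(i < d) (fejer_mean N (fun=> 1) x - fejer_mean N (ci i) x) =
    fejer_mean N (fun y => e / (2 * (K + 1)) + C * cosdist x y) x.
    rewrite fejer_meanD; [|exact: cper_cst|exact: cperZ].
    rewrite [X in _ = X + _]fejer_mean_cst fejer_meanZ //; congr (_ + C * _).
    rewrite /cosdist fejer_mean_sum; last first.
      by move=> i; apply: cperB; [exact: c1|exact: cper_cosdot].
    apply: eq_bigr => i _; rewrite fejer_meanB //; exact: cper_cosdot.
  rewrite E -fejer_mean_cst -fejer_meanB //; last exact: cper_cst.
  have cfx : cper (fun y => f y - f x) by apply: cperB => //; exact: cper_cst.
  rewrite ler_norml; apply/andP; split.
    rewrite -mulN1r -fejer_meanZ //; apply: le_fejer_mean => //; first exact: cperZ.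
    by move=> y; rewrite mulN1r; have := HC y; rewrite ler_norml => /andP[].
  apply: le_fejer_mean => // y.
  by have := HC y; rewrite ler_norml => /andP[].
(* Each [ci i] equals 1 at [x] and its means have the same limit [K] as those of the constant 1, so
   the part of the bound coming from [cosdist] disappears. *)
have lim0 : C * \sum_(i < d) (fejer_mean N (fun=> 1) x - fejer_mean N (ci i) x)
    @[N --> \oo] --> C * \sum_(i < d) (K - K).
  apply: cvgMr.
  elim: (index_enum _) => [|i s IH].
    by under eq_fun do rewrite big_nil; rewrite big_nil; exact: cvg_cst.
  under eq_fun do rewrite big_cons; rewrite big_cons.
  by apply: cvgD IH; apply: cvgB; [exact: fejer_mean1_cvg|exact: fejer_mean_cos_cvg].
move: lim0; under eq_bigr do rewrite subrr; rewrite big1 // mulr0 => lim0.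
have e20 : 0 < e / 2 by rewrite divr_gt0.
near=> N; rewrite sub0r normrN; apply: le_trans (key N) _; rewrite [leRHS]splitr.
apply: lerD.
  have : `|K - fejer_mean N (fun=> 1) x| <= 1.
    by near: N; have /cvgrPdist_le := fejer_mean1_cvg x; apply.
  rewrite ler_norml => /andP[hK _].
  have K10 : 0 < K + 1 by rewrite ltr_wpDl // ltW.
  apply: (@le_trans _ _ (e / (2 * (K + 1)) * (K + 1))).
    by apply: ler_wpM2l; [exact: ltW|lra].
  by rewrite invfM mulrA mulfVK ?gt_eqF.
have : `|0 - C * \sum_(i < d) (fejer_mean N (fun=> 1) x - fejer_mean N (ci i) x)| <= e / 2.
  by near: N; move/cvgrPdist_le: lim0; apply.
by rewrite sub0r normrN; apply: le_trans; exact: ler_norm.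
Unshelve. all: end_near. Qed.

(** By decay of the coefficients the series has some sum [l]. Its Cesaro means converge to [l] and,
    being Fejer means, also to [(2 * pi) ^+ d * f x]. *)
Lemma fourier_inversion f x : psmooth f ->
  has_sum (fun k => fcoef f k x) ((2 * pi) ^+ d * f x).
Proof.
move=> sf; have cf := psmooth_cper sf; have [B [B0 HB]] := fmode_decay sf.
have Hb k : `|fcoef f k x| <= B * omega k.
  apply: le_trans (HB _ _) _; rewrite ler_wpM2l // expr2 ler_piMr ?omega_le1 //.
  exact/ltW/omega_gt0.
have sb : sum_bounded (fun k : 'rV[int]_d => B * omega k) (B * 5 ^+ d).
  by move=> F; rewrite -mulr_sumr ler_wpM2l //; exact: omega_summable.
have [l Hl] := has_sum_dominated Hb sb.
suff <- : l = (2 * pi) ^+ d * f x by [].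
have H1 := fejer_cesaro Hl Hb sb; have H2 := @fejer_mean_cvg f x cf.
exact: (cvg_unique _ H1 H2).
Qed.

(** For fixed N the kernel is bounded, so the Fejer mean at [x] is at most a multiple of the
    integral of [f], hence 0; and the means converge to [(2 * pi) ^+ d * f x]. *)
Lemma tintegral_eq0 f : cper f -> (forall x, 0 <= f x) ->
  \int[torus d]_x f x <= 0 -> forall x, f x = 0.
Proof.
move=> cf f0 If x; have K0 : 0 < (2 * pi) ^+ d :> R.
  by rewrite exprn_gt0 // mulr_gt0 // pi_gt0.
have H := @fejer_mean_cvg f x cf.
have Z N : fejer_mean N f x = 0.
  rewrite fejer_meanE // (_ : \int[torus d]_y _ = 0) ?mulr0 //; apply/le_anti/andP; split.
    have [M [M0 HM]] := cper_bounded (cper_fejer_kernel N x).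
    apply: (@le_trans _ _ (\int[torus d]_y (M * f y))).
      apply: le_tintegral; [|exact: cperZ|].
        by apply: cperM => //; exact: cper_fejer_kernel.
      by move=> y; rewrite mulrC ler_wpM2r //; apply: le_trans (HM y); exact: ler_norm.
    by rewrite tintegralZ // mulr_ge0_le0.
  by apply: Rintegral_ge0 => y _; rewrite mulr_ge0 ?fejer_kernel_ge0.
move: H; rewrite (_ : (fun N => _) = cst 0); last by apply/funext => N; rewrite Z.
move=> H; have C0 : cst 0 N @[N --> \oo] --> (0 : R) by exact: cvg_cst.
have /eqP : (2 * pi) ^+ d * f x = 0 by exact: (cvg_unique _ H C0).
by rewrite mulf_eq0 gt_eqF //= => /eqP.
Qed.

End inversion.

(** * The binomial series of the square root *)

Section sqrt_series.
Context {R : realType}.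
Implicit Types (x : R) (n N : nat).

(** The central binomial coefficient of 2n and n divided by 4^n, which is the n-th Taylor
    coefficient of (1 - x)^(-1/2). *)
Fixpoint cbin n : R :=
  if n is m.+1 then cbin m * ((2 * m + 1)%N%:R / (2 * m + 2)%N%:R) else 1.

Lemma cbinS n : (2 * n + 2)%N%:R * cbin n.+1 = (2 * n + 1)%N%:R * cbin n.
Proof.
rewrite /= mulrCA [X in _ * X]mulrC divfK; first by rewrite mulrC.
by rewrite pnatr_eq0 addn_eq0 andbF.
Qed.

Lemma cbin_gt0 n : 0 < cbin n.
Proof.
elim: n => //= n IH; rewrite mulr_gt0 // divr_gt0 // ltr0n; lia.
Qed.

Lemma cbin_ge0 n : 0 <= cbin n.
Proof. exact/ltW/cbin_gt0. Qed.

Lemma cbin_decr n : cbin n.+1 <= cbin n.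
Proof.
rewrite /=; apply: ler_piMr; first exact/ltW/cbin_gt0.
rewrite ler_pdivrMr ?ltr0n; last by lia.
by rewrite mul1r ler_nat; lia.
Qed.

(** With the bound from below in [cbin_sqr_ge], this says that [cbin n] is of order n^(-1/2). The
    product considered here decreases with [n], the other one increases. *)
Lemma cbin_sqr_le n : cbin n ^+ 2 * (2 * n + 1)%N%:R <= 1.
Proof.
elim: n => [|n IH]; first by rewrite /= expr1n mul1r.
rewrite /= exprMn; set q := (X in _ * X * _).
rewrite -mulrA; apply: le_trans IH; rewrite ler_wpM2l ?sqr_ge0 // /q.
rewrite expr_div_n mulrAC ler_pdivrMr; last by rewrite exprn_gt0 // ltr0n; lia.
rewrite !natrD !natrM -[n.+1%:R]natr1; have : 0 <= n%:R :> R by [].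
move: n%:R => t t0; rewrite -subr_ge0 (_ : _ - _ = 2 * t + 1); last by ring.
by rewrite addr_ge0 // mulr_ge0.
Qed.

Lemma cbin_sqr_ge n : (0 < n)%N -> 1 <= cbin n ^+ 2 * (4 * n)%N%:R.
Proof.
case: n => // n _; elim: n => [|n IH].
  rewrite (_ : cbin 1 = 2^-1); last by rewrite /= mul1r div1r.
  by rewrite (_ : _ * _ = 1) // muln1; field.
have -> : cbin n.+2 = cbin n.+1 * ((2 * n.+1 + 1)%N%:R / (2 * n.+1 + 2)%N%:R) by [].
rewrite exprMn.
apply: le_trans IH _; rewrite -[leRHS]mulrA ler_wpM2l ?sqr_ge0 //.
rewrite expr_div_n mulrAC ler_pdivlMr; last by rewrite exprn_gt0 // ltr0n; lia.
rewrite !natrD !natrM -[n.+2%:R]natr1 -[n.+1%:R]natr1; have : 0 <= n%:R :> R by [].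
move: n%:R => t t0; rewrite -subr_ge0 (_ : _ - _ = 4 * (t + 2)); last by ring.
by rewrite mulr_ge0 // addr_ge0.
Qed.

Lemma cbin_cvg0 : cbin n @[n --> \oo] --> (0 : R).
Proof.
apply/cvgrPdist_le => e e0; near=> n.
rewrite sub0r normrN gtr0_norm ?cbin_gt0 //.
suff : cbin n ^+ 2 <= e ^+ 2.
  by rewrite ler_pXn2r // nnegrE ltW // cbin_gt0.
have n0 : 0 < (2 * n + 1)%N%:R :> R by rewrite ltr0n; lia.
rewrite -(ler_pM2r n0); apply: le_trans (cbin_sqr_le n) _.
rewrite mulrC -ler_pdivrMr ?exprn_gt0 // div1r.
apply: (@le_trans _ _ n%:R); last by rewrite ler_nat; lia.
by near: n; exact: nbhs_infty_ger.
Unshelve. all: end_near. Qed.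

Fixpoint csum N x : R := if N is n.+1 then csum n x + cbin n * x ^+ n else 0.

Fixpoint dcsum N x : R :=
  if N is n.+1 then dcsum n x + cbin n * (n%:R * x ^+ n.-1) else 0.

Lemma is_derive_monomial (c : R) n x :
  is_derive x (1 : R) (fun y : R => c * y ^+ n : R^o) (c * (n%:R * x ^+ n.-1)).
Proof.
have H := is_deriveZ c (is_deriveX n (is_derive_id x (1 : R))).
have -> : (fun y : R => c * y ^+ n : R^o) = (c *: (id ^+ n : R -> R) : R -> R^o).
  apply/funext => y; rewrite -[RHS]/(c * (id ^+ n : R -> R) y); congr (_ * _).
  elim: n {H} => [|n IH]; first by rewrite !expr0.
  by rewrite !exprS IH.
by apply: (is_derive_eq H); rewrite /GRing.scale /=; ring.
Qed.

Lemma is_derive_csum N x : is_derive x (1 : R) (csum N : R -> R^o) (dcsum N x).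
Proof.
elim: N => [|N IH] /=; first exact: is_derive_cst.
apply: (@is_deriveD _ _ R^o (csum N) (fun x => cbin N * x ^+ N)).
exact: is_derive_monomial.
Qed.

(** The function y = (1 - x)^(-1/2) solves 2 (1 - x) y' = y; the last term is the error caused by
    truncating its series. *)
Lemma dcsumE N x : 2 * (1 - x) * dcsum N.+1 x =
  csum N.+1 x - 2 * N.+1%:R * cbin N.+1 * x ^+ N.
Proof.
elim: N => [|N IH].
  have -> : dcsum 1 x = 0 by rewrite /= mul0r mulr0 addr0.
  have -> : csum 1 x = 1 by rewrite /= add0r mul1r.
  have -> : cbin 1 = 2^-1 by rewrite /= mul1r div1r.
  by rewrite expr0 mulr0 !mulr1 divff ?subrr.
have H : 2 * N.+2%:R * cbin N.+2 = (2 * N.+1%:R + 1) * cbin N.+1.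
  have := cbinS N.+1; rewrite !natrD !natrM => <-.
  by rewrite -[N.+2%:R]natr1; ring.
have -> : dcsum N.+2 x = dcsum N.+1 x + cbin N.+1 * (N.+1%:R * x ^+ N) by [].
have -> : csum N.+2 x = csum N.+1 x + cbin N.+1 * x ^+ N.+1 by [].
rewrite mulrDr IH H exprS.
by move: (csum _ _) (cbin _) (_%:R) (x ^+ N) => a b t z; ring.
Qed.

Lemma csum_ge0 N x : 0 <= x -> 0 <= csum N x.
Proof.
move=> x0; elim: N => //= N IH; rewrite addr_ge0 // mulr_ge0 ?exprn_ge0 //.
exact/ltW/cbin_gt0.
Qed.

Lemma csum_nondecreasing N x y : 0 <= x -> x <= y -> csum N x <= csum N y.
Proof.
move=> x0 xy; elim: N => //= N IH; rewrite lerD // ler_wpM2l ?cbin_ge0 //.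
by rewrite lerXn2r ?nnegrE // (le_trans x0 xy).
Qed.

Lemma csum_le N x : 0 <= x -> (1 - x) * csum N x <= 1.
Proof.
(* Strengthened for the induction: by summation by parts the left-hand side is 1 minus the sum over
   n < N of [(cbin n - cbin n.+1) * x ^+ n.+1]. *)
move=> x0; suff : (1 - x) * csum N.+1 x + cbin N * x ^+ N.+1 <= 1.
  apply: le_trans; rewrite /= mulrDr -addrA lerDl.
  rewrite (_ : _ + _ = cbin N * x ^+ N); last by rewrite exprS; ring.
  by rewrite mulr_ge0 ?exprn_ge0 // ltW // cbin_gt0.
elim: N => [|N IH]; first by rewrite /= add0r !mul1r expr1 mulr1 subrK.
apply: le_trans IH; rewrite [csum N.+2 x]/(csum N.+1 x + _) mulrDr -addrA lerD2l.
rewrite [x ^+ N.+2]exprS (_ : _ + _ = cbin N.+1 * x ^+ N.+1); last by ring.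
by rewrite ler_wpM2r ?exprn_ge0 // cbin_decr.
Qed.

(* [csum N] is a partial sum of the Taylor series of [(1 - x)^(-1/2)], hence
   [ksum N x] tends to 1. *)
Definition ksum N x := (1 - x) * csum N x ^+ 2.

(** The differential equation cancels everything except the truncation error. The remaining term has
    a sign, so [ksum] decreases from 1 on the nonnegative axis. *)
Lemma is_derive_ksum N x : is_derive x (1 : R) (ksum N.+1 : R -> R^o)
  (- (2 * N.+1%:R * cbin N.+1 * x ^+ N * csum N.+1 x)).
Proof.
have H := is_derive_csum N.+1 x.
have H1 : is_derive x (1 : R) ((cst 1 - id : R -> R^o) : R -> R^o) (0 - 1).
  exact: is_deriveB.
have := is_deriveM H1 (is_deriveM H H).
have -> : (cst 1 - id : R -> R^o) * ((csum N.+1 : R -> R^o) * (csum N.+1 : R -> R^o)) =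
    (ksum N.+1 : R -> R^o).
  by apply/funext => y; rewrite /ksum expr2.
move=> H2; apply: (is_derive_eq H2).
have -> : 2 * N.+1%:R * cbin N.+1 * x ^+ N = csum N.+1 x - 2 * (1 - x) * dcsum N.+1 x.
  by rewrite dcsumE opprB addrC subrK.
rewrite -[LHS]/((1 - x) * (csum N.+1 x * dcsum N.+1 x + csum N.+1 x * dcsum N.+1 x) +
  (csum N.+1 x * csum N.+1 x) * (0 - 1)).
by move: (csum _ _) (dcsum _ _) => a b; ring.
Qed.

Lemma ksum0 N : ksum N.+1 0 = 1.
Proof.
rewrite /ksum subr0 mul1r (_ : csum N.+1 0 = 1) ?expr1n //.
elim: N => [|N IH]; first by rewrite /= add0r expr0 mulr1.
have -> : csum N.+2 0 = csum N.+1 0 + cbin N.+1 * 0 ^+ N.+1 by [].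
by rewrite IH exprS mul0r mulr0 addr0.
Qed.

Lemma ksum_le1 N x : 0 <= x -> ksum N.+1 x <= 1.
Proof.
move=> x0; rewrite -(ksum0 N).
have [<-//|xn0] := eqVneq 0 x.
have xp : 0 < x by rewrite lt_neqAle xn0.
have [c|c xc] := @MVT R (ksum N.+1) (fun y => - (2 * N.+1%:R * cbin N.+1 * y ^+ N * csum N.+1 y))
    0 x xp (fun y _ => is_derive_ksum N y).
  apply: continuous_subspaceT => y.
  by apply: differentiable_continuous; apply/derivable1_diffP; have [] := is_derive_ksum N y.
rewrite subr0 => E; rewrite -subr_le0 E mulNr oppr_le0 mulr_ge0 //.
have c0 : 0 <= c by move: xc; rewrite in_itv /= => /andP[/ltW].
by rewrite !mulr_ge0 // ?exprn_ge0 ?csum_ge0 // ltW // cbin_gt0.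
Qed.

(** With [M] the value of [csum] at the right end point, adding [2 * cbin N.+1 * M * y ^+ N.+1]
    compensates the derivative of [ksum]: the sum is nondecreasing on [0, x] and equals 1 at 0.
    Finally [M] is at most 1 / (1 - x). *)
Lemma ksum_ge N x : 0 <= x -> x < 1 -> 1 - 2 * cbin N.+1 / (1 - x) <= ksum N.+1 x.
Proof.
move=> x0 x1; have x1' : 0 < 1 - x by rewrite subr_gt0.
have cx : csum N.+1 x <= (1 - x)^-1.
  by rewrite -[leRHS]mul1r ler_pdivlMr // mulrC csum_le.
apply: (@le_trans _ _ (1 - 2 * cbin N.+1 * csum N.+1 x * x ^+ N.+1)).
  rewrite lerD2l lerN2 -[leLHS]mulrA.
  apply: ler_wpM2l; first by apply: mulr_ge0 => //; exact: cbin_ge0.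
  apply: (@le_trans _ _ (csum N.+1 x)); last exact: cx.
  by rewrite ler_piMr ?csum_ge0 // exprn_ile1 // ltW.
have [<-|xn0] := eqVneq 0 x; first by rewrite ksum0 expr0n /= mulr0 subr0.
have xp : 0 < x by rewrite lt_neqAle xn0.
pose M := csum N.+1 x.
pose g (y : R) : R := ksum N.+1 y + 2 * cbin N.+1 * M * y ^+ N.+1.
have dg (y : R) : is_derive y (1 : R) (g : R -> R^o)
   (- (2 * N.+1%:R * cbin N.+1 * y ^+ N * csum N.+1 y) +
    2 * cbin N.+1 * M * (N.+1%:R * y ^+ N)).
  apply: (@is_deriveD _ _ R^o (ksum N.+1) (fun y => 2 * cbin N.+1 * M * y ^+ N.+1)).
    exact: is_derive_ksum.
  exact: is_derive_monomial.
have [|c xc] := @MVT R g _ 0 x xp (fun y _ => dg y).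
  apply: continuous_subspaceT => y.
  by apply: differentiable_continuous; apply/derivable1_diffP; have [] := dg y.
rewrite subr0 {1 2}/g ksum0 expr0n /= mulr0 addr0 => E.
rewrite lerBlDr -subr_ge0 E mulr_ge0 // ?(ltW xp) //.
move: xc; rewrite in_itv /= => /andP[/ltW c0' /ltW cx'].
have cM : csum N.+1 c <= M by exact: csum_nondecreasing.
have -> : - (2 * N.+1%:R * cbin N.+1 * c ^+ N * csum N.+1 c) +
  2 * cbin N.+1 * M * (N.+1%:R * c ^+ N) =
  2 * N.+1%:R * cbin N.+1 * c ^+ N * (M - csum N.+1 c) by ring.
apply: mulr_ge0; last by rewrite subr_ge0.
apply: mulr_ge0; last exact: exprn_ge0.
by apply: mulr_ge0; [exact: mulr_ge0|exact: cbin_ge0].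
Qed.

(** A partial sum of the expansion of sqrt (1 - x) in the functions 1 - x^n. It comes from (1 - x)
    times [csum] by summation by parts, and its coefficients are nonnegative because [cbin]
    decreases. *)
Definition wsum N x : R := \sum_(n < N) (cbin n - cbin n.+1) * (1 - x ^+ n.+1).

Lemma wsumE N x : wsum N x = (1 - x) * csum N x - cbin N * (1 - x ^+ N).
Proof.
elim: N => [|N IH]; first by rewrite /wsum big_ord0 /= expr0 mulr0 subrr mulr0 subr0.
by rewrite /wsum big_ord_recr /= -/(wsum N x) IH exprS; ring.
Qed.

Lemma wsum_ge0 N x : 0 <= x -> x <= 1 -> 0 <= wsum N x.
Proof.
move=> x0 x1; apply: sumr_ge0 => n _; rewrite mulr_ge0 // subr_ge0 ?cbin_decr //.
exact: exprn_ile1.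
Qed.

Lemma csum_le_sqrt N x : 0 <= x -> x <= 1 -> (1 - x) * csum N.+1 x <= Num.sqrt (1 - x).
Proof.
move=> x0 x1; have h : 0 <= 1 - x by rewrite subr_ge0.
rewrite -[leLHS]ger0_norm; last by rewrite mulr_ge0 // csum_ge0.
rewrite -sqrtr_sqr ler_sqrt // exprMn expr2 -mulrA ler_piMr //.
exact: ksum_le1.
Qed.

Lemma wsum_le N x : 0 <= x -> x <= 1 -> wsum N.+1 x <= Num.sqrt (1 - x).
Proof.
move=> x0 x1; apply: le_trans (csum_le_sqrt N x0 x1).
rewrite wsumE gerBl mulr_ge0 //; first exact/ltW/cbin_gt0.
by rewrite subr_ge0 exprn_ile1.
Qed.

(** Since (1 - x) [csum] is the square root of (1 - x) [ksum], it tends to sqrt (1 - x), and the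
    boundary term of the summation by parts is at most [cbin N.+1]. At x = 1 the estimate on [ksum]
    degenerates, but there every term of [wsum] vanishes. *)
Lemma wsum_cvg x : 0 <= x -> x <= 1 ->
  wsum N.+1 x @[N --> \oo] --> Num.sqrt (1 - x).
Proof.
move=> x0; rewrite le_eqVlt => /predU1P[->|x1].
  rewrite subrr sqrtr0 (_ : (fun N => _) = cst 0); first exact: cvg_cst.
  by apply/funext => N; rewrite /wsum big1 // => i _; rewrite expr1n subrr mulr0.
have x1' : 0 < 1 - x by rewrite subr_gt0.
have cS : cbin N.+1 @[N --> \oo] --> (0 : R) by rewrite (cvg_shiftS cbin); exact: cbin_cvg0.
have kc : ksum N.+1 x @[N --> \oo] --> (1 : R).
  apply: (@squeeze_cvgr _ _ _ _ (fun N => 1 - 2 * cbin N.+1 / (1 - x)) (cst 1)).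
  - by near=> N; rewrite ksum_ge // ksum_le1.
  - have h1 : 2 * cbin N.+1 / (1 - x) @[N --> \oo] --> 2 * 0 / (1 - x).
      by apply: cvgMl; exact: cvgMr.
    have h2 : (1 : R) @[N --> \oo] --> (1 : R) by exact: cvg_cst.
    by have := cvgB h2 h1; rewrite mulr0 mul0r subr0; exact.
  - exact: cvg_cst.
have sc : (1 - x) * csum N.+1 x @[N --> \oo] --> Num.sqrt (1 - x).
  rewrite (_ : (fun N => _) = (fun N => Num.sqrt ((1 - x) * ksum N.+1 x))); last first.
    apply/funext => N; rewrite /ksum mulrA -expr2 -exprMn sqrtr_sqr ger0_norm //.
    by rewrite mulr_ge0 ?(ltW x1') // csum_ge0.
  have h1 : (1 - x) * ksum N.+1 x @[N --> \oo] --> (1 - x) * 1 by exact: cvgMr.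
  have := cvg_comp _ _ h1 (@sqrt_continuous R _); rewrite mulr1; exact.
suff h : cbin N.+1 * (1 - x ^+ N.+1) @[N --> \oo] --> (0 : R).
  have -> : (fun N => wsum N.+1 x) =
      (fun N => (1 - x) * csum N.+1 x - cbin N.+1 * (1 - x ^+ N.+1)).
    by apply/funext => N; exact: wsumE.
  by have := cvgB sc h; rewrite subr0; exact.
apply: (@squeeze_cvgr _ _ _ _ (cst 0) (fun N => cbin N.+1)) => //; last exact: cvg_cst.
near=> N; have h : 0 <= x ^+ N.+1 <= 1 by rewrite exprn_ge0 //= exprn_ile1 // ltW.
have c0 := cbin_gt0 N.+1; case/andP: h => h1 h2.
by rewrite mulr_ge0 ?(ltW c0) ?subr_ge0 //= ler_piMr ?(ltW c0) // gerBl.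
Unshelve. all: end_near. Qed.

End sqrt_series.

(** * The half Laplacian as a limit of random walks *)

Section random_walk.
Context {R : realType} {d : nat}.
Implicit Types (f g : 'rV[R]_d -> R) (k : 'rV[int]_d) (x y z : 'rV[R]_d).
Implicit Types (l : seq (R * 'rV[R]_d)).

(** The list [l] is a finite measure given by its atoms (weight, shift); [shift_comp] below is
    convolution of such measures. *)
Definition shiftsum l f x : R := \sum_(p <- l) p.1 * f (x + p.2).

(** Symmetry is required of the operator and not of the list, so that it passes to compositions
    without any permutation of atoms. *)
Definition shift_symmetric l :=
  forall f x, shiftsum l f x = \sum_(p <- l) p.1 * f (x - p.2).

Definition shift_nonneg l := forall p, p \in l -> 0 <= p.1.

Definition shift_comp l l' : seq (R * 'rV[R]_d) :=
  [seq (p.1 * q.1, p.2 + q.2) | p <- l, q <- l'].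

Lemma shiftsum_comp l l' f x :
  shiftsum (shift_comp l l') f x = shiftsum l (shiftsum l' f) x.
Proof.
rewrite /shiftsum big_allpairs_dep; apply: eq_bigr => p _.
rewrite mulr_sumr; apply: eq_bigr => q _ /=.
by rewrite mulrA addrA.
Qed.

Lemma shift_comp_symmetric l l' : shift_symmetric l -> shift_symmetric l' ->
  shift_symmetric (shift_comp l l').
Proof.
move=> sl sl' f x; rewrite shiftsum_comp sl /shift_comp big_allpairs_dep.
apply: eq_bigr => p _; rewrite sl' mulr_sumr; apply: eq_bigr => q _ /=.
by rewrite mulrA opprD addrA.
Qed.

Lemma shift_comp_nonneg l l' : shift_nonneg l -> shift_nonneg l' ->
  shift_nonneg (shift_comp l l').
Proof.
by move=> nl nl' _ /allpairsP[[p q] /= [/nl hp /nl' hq ->]]; exact: mulr_ge0.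
Qed.

Lemma eq_shiftsum l f g : f =1 g -> shiftsum l f =1 shiftsum l g.
Proof. by move=> /funext ->. Qed.

Lemma shiftsum_ge0 l f x : shift_nonneg l -> (forall y, 0 <= f y) ->
  0 <= shiftsum l f x.
Proof.
move=> nl f0; rewrite /shiftsum big_seq; apply: sumr_ge0 => p pl.
by rewrite mulr_ge0 // nl.
Qed.

Lemma shiftsumZ l (c : R) f x : shiftsum l (fun y => c * f y) x = c * shiftsum l f x.
Proof. by rewrite /shiftsum mulr_sumr; apply: eq_bigr => p _; rewrite mulrCA. Qed.

(* The walk is lazy so that its symbol lies in [0, 1]. *)
Definition walk_step (s : R) : seq (R * 'rV[R]_d) :=
  (2^-1, 0) ::
  [seq ((4 * d%:R)^-1, s *: delta_mx ord0 i) | i <- index_enum 'I_d] ++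
  [seq ((4 * d%:R)^-1, - (s *: delta_mx ord0 i)) | i <- index_enum 'I_d].

Lemma walk_stepE s f x : shiftsum (walk_step s) f x =
  2^-1 * f x + (4 * d%:R)^-1 *
    \sum_(i < d) (f (x + s *: delta_mx ord0 i) + f (x - s *: delta_mx ord0 i)).
Proof.
rewrite /shiftsum /walk_step big_cons big_cat !big_map /= addr0; congr (_ + _).
by rewrite -big_split /= mulr_sumr; apply: eq_bigr => i _; rewrite mulrDr.
Qed.

Lemma walk_step_symmetric s : shift_symmetric (walk_step s).
Proof.
move=> f x; rewrite walk_stepE /walk_step big_cons big_cat !big_map /= subr0; congr (_ + _).
rewrite -big_split /= mulr_sumr; apply: eq_bigr => i _.
by rewrite opprK mulrDr addrC.
Qed.

Lemma walk_step_nonneg s : shift_nonneg (walk_step s).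
Proof.
move=> p; rewrite inE mem_cat => /orP[/eqP -> /=|]; first by rewrite invr_ge0.
by case/orP => /mapP[i _ ->]; rewrite /= invr_ge0 mulr_ge0.
Qed.

Fixpoint walk (s : R) n : seq (R * 'rV[R]_d) :=
  if n is m.+1 then shift_comp (walk_step s) (walk s m) else [:: (1, 0)].

Lemma walk_symmetric s n : shift_symmetric (walk s n).
Proof.
elim: n => [|n IH]; last exact (shift_comp_symmetric (@walk_step_symmetric s) IH).
by move=> f x; rewrite /shiftsum !big_seq1 /= subr0 addr0.
Qed.

Lemma walk_nonneg s n : shift_nonneg (walk s n).
Proof.
elim: n => [|n IH]; last exact (shift_comp_nonneg (@walk_step_nonneg s) IH).
by move=> p; rewrite inE => /eqP ->.
Qed.

(** The Fourier multiplier of one step: the average of 1 and of the mean over i of cos (s k_i). *)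
Definition walk_symbol (s : R) k : R :=
  1 - (2 * d%:R)^-1 * \sum_(i < d) (1 - cos (s * (k ord0 i)%:~R)).

(** In real form a single translation is not a scalar multiplication on a mode; a symmetric pair of
    translations is. *)
Lemma fcoef_shift f k x z : cper f ->
  fcoef f k (x + z) + fcoef f k (x - z) = 2 * cos (dot (lattice k) z) * fcoef f k x.
Proof.
move=> cf; rewrite !fcoefE -tintegralD; do ?by apply: cperM => //; exact: cper_cosdot.
rewrite -tintegralZ; last by apply: cperM => //; exact: cper_cosdot.
apply: eq_Rintegral => y _; rewrite opprD opprB [y + (z - x)]addrA.
rewrite [y + z - x]addrAC [y + (_ - _)]addrA; move: (y - x) => w.
by rewrite !dotDr dotNr cosB cosD; ring.
Qed.

Context (d0 : (0 < d)%N).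

Let dn0 : d%:R != 0 :> R.
Proof. by rewrite pnatr_eq0 -lt0n. Qed.

Lemma walk_step_fcoef s f k x : cper f ->
  shiftsum (walk_step s) (fcoef f k) x = walk_symbol s k * fcoef f k x.
Proof.
move=> cf; rewrite walk_stepE.
under eq_bigr do rewrite fcoef_shift // dotZr dot_delta mxE.
rewrite -mulr_suml -mulr_sumr /walk_symbol sumrB sumr_const card_ord.
by move: (\sum_(i < d) _) (fcoef f k x) => S a; field.
Qed.

Lemma walk_fcoef s n f k x : cper f ->
  shiftsum (walk s n) (fcoef f k) x = walk_symbol s k ^+ n * fcoef f k x.
Proof.
move=> cf; elim: n x => [|n IH] x.
  by rewrite /shiftsum big_seq1 /= addr0 expr0.
have -> : walk s n.+1 = shift_comp (walk_step s) (walk s n) by [].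
rewrite shiftsum_comp (eq_shiftsum _ IH).
by rewrite shiftsumZ walk_step_fcoef // exprS mulrCA mulrA.
Qed.

Lemma has_sum_walk s n f x : psmooth f ->
  has_sum (fun k => walk_symbol s k ^+ n * fcoef f k x)
    ((2 * pi) ^+ d * shiftsum (walk s n) f x).
Proof.
move=> sf; have cf := psmooth_cper sf.
have H := has_sum_sumr (walk s n) (fun p => has_sumZ p.1 (fourier_inversion (x + p.2) sf)).
have -> : (2 * pi) ^+ d * shiftsum (walk s n) f x =
    \sum_(p <- walk s n) p.1 * ((2 * pi) ^+ d * f (x + p.2)).
  by rewrite /shiftsum mulr_sumr; apply: eq_bigr => p _; rewrite mulrCA.
apply: (eq_has_sum _ H) => k.
by rewrite -walk_fcoef.
Qed.

Lemma walk_symbol_le1 s k : walk_symbol s k <= 1.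
Proof.
rewrite gerBl mulr_ge0 ?invr_ge0 ?mulr_ge0 //.
by apply: sumr_ge0 => i _; rewrite subr_ge0 cos_le1.
Qed.

Lemma walk_symbol_ge0 s k : 0 <= walk_symbol s k.
Proof.
have dp : 0 < 2 * d%:R :> R by rewrite mulr_gt0 // ltr0n.
rewrite subr_ge0 ler_pdivrMl // mulr1.
apply: (@le_trans _ _ (\sum_(i < d) 2)).
  by apply: ler_sum => i _; have := cos_geN1 (s * (k ord0 i)%:~R); lra.
by rewrite sumr_const card_ord mulr_natr.
Qed.

Lemma sin_le_norm (t : R) : `|sin t| <= `|t|.
Proof.
wlog t0 : t / 0 < t => [H|].
  have [t0|t0|->] := ltgtP t 0; last by rewrite sin0.
    by rewrite -normrN -sinN -[leRHS]normrN; apply: H; rewrite oppr_gt0.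
  exact: H.
have [|c _] := @MVT R sin cos 0 t t0 (fun (w : R) _ => is_derive_sin w).
  by apply: continuous_subspaceT => y; exact: continuous_sin.
rewrite sin0 !subr0 => ->; rewrite normrM ler_piMl //.
exact: cos_max.
Qed.

Lemma oneBcos (t : R) : 1 - cos t = 2 * sin (t / 2) ^+ 2.
Proof.
have {1}-> : t = t / 2 + t / 2 by field.
by rewrite cosD -!expr2 cos2sin2; ring.
Qed.

Lemma oneBcos_le (t : R) : 1 - cos t <= t ^+ 2 / 2.
Proof.
rewrite oneBcos.
have : sin (t / 2) ^+ 2 <= (t / 2) ^+ 2.
  by rewrite -[leLHS]real_normK ?num_real // -[leRHS]real_normK ?num_real // lerXn2r ?nnegrE // sin_le_norm.
by rewrite expr_div_n; lra.
Qed.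

Let mesh (n : nat) : R := n.+1%:R^-1.

(** Through 1 - cos t = 2 sin^2 (t / 2) this reduces to sin h / h tending to 1, the derivative of
    [sin] at 0. The limit is taken along nonzero points, whence the separate case [a = 0]. *)
Lemma oneBcos_cvg (a : R) :
  2 * (1 - cos (mesh n * a)) / mesh n ^+ 2 @[n --> \oo] --> a ^+ 2.
Proof.
have [->|a0] := eqVneq a 0.
  rewrite (_ : (fun n => _) = cst 0); first by rewrite expr0n; exact: cvg_cst.
  by apply/funext => n; rewrite mulr0 cos0 subrr mulr0 mul0r.
have m0 n : mesh n != 0 by rewrite invr_eq0 pnatr_eq0.
have H : h^-1 * sin h @[h --> (0 : R)^'] --> (1 : R).
  have [/cvg_ex[/= l Hl] E] := is_derive_sin (0 : R).
  have : l = 1.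
    by rewrite -cos0 -E; apply/esym/cvg_lim.
  move=> <-; move: Hl; apply: cvg_trans; apply: near_eq_cvg; near=> h.
  by rewrite /= sin0 subr0 addr0 [h *: 1]mulr1.
have c : mesh n * a / 2 @[n --> \oo] --> (0 : R).
  have := @cvg_harmonic R; rewrite /harmonic => h.
  have h1 : mesh n * a / 2 @[n --> \oo] --> 0 * a / 2.
    by apply: cvgMl; apply: cvgMl; exact: h.
  by move: h1; rewrite !mul0r.
move/cvgr_dnbhsP : H => /(_ (fun n => mesh n * a / 2)) H.
have {}H : (mesh n * a / 2)^-1 * sin (mesh n * a / 2) @[n --> \oo] --> (1 : R).
  by apply: H; split => // n; rewrite !mulf_neq0 // invr_eq0.
have H2 : a ^+ 2 * ((mesh n * a / 2)^-1 * sin (mesh n * a / 2)) ^+ 2 @[n --> \oo] --> a ^+ 2 * 1 ^+ 2.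
  by apply: cvgMr; exact: (cvg_comp _ _ H (@exprn_continuous R 2 1)).
move: H2; rewrite expr1n mulr1; apply: cvg_trans; apply: near_eq_cvg; near=> n.
rewrite /= oneBcos; move: (m0 n) (sin _) => mn S.
by field; rewrite mn a0.
Unshelve. all: end_near. Qed.

Lemma walk_symbol_cvg k :
  (1 - walk_symbol (mesh n) k) / mesh n ^+ 2 @[n --> \oo] -->
  enorm (lattice k : 'rV[R]_d) ^+ 2 / (4 * d%:R).
Proof.
have -> : (fun n => (1 - walk_symbol (mesh n) k) / mesh n ^+ 2) =
  (fun n => (\sum_(i < d) (2 * (1 - cos (mesh n * (k ord0 i)%:~R)) / mesh n ^+ 2)) / (4 * d%:R)).
  apply/funext => n; rewrite /walk_symbol opprB addrC subrK.
  have m0 : mesh n != 0 by rewrite invr_eq0 pnatr_eq0.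
  rewrite -mulr_suml -mulr_sumr; move: (\sum_(i < d) _) => S.
  by field; rewrite m0 dn0.
rewrite enorm_lattice_sqr; apply: cvgMl.
elim: (index_enum _) => [|i s IH].
  by under eq_fun do rewrite big_nil; rewrite big_nil; exact: cvg_cst.
under eq_fun do rewrite big_cons; rewrite big_cons.
by have := cvgD (@oneBcos_cvg (k ord0 i)%:~R) IH; exact.
Qed.

End random_walk.

(** * The half Laplacian as a uniform limit of symmetric difference operators *)

Section half_laplacian_approximation.
Context {R : realType} {d : nat} (d0 : (0 < d)%N).
Implicit Types (f g : 'rV[R]_d -> R) (k : 'rV[int]_d) (x y z : 'rV[R]_d).
Implicit Types (l : seq (R * 'rV[R]_d)).

Let torus_vol : 0 < (2 * pi) ^+ d :> R.
Proof. by rewrite exprn_gt0 // mulr_gt0 // pi_gt0. Qed.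

Let dn_gt0 : 0 < d%:R :> R.
Proof. by rewrite ltr0n. Qed.

Let mesh (n : nat) : R := n.+1%:R^-1.

Lemma fcoef_decay f : psmooth f -> exists2 B : R, 0 <= B &
  forall k x, `|fcoef f k x| <= B * omega k ^+ 2.
Proof. by move=> /fmode_decay[B [B0 HB]]; exists B => // k x; exact: HB. Qed.

Lemma has_sum_half_laplacian f x : psmooth f ->
  has_sum (fun k => enorm (lattice k : 'rV[R]_d) * fcoef f k x)
    ((2 * pi) ^+ d * half_laplacian f x).
Proof.
move=> sf; have cf := psmooth_cper sf; have [B B0 HB] := fcoef_decay sf.
have Hb k : `|enorm (lattice k : 'rV[R]_d) * fcoef f k x| <= B * omega k.
  have e0 := enorm_ge0 (lattice k : 'rV[R]_d); have o0 := @omega_gt0 R d k.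
  rewrite normrM (ger0_norm e0).
  apply: le_trans (ler_wpM2l e0 (HB k x)) _.
  rewrite mulrCA ler_wpM2l // expr2 mulrA ler_piMl ?(ltW o0) //.
  apply: le_trans (omega_enorm k); rewrite mulrC ler_wpM2l ?(ltW o0) //.
  by move: e0; move: (enorm _) => e e0; nra.
have sb : sum_bounded (fun k : 'rV[int]_d => B * omega k) (B * 5 ^+ d).
  by move=> F; rewrite -mulr_sumr ler_wpM2l //; exact: omega_summable.
have [s Hs] := has_sum_dominated Hb sb.
suff -> : (2 * pi) ^+ d * half_laplacian f x = s by [].
rewrite /half_laplacian mulrA divff ?mul1r ?gt_eqF //; apply: has_sum_sum.
apply: (eq_has_sum _ Hs) => k; congr (_ * _).
rewrite fcoefE; have -> : (fun y => f y * cos (dot (lattice k) (y - x))) =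
  (fun y => cos (dot (lattice k) x) * (f y * cos (0 + dot (lattice k) y)) +
            sin (dot (lattice k) x) * (f y * sin (0 + dot (lattice k) y))).
  by apply/funext => y; rewrite !add0r dotDr dotNr cosB; ring.
have cc := cperM cf (cper_cosmode k 0); have cs := cperM cf (cper_sinmode k 0).
rewrite tintegralD; [|exact: cperZ|exact: cperZ].
rewrite !tintegralZ // [X in X + _]mulrC [X in _ + X]mulrC.
by congr (_ * _ + _ * _); apply: eq_Rintegral => y _; rewrite add0r.
Qed.

Definition shiftdiff l f x : R := \sum_(p <- l) p.1 * (f x - f (x + p.2)).

Lemma shiftdiffE l f x :
  shiftdiff l f x = shiftsum l (fun=> 1) x * f x - shiftsum l f x.
Proof.
rewrite /shiftdiff /shiftsum mulr_suml -sumrB; apply: eq_bigr => p _.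
by rewrite mulr1 mulrBr.
Qed.

Lemma walk_mass s n x : shiftsum (walk s n) (fun=> 1 : R) x = 1.
Proof.
elim: n x => [|n IH] x; first by rewrite /shiftsum big_seq1 /= mulr1.
have -> : walk s n.+1 = shift_comp (walk_step s) (walk s n) by [].
rewrite shiftsum_comp (eq_shiftsum _ IH) walk_stepE.
rewrite sumr_const card_ord -(mulr_natr (1 + 1) d); have := dn_gt0.
by move: d%:R => t t0; field; rewrite gt_eqF.
Qed.

(* The mesh being [1 / n.+1], this factor makes
   [half_weight n * sqrt (1 - walk_symbol (mesh n) k)] tend to [|k|]. *)
Definition half_weight (n : nat) : R := 2 * Num.sqrt d%:R * n.+1%:R.

(** The walk at a random time: the law after [m.+1] steps is weighted by the coefficient of 1 -
    x^(m+1) in [wsum]. The parameter [n] fixes the mesh and [N] truncates the series. *)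
Definition half_walk n N : seq (R * 'rV[R]_d) :=
  [seq (half_weight n * (cbin m - cbin m.+1) * p.1, p.2)
    | m <- iota 0 N, p <- walk (mesh n) m.+1].

Lemma half_weight_ge0 n : 0 <= half_weight n.
Proof. by rewrite !mulr_ge0 // sqrtr_ge0. Qed.

Lemma half_walkE n N f x : shiftsum (half_walk n N) f x =
  \sum_(m < N) half_weight n * (cbin m - cbin m.+1) * shiftsum (walk (mesh n) m.+1) f x.
Proof.
rewrite /shiftsum /half_walk big_allpairs_dep -(big_mkord xpredT
  (fun m => half_weight n * (cbin m - cbin m.+1) * shiftsum (walk (mesh n) m.+1) f x)).
rewrite /index_iota subn0; apply: eq_bigr => m _.
by rewrite /shiftsum mulr_sumr; apply: eq_bigr => p _ /=; rewrite mulrA.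
Qed.

Lemma half_walk_nonneg n N : shift_nonneg (half_walk n N).
Proof.
move=> _ /allpairsPdep[m [p [_ pw ->]]] /=.
rewrite !mulr_ge0 ?half_weight_ge0 // ?subr_ge0 ?cbin_decr //.
exact: walk_nonneg pw.
Qed.

Lemma half_walk_symmetric n N : shift_symmetric (half_walk n N).
Proof.
move=> f x; rewrite half_walkE /half_walk big_allpairs_dep -(big_mkord xpredT
  (fun m => half_weight n * (cbin m - cbin m.+1) * shiftsum (walk (mesh n) m.+1) f x)).
rewrite /index_iota subn0; apply: eq_bigr => m _.
by rewrite walk_symmetric mulr_sumr; apply: eq_bigr => p _ /=; rewrite mulrA.
Qed.

Definition half_symbol n N k : R := half_weight n * wsum N (walk_symbol (mesh n) k).

Lemma has_sum_half_walk n N f x : psmooth f ->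
  has_sum (fun k => half_symbol n N k * fcoef f k x)
    ((2 * pi) ^+ d * shiftdiff (half_walk n N) f x).
Proof.
move=> sf; have inv := fourier_inversion x sf.
have H (m : 'I_N) := has_sumZ (half_weight n * (cbin m - cbin m.+1))
  (has_sumB inv (has_sum_walk d0 (mesh n) m.+1 x sf)).
have := has_sum_sumr (index_enum 'I_N) H.
rewrite (_ : \sum_(m < N) _ = (2 * pi) ^+ d * shiftdiff (half_walk n N) f x).
  apply: eq_has_sum => k; rewrite /half_symbol /wsum mulr_sumr mulr_suml.
  by apply: eq_bigr => m _; ring.
rewrite shiftdiffE !half_walkE mulr_suml -sumrB mulr_sumr; apply: eq_bigr => m _.
by rewrite walk_mass; ring.
Qed.

Lemma half_weight_sqrt n k : half_weight n * Num.sqrt (1 - walk_symbol (mesh n) k) =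
  Num.sqrt (4 * d%:R * ((1 - walk_symbol (mesh n) k) / mesh n ^+ 2)).
Proof.
have -> : 4 * d%:R * ((1 - walk_symbol (mesh n) k) / mesh n ^+ 2) =
    (2 * n.+1%:R) ^+ 2 * (d%:R * (1 - walk_symbol (mesh n) k)).
  by rewrite /mesh exprVn invrK; ring.
rewrite sqrtrM ?sqr_ge0 // sqrtr_sqr ger0_norm ?mulr_ge0 // sqrtrM //.
by rewrite /half_weight; ring.
Qed.

(** Since 1 - cos t is at most t^2 / 2, the discrete symbol never exceeds |k|. This is the
    domination that allows the mesh to tend to 0 under the sum. *)
Lemma half_weight_sqrt_le n k :
  half_weight n * Num.sqrt (1 - walk_symbol (mesh n) k) <= enorm (lattice k : 'rV[R]_d).
Proof.
rewrite half_weight_sqrt -[leRHS](ger0_norm (enorm_ge0 _)) -sqrtr_sqr ler_sqrt ?sqr_ge0 //.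
rewrite enorm_lattice_sqr /walk_symbol opprB addrC subrK /mesh exprVn invrK.
have -> : 4 * d%:R * ((2 * d%:R)^-1 *
    (\sum_(i < d) (1 - cos (n.+1%:R^-1 * (k ord0 i)%:~R))) * n.+1%:R ^+ 2) =
   \sum_(i < d) (2 * n.+1%:R ^+ 2) * (1 - cos (n.+1%:R^-1 * (k ord0 i)%:~R)) :> R.
  rewrite -mulr_sumr; move: (\sum_(i < d) _) (dn_gt0) => S; move: d%:R => t t0.
  by field; rewrite gt_eqF.
apply: ler_sum => i _.
have := oneBcos_le (n.+1%:R^-1 * (k ord0 i)%:~R : R); rewrite exprMn exprVn.
have p : 0 < n.+1%:R ^+ 2 :> R by rewrite exprn_gt0.
rewrite -(ler_pM2l (mulr_gt0 (ltr0Sn R 1) p)) => /le_trans; apply.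
by rewrite le_eqVlt; apply/orP; left; apply/eqP; field.
Qed.

Lemma half_weight_sqrt_cvg k :
  half_weight n * Num.sqrt (1 - walk_symbol (mesh n) k) @[n --> \oo] -->
  enorm (lattice k : 'rV[R]_d).
Proof.
under eq_fun do rewrite half_weight_sqrt.
have H : 4 * d%:R * ((1 - walk_symbol (mesh n) k) / mesh n ^+ 2) @[n --> \oo] -->
    4 * d%:R * (enorm (lattice k : 'rV[R]_d) ^+ 2 / (4 * d%:R)).
  by apply: cvgMr; exact: walk_symbol_cvg.
have := cvg_comp _ _ H (@sqrt_continuous R _).
rewrite mulrCA divff ?mulr1; last by rewrite mulf_neq0 // gt_eqF.
by rewrite sqrtr_sqr ger0_norm ?enorm_ge0.
Qed.

Lemma half_symbol_ge0 n N k : 0 <= half_symbol n N k.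
Proof.
rewrite mulr_ge0 ?half_weight_ge0 // wsum_ge0 ?walk_symbol_le1 //.
exact: walk_symbol_ge0.
Qed.

Lemma half_symbol_le n N k :
  half_symbol n N.+1 k <= half_weight n * Num.sqrt (1 - walk_symbol (mesh n) k).
Proof.
rewrite ler_wpM2l ?half_weight_ge0 // wsum_le ?walk_symbol_le1 //.
exact: walk_symbol_ge0.
Qed.

(** Both symbols lie between 0 and |k|, so one factor [omega] bounds their difference by 1; the
    second factor is left as the summable weight. *)
Lemma omega_enorm_le1 k (a b : R) : 0 <= a -> a <= b -> b <= enorm (lattice k : 'rV[R]_d) ->
  `|omega k * (a - b)| <= 1.
Proof.
move=> a0 ab bk; have o0 := @omega_gt0 R d k.
rewrite normrM gtr0_norm // distrC ger0_norm ?subr_ge0 //.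
apply: le_trans (omega_enorm k); rewrite ler_wpM2l ?(ltW o0) //.
have := enorm_ge0 (lattice k : 'rV[R]_d); move: (enorm _) bk => e bk e0; nra.
Qed.

(** For a fixed mesh, letting [N] grow produces the square root [r n]; then the mesh tends to 0.
    Both limits are taken on the symbols, and the bounds on the coefficients do not depend on [x],
    so the estimate is uniform. *)
Lemma shiftdiff_cvg f : psmooth f -> forall e, 0 < e ->
  \forall n \near \oo, \forall N \near \oo, forall x,
    `|shiftdiff (half_walk n N.+1) f x - half_laplacian f x| <= e.
Proof.
move=> sf e e0; have [B B0 HB] := fcoef_decay sf.
have om0 k := ltW (@omega_gt0 R d k).
have B1 : 0 < B + 1 by rewrite ltr_wpDl.
(* Each of the two replacements of symbols costs at most [B * e1] in the sum, which is (2 pi)^d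
   times the quantity to be bounded. *)
pose e1 := (2 * pi) ^+ d * e / 2 / (B + 1).
have e10 : 0 < e1 by rewrite !divr_gt0 // mulr_gt0.
pose r n k := half_weight n * Num.sqrt (1 - walk_symbol (mesh n) k).
have r0 n k : 0 <= r n k by rewrite mulr_ge0 ?half_weight_ge0 ?sqrtr_ge0.
have T1 := @tannery R _ omega _ (fun n k => omega k * (r n k - enorm (lattice k : 'rV[R]_d)))
  1 om0 omega_summable.
have {}T1 : \forall n \near \oo, forall F : {fset 'rV[int]_d},
    \sum_(k <- F) `|omega k * (r n k - enorm (lattice k : 'rV[R]_d))| * omega k <= e1.
  apply: T1 => // [n k|k]; first by apply: omega_enorm_le1 => //; exact: half_weight_sqrt_le.
  have -> : 0 = omega k * (enorm (lattice k : 'rV[R]_d) - enorm (lattice k : 'rV[R]_d)).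
    by rewrite subrr mulr0.
  apply: cvgMr; apply: cvgB; first exact: half_weight_sqrt_cvg.
  exact: cvg_cst.
near=> n.
have T2 := @tannery R _ omega _ (fun N k => omega k * (half_symbol n N.+1 k - r n k))
  1 om0 omega_summable.
have {}T2 : \forall N \near \oo, forall F : {fset 'rV[int]_d},
    \sum_(k <- F) `|omega k * (half_symbol n N.+1 k - r n k)| * omega k <= e1.
  apply: T2 => // [N k|k].
    apply: omega_enorm_le1; first exact: half_symbol_ge0.
      exact: half_symbol_le.
    exact: half_weight_sqrt_le.
  have -> : 0 = omega k * (r n k - r n k) by rewrite subrr mulr0.
  apply: cvgMr; apply: cvgB; last exact: cvg_cst.
  by apply: cvgMr; apply: wsum_cvg; [exact: walk_symbol_ge0|exact: walk_symbol_le1].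
near=> N => x.
have T1n : forall F : {fset 'rV[int]_d},
    \sum_(k <- F) `|omega k * (r n k - enorm (lattice k : 'rV[R]_d))| * omega k <= e1.
  by near: n.
have T2N : forall F : {fset 'rV[int]_d},
    \sum_(k <- F) `|omega k * (half_symbol n N.+1 k - r n k)| * omega k <= e1.
  by near: N.
have H := has_sumB (has_sum_half_walk n N.+1 x sf) (has_sum_half_laplacian x sf).
rewrite -(ler_pM2l torus_vol) -{1}(gtr0_norm torus_vol) -normrM mulrBr.
apply: (has_sum_norm_le H) => F.
apply: le_trans (ler_norm_sum _ _ _) _.
apply: (@le_trans _ _ (\sum_(k <- F) (B * (`|omega k * (half_symbol n N.+1 k - r n k)| * omega k) +
   B * (`|omega k * (r n k - enorm (lattice k : 'rV[R]_d))| * omega k)))).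
  apply: ler_sum => k _.
  have E : half_symbol n N.+1 k - enorm (lattice k : 'rV[R]_d) =
    (half_symbol n N.+1 k - r n k) + (r n k - enorm (lattice k : 'rV[R]_d)).
    by rewrite addrA subrK.
  rewrite -mulrBl normrM E !normrM !(ger0_norm (om0 k)) -mulrDr -mulrDl -mulrDr.
  rewrite [omega k * _]mulrC -mulrA -expr2 mulrCA.
  by apply: ler_pM => //; exact: ler_normD.
rewrite big_split /= -!mulr_sumr.
apply: (@le_trans _ _ (B * e1 + B * e1)).
  by apply: lerD; apply: ler_wpM2l.
apply: (@le_trans _ _ ((B + 1) * e1 + (B + 1) * e1)).
  by apply: lerD; apply: ler_wpM2r; rewrite ?(ltW e10) // lerDl.
by rewrite /e1 le_eqVlt; apply/orP; left; apply/eqP; field; rewrite gt_eqF.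
Unshelve. all: end_near. Qed.

End half_laplacian_approximation.

(** * Equidistribution of the walk and the lower bound on the weights *)

Section half_laplacian_positivity.
Context {R : realType} {d : nat} (d0 : (0 < d)%N).
Implicit Types (f g : 'rV[R]_d -> R) (k : 'rV[int]_d) (x y z : 'rV[R]_d).
Implicit Types (l : seq (R * 'rV[R]_d)).

Let torus_vol : 0 < (2 * pi) ^+ d :> R.
Proof. by rewrite exprn_gt0 // mulr_gt0 // pi_gt0. Qed.

Let dn_gt0 : 0 < d%:R :> R.
Proof. by rewrite ltr0n. Qed.

Let mesh (n : nat) : R := n.+1%:R^-1.

(** The limit of (1 - [walk_symbol]) / mesh^2. After a (n+1)^2 steps the symbol is close to exp (- a
    [rate k]), a Fourier coefficient of the heat kernel. *)
Let rate k : R := enorm (lattice k : 'rV[R]_d) ^+ 2 / (4 * d%:R).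

Let rate_ge0 k : 0 <= rate k.
Proof. by rewrite divr_ge0 ?sqr_ge0 // mulr_ge0. Qed.

Lemma rate_gt0 k : k != 0 -> 0 < rate k.
Proof.
move=> k0; apply: divr_gt0; last exact: mulr_gt0.
rewrite enorm_lattice_sqr.
have [i ki] : exists i, k ord0 i != 0.
  apply/existsP; apply: contra_neqT k0 => /existsPn H.
  by apply/rowP => i; rewrite mxE; apply/eqP; rewrite -[_ == _]negbK H.
rewrite (bigD1 i) //= ltr_pwDl ?sumr_ge0 //; last by move=> j _; exact: sqr_ge0.
by rewrite exprn_even_gt0 //= intr_eq0.
Qed.

Lemma expR_omega k : expR (- enorm (lattice k : 'rV[R]_d) ^+ 2) <= omega k.
Proof.
rewrite enorm_lattice_sqr /omega.
elim: (index_enum _) => [|i s IH]; first by rewrite !big_nil oppr0 expR0.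
rewrite !big_cons opprD expRD; apply: ler_pM; rewrite ?expR_ge0 //.
rewrite expRN lef_pV2 ?posrE ?expR_gt0 ?ltr_pwDl ?sqr_ge0 //.
exact: expR_ge1Dx.
Qed.

Lemma expR_natmul_cvg0 (r : R) : 0 < r -> expR (- (n%:R * r)) @[n --> \oo] --> (0 : R).
Proof.
move=> r0; under eq_fun do rewrite -mulrN expRM_natl.
by apply: cvg_expr; rewrite gtr0_norm ?expR_gt0 // -expR0 ltr_expR oppr_lt0.
Qed.

(** At a large time the nonzero modes of the heat kernel are together small against the mean. The
    time is written as a square because the number of steps is later compared with square roots. *)
Lemma heat_tail : exists2 mu : nat, (0 < mu)%N & forall F : {fset 'rV[int]_d},
  \sum_(k <- F | k != 0) expR (- ((mu ^ 2)%N%:R * rate k)) <= 4^-1.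
Proof.
have om0 k := ltW (@omega_gt0 R d k).
have q0 : 0 < 4^-1 :> R by rewrite invr_gt0.
have [||N _ H] := @tannery R _ omega _
    (fun m k => if k == 0 then 0 else expR (- (m%:R * rate k))) 1
    om0 omega_summable _ _ _ q0.
- move=> n k; case: ifP => _; rewrite ?normr0 // gtr0_norm ?expR_gt0 //.
  by rewrite -expR0 ler_expR oppr_le0 mulr_ge0.
- move=> k; case: eqP => [_|/eqP k0]; first exact: cvg_cst.
  by apply: expR_natmul_cvg0; exact: rate_gt0.
(* The square of this number is at least [N + 4 * d]: time [N] makes the dominated sum small, and
   time [4 * d] gives exp (- |k|^2), which is at most [omega k]. *)
exists (N + 4 * d)%N; first by rewrite addn_gt0 muln_gt0 d0 orbT.
move=> F; apply: le_trans (H N (leqnn N) F).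
rewrite [leRHS](bigID (fun k => k == 0)) /= ler_wpDl ?sumr_ge0 //.
  by move=> k _; rewrite mulr_ge0.
apply: ler_sum => k /negbTE ->; rewrite gtr0_norm ?expR_gt0 //.
apply: (@le_trans _ _ (expR (- (N%:R * rate k)) *
    expR (- enorm (lattice k : 'rV[R]_d) ^+ 2))); last first.
  by rewrite ler_wpM2l ?expR_ge0 // expR_omega.
rewrite -expRD ler_expR -opprD lerN2.
have -> : enorm (lattice k : 'rV[R]_d) ^+ 2 = (4 * d)%N%:R * rate k.
  by rewrite /rate natrM mulrCA divff ?mulr1 // mulf_neq0 // gt_eqF.
rewrite -mulrDl -natrD ler_wpM2r // ler_nat.
by rewrite expnS expn1 leq_pmulr // addn_gt0 muln_gt0 d0 orbT.
Qed.

Lemma walk_symbol_exp n k a : walk_symbol (mesh n) k ^+ (a * n.+1 ^ 2) <=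
  expR (- (a%:R * ((1 - walk_symbol (mesh n) k) / mesh n ^+ 2))).
Proof.
set p := walk_symbol _ k; have p0 : 0 <= p by exact: walk_symbol_ge0.
have -> : a%:R * ((1 - p) / mesh n ^+ 2) = (a * n.+1 ^ 2)%N%:R * (1 - p).
  by rewrite /mesh exprVn invrK natrM natrX; ring.
rewrite -mulrN expRM_natl lerXn2r ?nnegrE ?expR_ge0 //.
by rewrite opprB; have := expR_ge1Dx (p - 1); rewrite addrC subrK.
Qed.

Lemma fcoef_le f k x : cper f -> (forall y, 0 <= f y) ->
  `|fcoef f k x| <= \int[torus d]_y f y.
Proof.
move=> cf f0; rewrite fcoefE.
have cg : cper (fun y => f y * cos (dot (lattice k) (y - x))).
  by apply: cperM => //; exact: cper_cosdot.
rewrite ler_norml; apply/andP; split.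
  rewrite -mulN1r -tintegralZ //; apply: le_tintegral; [exact: cperZ|by []|move=> y].
  by rewrite mulrC ler_wpM2l // cos_geN1.
apply: le_tintegral => // y.
by rewrite ler_piMr // cos_le1.
Qed.

(** The zero mode contributes the integral of [f], the others together at most half of it. As the
    symbol lies in [0, 1], further steps only decrease its powers, so they are compared with the
    heat kernel. Its part is at most a quarter because each coefficient of a nonnegative [f] is at
    most the integral of [f], which keeps [mu] independent of [f]. The other quarter is the
    discretisation error, estimated by the decay of the coefficients; how large [n] must be thus
    depends on [f]. *)
Lemma walk_lower_bound (mu : nat) f : (forall F : {fset 'rV[int]_d},
    \sum_(k <- F | k != 0) expR (- ((mu ^ 2)%N%:R * rate k)) <= 4^-1) ->
  psmooth f -> (forall y, 0 <= f y) -> 0 < \int[torus d]_y f y ->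
  \forall n \near \oo, forall m x, (mu ^ 2 * n.+1 ^ 2 <= m)%N ->
    (\int[torus d]_y f y) / 2 <= (2 * pi) ^+ d * shiftsum (walk (mesh n) m) f x.
Proof.
move=> Hmu sf f0 I0; set I := Rintegral _ _ _ in I0 *; have cf := psmooth_cper sf.
have [B B0 HB] := fcoef_decay sf; have om0 k := ltW (@omega_gt0 R d k).
have B1 : 0 < B + 1 by rewrite ltr_wpDl.
pose En n k : R := expR (- ((mu ^ 2)%N%:R * ((1 - walk_symbol (mesh n) k) / mesh n ^+ 2))).
pose E k : R := expR (- ((mu ^ 2)%N%:R * rate k)).
have En01 n k : 0 <= En n k <= 1.
  rewrite expR_ge0 -expR0 ler_expR oppr_le0 mulr_ge0 // divr_ge0 ?sqr_ge0 //.
  by rewrite subr_ge0 walk_symbol_le1.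
have E01 k : 0 <= E k <= 1 by rewrite expR_ge0 -expR0 ler_expR oppr_le0 mulr_ge0.
have T := @tannery R _ omega _ (fun n k => En n k - E k) 1 om0 omega_summable.
have e0 : 0 < I / 4 / (B + 1) by rewrite !divr_gt0.
have {}T : \forall n \near \oo, forall F : {fset 'rV[int]_d},
    \sum_(k <- F) `|En n k - E k| * omega k <= I / 4 / (B + 1).
  apply: T => // [n k|k].
    by have := En01 n k; have := E01 k; rewrite ler_norml; lra.
  have -> : 0 = E k - E k by rewrite subrr.
  apply: cvgB; last exact: cvg_cst.
  have H : - ((mu ^ 2)%N%:R * ((1 - walk_symbol (mesh n) k) / mesh n ^+ 2)) @[n --> \oo] -->
      - ((mu ^ 2)%N%:R * rate k).
    by apply: cvgN; apply: cvgMr; exact: walk_symbol_cvg.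
  exact: (cvg_comp _ _ H (@continuous_expR R _)).
near=> n => m x am.
have Tn : forall F : {fset 'rV[int]_d},
    \sum_(k <- F) `|En n k - E k| * omega k <= I / 4 / (B + 1) by near: n.
have p01 k : 0 <= walk_symbol (mesh n) k <= 1.
  by rewrite walk_symbol_ge0 ?walk_symbol_le1.
have f00 : fcoef f 0 x = I.
  rewrite fcoefE; apply: eq_Rintegral => y _.
  rewrite (_ : lattice 0 = 0); last by apply/rowP => i; rewrite !mxE.
  by rewrite dotC -(scale0r (0 : 'rV[R]_d)) dotZr mul0r cos0 mulr1.
have p00 : walk_symbol (mesh n) (0 : 'rV[int]_d) = 1 :> R.
  rewrite /walk_symbol big1 ?mulr0 ?subr0 // => i _.
  by rewrite mxE mulr0z mulr0 cos0 subrr.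
have H := has_sumB (has_sum_walk d0 (mesh n) m x sf) (has_sum_single 0 I).
suff : `|(2 * pi) ^+ d * shiftsum (walk (mesh n) m) f x - I| <= I / 4 + I / 4.
  by rewrite ler_norml => /andP[h _]; lra.
apply: (has_sum_norm_le H) => F; apply: le_trans (ler_norm_sum _ _ _) _.
rewrite (bigID (fun k => k == 0)) /= big1 ?add0r; last first.
  by move=> k /eqP ->; rewrite p00 expr1n mul1r eqxx f00 subrr normr0.
apply: (@le_trans _ _ (\sum_(k <- F | k != 0)
    (`|En n k - E k| * (B * omega k) + E k * I))).
  apply: ler_sum => k /negbTE ->; rewrite subr0 normrM ger0_norm; last first.
    by rewrite exprn_ge0 //; case/andP: (p01 k).
  have pm : walk_symbol (mesh n) k ^+ m <= `|En n k - E k| + E k.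
    apply: (@le_trans _ _ (En n k)); last first.
      by rewrite -lerBlDr; exact: ler_norm.
    apply: le_trans (walk_symbol_exp n k (mu ^ 2)).
    by apply: ler_wiXn2l => //; case/andP: (p01 k).
  apply: (@le_trans _ _ ((`|En n k - E k| + E k) * `|fcoef f k x|)).
    by rewrite ler_wpM2r.
  rewrite mulrDl; apply: lerD; apply: ler_wpM2l => //.
  - apply: le_trans (HB k x) _; rewrite ler_wpM2l // expr2 ler_piMr //.
    exact: omega_le1.
  - exact: expR_ge0.
  - exact: fcoef_le.
rewrite big_split /=; apply: lerD.
  apply: (@le_trans _ _ (B * (\sum_(k <- F) `|En n k - E k| * omega k))).
    rewrite mulr_sumr [leRHS](bigID (fun k => k == 0)) /= ler_wpDl ?sumr_ge0 //.
      by move=> k _; rewrite !mulr_ge0.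
    by apply: ler_sum => k _; rewrite mulrCA.
  apply: (@le_trans _ _ ((B + 1) * (I / 4 / (B + 1)))).
    by apply: ler_pM => //; rewrite ?lerDl // sumr_ge0 // => k _; rewrite mulr_ge0.
  by rewrite mulrCA divff ?mulr1 // gt_eqF.
rewrite -mulr_suml mulrC ler_wpM2l ?(ltW I0) //; exact: Hmu.
Unshelve. all: end_near. Qed.

(** The bounds of order n^(-1/2) give at least 1/(2q) at q^2 and at most 1/(4q) at 16 q^2; the
    factor 16 is what separates them. *)
Lemma cbin_gap (q : nat) : (0 < q)%N ->
  (4 * q%:R)^-1 <= cbin (q ^ 2) - cbin (16 * q ^ 2) :> R.
Proof.
move=> q0; have qR : 0 < q%:R :> R by rewrite ltr0n.
have h1 : (2 * q%:R)^-1 <= cbin (q ^ 2) :> R.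
  rewrite -[leLHS]mul1r ler_pdivrMr ?mulr_gt0 //.
  rewrite -(@ler_pXn2r _ 2) ?nnegrE //; last by rewrite !mulr_ge0 // cbin_ge0.
  rewrite expr1n; apply: le_trans (cbin_sqr_ge (_ : 0 < q ^ 2)%N) _; first by rewrite expn_gt0 q0.
  by rewrite exprMn (_ : (4 * q ^ 2)%N%:R = (2 * q%:R) ^+ 2) // natrM natrX; ring.
have h2 : cbin (16 * q ^ 2) <= (4 * q%:R)^-1 :> R.
  rewrite -[leRHS]mul1r ler_pdivlMr ?mulr_gt0 //.
  rewrite -(@ler_pXn2r _ 2) ?nnegrE //; last by rewrite !mulr_ge0 // cbin_ge0.
  rewrite expr1n; apply: le_trans (cbin_sqr_le (16 * q ^ 2)).
  rewrite exprMn ler_wpM2l ?sqr_ge0 // -natrM -natrX ler_nat; lia.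
have -> : (4 * q%:R)^-1 = (2 * q%:R)^-1 - (4 * q%:R)^-1 :> R.
  by field; rewrite gt_eqF.
exact: lerB.
Qed.

(** Only the indices from q^2 to 16 q^2, with q = mu (n+1), are kept. Their coefficients telescope
    to at least 1/(4q), and [half_weight n], being at least 2 (n+1), turns this into 1/(2 mu), free
    of [n]. Equidistribution supplies the remaining factor 1 / (2 (2 pi)^d). *)
Lemma half_walk_lower_bound : exists2 c : R, 0 < c & forall f,
  psmooth f -> (forall y, 0 <= f y) ->
  \forall n \near \oo, \forall N \near \oo, forall x,
    c * (\int[torus d]_y f y) <= shiftsum (half_walk n N.+1) f x.
Proof.
have [mu mu0 Hmu] := heat_tail; have muR : 0 < mu%:R :> R by rewrite ltr0n.
pose c : R := (4 * mu%:R * (2 * pi) ^+ d)^-1.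
exists c => [|f sf f0]; first by rewrite invr_gt0 !mulr_gt0.
have : 0 <= \int[torus d]_y f y by apply: Rintegral_ge0.
rewrite le_eqVlt => /predU1P[<-|I0].
  near=> n; near=> N => x; rewrite mulr0.
  by apply: shiftsum_ge0 => //; exact: half_walk_nonneg.
have W := walk_lower_bound Hmu sf f0 I0.
near=> n; near=> N => x.
have Wn : forall m x, (mu ^ 2 * n.+1 ^ 2 <= m)%N ->
    (\int[torus d]_y f y) / 2 <= (2 * pi) ^+ d * shiftsum (walk (mesh n) m) f x.
  by near: n.
set I := Rintegral _ _ _ in I0 Wn *.
pose q := (mu * n.+1)%N; have q0 : (0 < q)%N by rewrite muln_gt0 mu0.
have q16 : (16 * q ^ 2 <= N.+1)%N by apply: leqW; near: N; exact: nbhs_infty_ge.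
have qq : (q ^ 2 <= 16 * q ^ 2)%N by rewrite leq_pmull.
pose t m : R := @half_weight R d n * (cbin m - cbin m.+1) * shiftsum (walk (mesh n) m.+1) f x.
have t0 m : 0 <= t m.
  rewrite !mulr_ge0 ?half_weight_ge0 ?subr_ge0 ?cbin_decr //.
  by apply: shiftsum_ge0 => //; exact: walk_nonneg.
pose K := I / (2 * (2 * pi) ^+ d).
have tK m : (q ^ 2 <= m)%N -> @half_weight R d n * K * (cbin m - cbin m.+1) <= t m.
  move=> qm; rewrite mulrAC; apply: ler_wpM2l.
    by rewrite mulr_ge0 ?half_weight_ge0 // subr_ge0 cbin_decr.
  rewrite /K invfM mulrA ler_pdivrMr // [leRHS]mulrC; apply: Wn.
  by apply: leqW; rewrite -expnMn.
rewrite half_walkE -(big_mkord xpredT t).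
rewrite (@big_cat_nat _ _ _ (q ^ 2)) //=; last exact: leq_trans qq q16.
rewrite ler_wpDl ?sumr_ge0 // (@big_cat_nat _ _ _ (16 * q ^ 2)) //=.
rewrite ler_wpDr ?sumr_ge0 //.
apply: (@le_trans _ _ (\sum_(q ^ 2 <= m < 16 * q ^ 2) @half_weight R d n * K * (cbin m - cbin m.+1))); last first.
  by rewrite !big_nat; apply: ler_sum => m /andP[qm _]; exact: tK.
rewrite -mulr_sumr (@telescope_sumr_eq _ _ _ (fun m => - cbin m)) //; last first.
  by move=> m _; rewrite opprK addrC.
rewrite opprK [- _ + _]addrC.
have K0 : 0 <= K by rewrite divr_ge0 ?(ltW I0) // mulr_ge0 // ltW.
apply: (@le_trans _ _ (@half_weight R d n * K * (4 * q%:R)^-1)); last first.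
  by rewrite ler_wpM2l ?cbin_gap // mulr_ge0 // half_weight_ge0.
have sd : 1 <= Num.sqrt d%:R :> R.
  by rewrite -[leLHS]sqrtr1 ler_sqrt // ler1n.
have nR : 0 < n.+1%:R :> R by [].
apply: (@le_trans _ _ (2 * n.+1%:R * K * (4 * q%:R)^-1)).
  rewrite /K /q /c natrM le_eqVlt; apply/orP; left; apply/eqP.
  move: (torus_vol) muR nR; move: ((2 * pi) ^+ d) (mu%:R) (n.+1%:R) => V M n1 V0 M0 n10.
  by field; rewrite !gt_eqF.
rewrite ler_wpM2r ?invr_ge0 ?mulr_ge0 // ler_wpM2r //.
by rewrite /half_weight ler_wpM2r // -{1}[2]mulr1 ler_wpM2l.
Unshelve. all: end_near. Qed.

(** One list of weights serves two functions because the equation involves [u] and its square, whose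
    contributions have a sign only after being combined under the same weights. The constant [c] is
    chosen before the functions. *)
Lemma half_laplacian_approx : exists2 c : R, 0 < c &
  forall f g e, psmooth f -> psmooth g -> 0 < e ->
  exists l, [/\ shift_nonneg l, shift_symmetric l,
    forall x, `|shiftdiff l f x - half_laplacian f x| <= e,
    forall x, `|shiftdiff l g x - half_laplacian g x| <= e &
    (forall y, 0 <= f y) -> forall x, c * (\int[torus d]_y f y) <= shiftsum l f x].
Proof.
have [c c0 Hc] := half_walk_lower_bound; exists c => // f g e sf sg e0.
have Hf := shiftdiff_cvg d0 sf e0; have Hg := shiftdiff_cvg d0 sg e0.
have [n [Hn1 Hn2 Hn3]] : exists n, [/\
    \forall N \near \oo, forall x, `|shiftdiff (half_walk n N.+1) f x - half_laplacian f x| <= e,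
    \forall N \near \oo, forall x, `|shiftdiff (half_walk n N.+1) g x - half_laplacian g x| <= e &
    (forall y, 0 <= f y) -> \forall N \near \oo, forall x,
      c * (\int[torus d]_y f y) <= shiftsum (half_walk n N.+1) f x].
  have [f0|nf0] := pselect (forall y, 0 <= f y).
    have [n [[h1 h2] h3]] := filter_ex (filterI (filterI Hf Hg) (Hc f sf f0)).
    by exists n; split => // _; exact h3.
  have [n [h1 h2]] := filter_ex (filterI Hf Hg).
  by exists n; split => // /nf0.
have [N [HN1 HN2 HN3]] : exists N, [/\
    forall x, `|shiftdiff (half_walk n N.+1) f x - half_laplacian f x| <= e,
    forall x, `|shiftdiff (half_walk n N.+1) g x - half_laplacian g x| <= e &
    (forall y, 0 <= f y) -> forall x,
      c * (\int[torus d]_y f y) <= shiftsum (half_walk n N.+1) f x].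
  have [f0|nf0] := pselect (forall y, 0 <= f y).
    have [N [[h1 h2] h3]] := filter_ex (filterI (filterI Hn1 Hn2) (Hn3 f0)).
    by exists N; split => // _; exact h3.
  have [N [h1 h2]] := filter_ex (filterI Hn1 Hn2).
  by exists N; split => // /nf0.
exists (half_walk n N.+1); split => //.
  exact: half_walk_nonneg.
exact: half_walk_symmetric.
Qed.

End half_laplacian_positivity.

(** * Sign properties of the half Laplacian *)

Section half_laplacian_properties.
Context {R : realType} {d : nat} (d0 : (0 < d)%N).
Implicit Types (f g u : 'rV[R]_d -> R) (k : 'rV[int]_d) (x y z : 'rV[R]_d).
Implicit Types (l : seq (R * 'rV[R]_d)).

Let torus_vol : 0 < (2 * pi) ^+ d :> R.
Proof. by rewrite exprn_gt0 // mulr_gt0 // pi_gt0. Qed.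

Lemma half_laplacianB f g x : psmooth f -> psmooth g ->
  half_laplacian (fun y => f y - g y) x = half_laplacian f x - half_laplacian g x.
Proof.
move=> sf sg; have cf := psmooth_cper sf; have cg := psmooth_cper sg.
apply: (mulfI (lt0r_neq0 torus_vol)); rewrite mulrBr.
have H := has_sumB (has_sum_half_laplacian x sf) (has_sum_half_laplacian x sg).
apply: (has_sum_uniq (has_sum_half_laplacian x (psmoothB sf sg))).
apply: (eq_has_sum _ H) => k; rewrite -mulrBr; congr (_ * _).
rewrite !fcoefE -tintegralB; try by apply: cperM => //; exact: cper_cosdot.
by apply: eq_Rintegral => y _; rewrite mulrBl.
Qed.

Lemma half_laplacianZ (c : R) f x : psmooth f ->
  half_laplacian (fun y => c * f y) x = c * half_laplacian f x.
Proof.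
move=> sf; have cf := psmooth_cper sf.
apply: (mulfI (lt0r_neq0 torus_vol)); rewrite [RHS]mulrCA.
have H := has_sumZ c (has_sum_half_laplacian x sf).
apply: (has_sum_uniq (has_sum_half_laplacian x (psmoothZ c sf))).
apply: (eq_has_sum _ H) => k; rewrite mulrCA; congr (_ * _).
rewrite !fcoefE -tintegralZ; last by apply: cperM => //; exact: cper_cosdot.
by apply: eq_Rintegral => y _; rewrite mulrA.
Qed.

Lemma cper_shiftdiff l f : cper f -> cper (shiftdiff l f).
Proof.
move=> cf; apply: cper_sum => p; apply: cperZ; apply: cperB => //.
exact: cper_shift.
Qed.

(** A uniform limit of the operators [shiftdiff l f], which are continuous and periodic. *)
Lemma cper_half_laplacian f : psmooth f -> cper (half_laplacian f).
Proof.
move=> sf; have [c _ H] := @half_laplacian_approx R d d0.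
have {}H e : 0 < e -> exists l, forall x, `|shiftdiff l f x - half_laplacian f x| <= e.
  by move=> e0; have [l [_ _ Hl _ _]] := H f f e sf sf e0; exists l.
split=> [|x j].
  move=> /= x; apply/(@cvgrPdist_le _ _ _ (nbhs (x : 'rV[R]_d))) => e e0; have e3 : 0 < e / 3 by rewrite divr_gt0.
  have [l Hl] := H _ e3; have [cl _] := cper_shiftdiff l (psmooth_cper sf).
  have /cvgrPdist_le /(_ _ e3) Hy := cl x.
  near=> y; have hy : `|shiftdiff l f x - shiftdiff l f y| <= e / 3 by near: y.
  have h1 := Hl x; have h2 := Hl y.
  have -> : half_laplacian f x - half_laplacian f y =
    - (shiftdiff l f x - half_laplacian f x) + (shiftdiff l f x - shiftdiff l f y) +
    (shiftdiff l f y - half_laplacian f y) by ring.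
  apply: le_trans (ler_normD _ _) _.
  apply: (@le_trans _ _ (e / 3 + e / 3 + e / 3)); last first.
    by rewrite le_eqVlt; apply/orP; left; apply/eqP; field.
  apply: lerD => //; apply: le_trans (ler_normD _ _) _.
  by apply: lerD => //; rewrite normrN.
apply/eqP; rewrite -subr_eq0 -normr_le0; apply/ler_addgt0Pl => e e0.
have e2 : 0 < e / 2 by rewrite divr_gt0.
have [l Hl] := H _ e2; have [_ pl] := cper_shiftdiff l (psmooth_cper sf).
have h1 := Hl x; have := Hl (x + (2 * pi) *: lattice j); rewrite pl => h2.
rewrite addr0 -(subrKA (shiftdiff l f x)) [e]splitr.
apply: le_trans (ler_normD _ _) _; apply: lerD => //.
by rewrite distrC.
Unshelve. all: end_near. Qed.

(** At a zero of [h] the difference operator reduces to minus the weighted sum of translates of [h],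
    which the approximation bounds below by the integral. *)
Lemma half_laplacian_min : exists2 c : R, 0 < c & forall h x,
  psmooth h -> (forall y, 0 <= h y) -> h x = 0 ->
  half_laplacian h x <= - (c * \int[torus d]_y h y).
Proof.
have [c c0 H] := @half_laplacian_approx R d d0; exists c => // h x sh h0 hx.
apply/ler_addgt0Pl => e e0; have [l [_ _ Hl _ /(_ h0 x) Hc]] := H h h e sh sh e0.
have := Hl x; rewrite shiftdiffE hx mulr0 sub0r ler_norml => /andP[h1 h2].
by lra.
Qed.

(* [u |nabla| u - |nabla| (u ^ 2)] at an extremum of [u] is [|nabla|] of a
   function of constant sign vanishing there. *)
Lemma extremum_bounds : exists2 c : R, 0 < c & forall u (m : R) x,
  psmooth u -> 0 < m -> (forall y, m <= u y) ->
  let Q := u x * half_laplacian u x - half_laplacian (fun y => u y ^+ 2) x in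
  ((forall y, u y <= u x) -> Q <= - (c * m * \int[torus d]_y (u x - u y))) /\
  ((forall y, u x <= u y) -> c * m * \int[torus d]_y (u y - u x) <= Q).
Proof.
have [c c0 H] := half_laplacian_min; exists c => // u m x su m0 um.
have su2 : psmooth (fun y => u y ^+ 2).
  by under eq_fun do rewrite expr2; exact: psmoothM.
have sxu := psmoothZ (u x) su.
have cu := psmooth_cper su.
split=> [umax|umin].
  have sh := psmoothB sxu su2.
  rewrite -half_laplacianZ // -half_laplacianB //.
  have hE y : u x * u y - u y ^+ 2 = u y * (u x - u y) by ring.
  have u0 y : 0 <= u y by apply: le_trans (um y); exact: ltW.
  apply: le_trans (H _ x sh _ _) _.
  - by move=> y; rewrite hE mulr_ge0 // subr_ge0.
  - by rewrite hE subrr mulr0.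
  rewrite lerN2 -mulrA ler_wpM2l ?(ltW c0) // -tintegralZ; last first.
    by apply: cperB => //; exact: cper_cst.
  apply: le_tintegral.
  - by apply: cperZ; apply: cperB => //; exact: cper_cst.
  - exact: psmooth_cper.
  - by move=> y; rewrite hE ler_wpM2r // subr_ge0.
have sh := psmoothB su2 sxu.
rewrite -half_laplacianZ // -opprB -half_laplacianB //.
have hE y : u y ^+ 2 - u x * u y = u y * (u y - u x) by ring.
have u0 y : 0 <= u y by apply: le_trans (um y); exact: ltW.
rewrite lerNr; apply: le_trans (H _ x sh _ _) _.
- by move=> y; rewrite hE mulr_ge0 // subr_ge0.
- by rewrite hE subrr mulr0.
rewrite lerN2 -mulrA ler_wpM2l ?(ltW c0) // -tintegralZ; last first.
  by apply: cperB => //; exact: cper_cst.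
apply: le_tintegral.
- by apply: cperZ; apply: cperB => //; exact: cper_cst.
- exact: psmooth_cper.
- by move=> y; rewrite hE ler_wpM2r // subr_ge0.
Qed.

(* Symmetry of the weights allows the shift [z] to be exchanged with [- z];
   averaging both forms produces the two-point expression of the hypothesis. *)
Lemma shiftdiff_dissipation l u (phi : R -> R) : shift_nonneg l -> shift_symmetric l ->
  cper u -> continuous phi ->
  (forall x y, (u y - u x) * (phi (u x) * u y - phi (u y) * u x) <= 0) ->
  \int[torus d]_x (phi (u x) * (u x * shiftdiff l u x - shiftdiff l (fun y => u y ^+ 2) x)) <= 0.
Proof.
move=> nl sl cu cphi H; have cpu := cper_comp cphi cu.
pose q x y := phi (u x) * (u y * (u y - u x)).
have cq z : cper (fun x => q x (x + z)).
  by apply: cperM => //; apply: cperM; [|apply: cperB => //]; exact: cper_shift.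
have E1 x : phi (u x) * (u x * shiftdiff l u x - shiftdiff l (fun y => u y ^+ 2) x) =
    \sum_(p <- l) p.1 * q x (x + p.2).
  rewrite /shiftdiff mulr_sumr -sumrB mulr_sumr; apply: eq_bigr => p _.
  by rewrite /q; ring.
have E2 x : \sum_(p <- l) p.1 * q x (x + p.2) = \sum_(p <- l) p.1 * q x (x - p.2).
  exact: (sl (q x) x).
under eq_Rintegral do rewrite E1.
have cs' (p : R * 'rV[R]_d) : cper (fun x => p.1 * q x (x + p.2)) by exact: cperZ.
have cs2 (p : R * 'rV[R]_d) : cper (fun x => p.1 * q x (x - p.2)) by exact: cperZ.
set I := Rintegral _ _ _.
have I1 : I = \sum_(p <- l) p.1 * \int[torus d]_x q x (x + p.2).
  by rewrite /I tintegral_sum //; apply: eq_bigr => p _; rewrite tintegralZ.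
have I2 : I = \sum_(p <- l) p.1 * \int[torus d]_x q (x + p.2) x.
  rewrite /I; under eq_Rintegral do rewrite E2.
  rewrite tintegral_sum //; apply: eq_bigr => p _; rewrite tintegralZ //.
  congr (_ * _); rewrite -(tintegral_shift p.2 (cq (- p.2))).
  by apply: eq_Rintegral => x _; rewrite addrK.
suff : I + I <= 0 by lra.
rewrite {1}I1 I2 -big_split /= big_seq; apply: sumr_le0 => p pl.
have cq' : cper (fun x => q (x + p.2) x).
  apply: cperM; first exact: (cper_shift p.2 cpu).
  by apply: cperM => //; apply: cperB => //; exact: cper_shift.
rewrite -mulrDr -tintegralD //; apply: mulr_ge0_le0; first exact: nl.
rewrite -[leRHS](mul0r ((2 * pi) ^+ d)) -tintegral_cst.
apply: le_tintegral; [exact: cperD|exact: cper_cst|].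
move=> x; apply: le_trans (H x (x + p.2)).
by rewrite /q le_eqVlt; apply/orP; left; apply/eqP; ring.
Qed.

(** The discrete inequality is passed to the limit: with [P] and [M] bounds for [phi (u x)] and
    [u x], replacing the half Laplacian of [u] and of its square by differences changes the
    integrand by at most [P * ((M + 1) * e)]. *)
Lemma energy_dissipation u (phi : R -> R) : psmooth u -> continuous phi ->
  (forall x y, (u y - u x) * (phi (u x) * u y - phi (u y) * u x) <= 0) ->
  \int[torus d]_x (phi (u x) *
    (u x * half_laplacian u x - half_laplacian (fun y => u y ^+ 2) x)) <= 0.
Proof.
move=> su cphi H; have cu := psmooth_cper su; have cpu := cper_comp cphi cu.
have su2 : psmooth (fun y => u y ^+ 2).
  by under eq_fun do rewrite expr2; exact: psmoothM.
have cu2 := psmooth_cper su2.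
have cL := cper_half_laplacian su; have cL2 := cper_half_laplacian su2.
have [M [M0 HM]] := cper_bounded cu; have [P [P0 HP]] := cper_bounded cpu.
have [c _ HK] := @half_laplacian_approx R d d0.
set I := Rintegral _ _ _.
have key e : 0 < e -> I <= P * ((M + 1) * e) * (2 * pi) ^+ d.
  move=> e0; have [l [nl sl h1 h2 _]] := HK u (fun y => u y ^+ 2) e su su2 e0.
  have D := shiftdiff_dissipation nl sl cu cphi H.
  have cD := cper_shiftdiff l cu; have cD2 := cper_shiftdiff l cu2.
  have cI1 : cper (fun x => phi (u x) * (u x * shiftdiff l u x - shiftdiff l (fun y => u y ^+ 2) x)).
    by apply: cperM => //; apply: cperB => //; exact: cperM.
  have cI : cper (fun x => phi (u x) *
    (u x * half_laplacian u x - half_laplacian (fun y => u y ^+ 2) x)).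
    by apply: cperM => //; apply: cperB => //; exact: cperM.
  apply: (@le_trans _ _ (I - \int[torus d]_x (phi (u x) *
    (u x * shiftdiff l u x - shiftdiff l (fun y => u y ^+ 2) x)))); first by lra.
  rewrite /I -tintegralB //; apply: le_trans (ler_norm _) _.
  apply: tintegral_norm_le; first exact: cperB.
  move=> x; rewrite -mulrBr normrM; apply: ler_pM => //.
  have -> : u x * half_laplacian u x - half_laplacian (fun y => u y ^+ 2) x -
     (u x * shiftdiff l u x - shiftdiff l (fun y => u y ^+ 2) x) =
     - (u x * (shiftdiff l u x - half_laplacian u x)) +
     (shiftdiff l (fun y => u y ^+ 2) x - half_laplacian (fun y => u y ^+ 2) x) by ring.
  rewrite mulrDl mul1r; apply: le_trans (ler_normD _ _) _; apply: lerD => //.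
  by rewrite normrN normrM; apply: ler_pM.
pose K := P * (M + 1) * (2 * pi) ^+ d.
have K0 : 0 <= K by rewrite !mulr_ge0 // ?ltW // ltr_wpDl.
apply/ler_addgt0Pl => e e0; rewrite addr0.
have K1 : 0 < K + 1 by rewrite ltr_wpDl.
apply: le_trans (key (e / (K + 1)) (divr_gt0 e0 K1)) _.
have -> : P * ((M + 1) * (e / (K + 1))) * (2 * pi) ^+ d = K * e / (K + 1).
  by rewrite /K; ring.
by rewrite ler_pdivrMr // mulrC ler_wpM2l ?(ltW e0) // lerDl.
Qed.

End half_laplacian_properties.

(** * Evolution *)

Section pos_sqr.
Context {R : realType}.
Implicit Types a b h : R.

Definition posp a : R := Num.max a 0.

Lemma posp_ge0 a : 0 <= posp a.
Proof. by rewrite le_max lexx orbT. Qed.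

Lemma posp_le_norm a : posp a <= `|a|.
Proof. by rewrite ge_max ler_norm normr_ge0. Qed.

Lemma pospE a : (posp a = a /\ 0 <= a) \/ (posp a = 0 /\ a < 0).
Proof.
rewrite /posp; case: (leP 0 a) => h; first by left.
by right.
Qed.

Lemma posp_continuous : continuous posp.
Proof.
move=> a; apply/cvgrPdist_le => e e0; near=> b.
have : `|a - b| <= e by near: b; exact: cvgr_dist_le.
apply: le_trans.
case: (pospE a) => -[-> ha]; case: (pospE b) => -[-> hb]; rewrite ?subrr ?normr0 //;
  rewrite ?subr0 ?sub0r ?normrN.
- by rewrite (ger0_norm ha) ger0_norm; lra.
- by rewrite (ger0_norm hb) distrC ger0_norm; lra.
Unshelve. all: end_near. Qed.

(** The squared positive part has the 2-Lipschitz derivative [2 * posp a], so the first-order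
    remainder is at most h^2 even across the kink of [posp]. *)
Lemma posp_sqr_taylor a h : `|posp (a + h) ^+ 2 - posp a ^+ 2 - 2 * posp a * h| <= h ^+ 2.
Proof.
rewrite ler_norml.
case: (pospE a) => -[-> ha]; case: (pospE (a + h)) => -[-> hb]; apply/andP; split; nra.
Qed.

Lemma is_derive_taylor (f : R -> R) (a l : R) :
  (forall h, `|f (a + h) - f a - l * h| <= h ^+ 2) -> is_derive a (1 : R) (f : R -> R^o) l.
Proof.
move=> H.
have C : (fun h : R => h^-1 *: ((f \o shift a) (h *: (1 : R)) - f a : R^o)) @ 0^' --> (l : R^o).
  apply/cvgrPdist_le => e e0; near=> h.
  have h0 : h != 0 by near: h; exact: nbhs_dnbhs_neq.
  have he : `|h| <= e by near: h; apply: dnbhs0_le.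
  have -> : l - h^-1 *: ((f \o shift a) (h *: (1 : R)) - f a : R^o) =
      - (h^-1 * (f (a + h) - f a - l * h)).
    rewrite /= [h *: 1]mulr1 [h + a]addrC /GRing.scale /=; move: (f _) (f _) => A B.
    by field.
  rewrite normrN normrM normfV ler_pdivrMl ?normr_gt0 //.
  apply: le_trans (H h) _; rewrite -real_normK ?num_real // expr2.
  by rewrite ler_wpM2l.
split; first by apply/cvg_ex; exists l.
by apply/cvg_lim.
Unshelve. all: end_near. Qed.

Lemma is_derive_lower (m a : R) :
  is_derive a (1 : R) (fun a => posp (m - a) ^+ 2 : R^o) (- (2 * posp (m - a))).
Proof.
apply: is_derive_taylor => h; have := posp_sqr_taylor (m - a) (- h).
by rewrite opprD addrA sqrrN mulrN mulNr.
Qed.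

Lemma is_derive_upper (m a : R) :
  is_derive a (1 : R) (fun a => posp (a - m) ^+ 2 : R^o) (2 * posp (a - m)).
Proof.
by apply: is_derive_taylor => h; have := posp_sqr_taylor (a - m) h; rewrite [a - m + h]addrAC.
Qed.

(** No sign of [a] and [b] is needed: if both lie below [m] the expression is a negative square, and
    if only one does, the other is at least [m], hence nonnegative. *)
Lemma lower_sign (m a b : R) : 0 <= m ->
  (b - a) * (- (2 * posp (m - a)) * b - - (2 * posp (m - b)) * a) <= 0.
Proof.
move=> m0; case: (pospE (m - a)) => -[-> ha]; case: (pospE (m - b)) => -[-> hb].
- have -> : (b - a) * (- (2 * (m - a)) * b - - (2 * (m - b)) * a) =
    - (2 * m * (b - a) ^+ 2) by ring.
  by rewrite oppr_le0 mulr_ge0 ?sqr_ge0 // mulr_ge0.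
- have -> : (b - a) * (- (2 * (m - a)) * b - - (2 * 0) * a) =
    - (2 * ((b - a) * (m - a) * b)) by ring.
  by rewrite oppr_le0 mulr_ge0 // mulr_ge0 //; [apply: mulr_ge0|]; lra.
- have -> : (b - a) * (- (2 * 0) * b - - (2 * (m - b)) * a) =
    - (2 * ((a - b) * (m - b) * a)) by ring.
  by rewrite oppr_le0 mulr_ge0 // mulr_ge0 //; [apply: mulr_ge0|]; lra.
- by rewrite mulr0 oppr0 !mul0r subrr mulr0.
Qed.

(** Here the value below [m] multiplies the expression, so nonnegativity of the values is required;
    this is why the lower bound on the solution precedes the upper one. *)
Lemma upper_sign (m a b : R) : 0 <= m -> 0 <= a -> 0 <= b ->
  (b - a) * (2 * posp (a - m) * b - 2 * posp (b - m) * a) <= 0.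
Proof.
move=> m0 a0 b0; case: (pospE (a - m)) => -[-> ha]; case: (pospE (b - m)) => -[-> hb].
- have -> : (b - a) * (2 * (a - m) * b - 2 * (b - m) * a) =
    - (2 * m * (b - a) ^+ 2) by ring.
  by rewrite oppr_le0 mulr_ge0 ?sqr_ge0 // mulr_ge0.
- have -> : (b - a) * (2 * (a - m) * b - 2 * 0 * a) =
    - (2 * ((a - b) * (a - m) * b)) by ring.
  by rewrite oppr_le0 mulr_ge0 // mulr_ge0 //; apply: mulr_ge0; lra.
- have -> : (b - a) * (2 * 0 * b - 2 * (b - m) * a) =
    - (2 * ((b - a) * (b - m) * a)) by ring.
  by rewrite oppr_le0 mulr_ge0 // mulr_ge0 //; apply: mulr_ge0; lra.
- by rewrite mulr0 !mul0r subrr mulr0.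
Qed.

End pos_sqr.

(* At a maximum [t > t1] of [g s - e * s], the graph of [phi] would lie below
   that of [g] and descend too slowly to the left. *)
Lemma le_of_lower_supports {R : realType} (g : R -> R) (t1 t2 : R) : t1 <= t2 ->
  (forall t, t1 <= t <= t2 -> {for t, continuous g}) ->
  (forall t, t1 < t <= t2 -> exists phi : R -> R, exists l : R,
    [/\ phi t = g t, (forall s, t1 < s < t -> phi s <= g s), l <= 0 &
        is_derive t (1 : R) (phi : R -> R^o) l]) ->
  g t2 <= g t1.
Proof.
move=> t12 cg H; apply/ler_addgt0Pl => e0 e00.
have [t12'|] := ltP t1 t2; last first.
  by move=> t21; rewrite (@le_anti _ _ t2 t1) ?t21 // lerDr ltW.
pose e := e0 / (t2 - t1); have e_gt0 : 0 < e by rewrite divr_gt0 ?subr_gt0.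
have [c cI Hc] : exists2 c, c \in `[t1, t2] &
    forall t, t \in `[t1, t2] -> g t - e * t <= g c - e * c.
  apply: (EVT_max (f := fun t => g t - e * t)) => //.
  apply: continuous_in_subspaceT => x /set_mem /=; rewrite in_itv /= => xI.
  have h2 : e @[y --> x] --> e by exact: cvg_cst.
  exact: (cvgB (cg x xI) (cvgM h2 cvg_id)).
have {cI} /andP[c1 c2] : t1 <= c <= t2 by move: cI; rewrite in_itv.
move: c1; rewrite le_eqVlt => /predU1P[cE|c1]; last first.
  have [phi [l [phic phis l0 [dphi Ephi]]]] := H c (introT andP (conj c1 c2)).
  exfalso; move: dphi => /cvg_ex[/= q Hq].
  have {Ephi} qE : q = l by rewrite -Ephi; apply/esym/cvg_lim.
  have Hq' := cvg_dnbhs_at_left Hq.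
  have e2 : 0 < e / 2 by rewrite divr_gt0.
  near (0 : R)^'- => h.
  have h0 : h < 0 by near: h; exact: nbhs_left_lt.
  have h1 : t1 - c < h by near: h; apply: nbhs_left_gt; rewrite subr_lt0.
  have hq : `|q - h^-1 *: (phi (h *: (1 : R) + c) - phi c)| <= e / 2.
    by near: h; move/cvgrPdist_le : Hq'; apply.
  rewrite [h *: 1]mulr1 [h + c]addrC in hq.
  have {}hq : h^-1 * (phi (c + h) - phi c) <= e / 2.
    by move: hq; rewrite ler_norml => /andP[+ _]; rewrite /GRing.scale /= qE; lra.
  have hphi : e / 2 * h <= phi (c + h) - phi c.
    by move: hq; rewrite ler_ndivrMl // [h * _]mulrC.
  have hI : t1 < c + h < c by apply/andP; split; lra.
  have := phis _ hI; have := Hc (c + h); rewrite in_itv /=.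
  have -> : t1 <= c + h <= t2 by apply/andP; split; lra.
  move=> /(_ isT); rewrite mulrDr; have : e * h < 0 by rewrite pmulr_rlt0.
  by move: hphi; rewrite phic -mulrA [2^-1 * h]mulrC mulrA; lra.
have := Hc t2; rewrite in_itv /= t12 lexx => /(_ isT).
rewrite -cE => h.
have -> : e0 = e * (t2 - t1) by rewrite /e divfK // subr_eq0 gt_eqF.
by rewrite mulrBr; move: h; lra.
Unshelve. all: end_near. Qed.

(** * Oscillation of a continuous periodic function *)

Section oscillation.
Context {R : realType} {d : nat}.
Implicit Types f : 'rV[R]_d -> R.

Definition oscillation f : R := sup (range f) - inf (range f).

Lemma oscillation_attained f : cper f -> exists x y : 'rV[R]_d,
  [/\ (forall z, f z <= f x), (forall z, f y <= f z) & oscillation f = f x - f y].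
Proof.
move=> cf; have [x xM] := cper_max cf; have [y ym] := cper_max (cperN cf).
exists x, y; have {}ym z : f y <= f z by have := ym z; rewrite lerN2.
split => //; congr (_ - _); apply/le_anti/andP; split.
- by apply: ge_sup => [|_ [z _ <-]//]; exists (f x), x.
- by apply: ub_le_sup; [exists (f x) => _ [z _ <-]|exists x].
- by apply: ge_inf; [exists (f y) => _ [z _ <-]|exists y].
- by apply: lb_le_inf => [|_ [z _ <-]//]; exists (f x), x.
Qed.

Lemma le_oscillation f x y : cper f -> f x - f y <= oscillation f.
Proof. by move=> /oscillation_attained[x' [y' [hx hy ->]]]; exact: lerB. Qed.

Lemma oscillation_le f (m M : R) : cper f -> (forall x, m <= f x <= M) ->
  oscillation f <= M - m.
Proof.
move=> /oscillation_attained[x [y [_ _ ->]]] H.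
by have /andP[_ hx] := H x; have /andP[hy _] := H y; exact: lerB.
Qed.

End oscillation.

(** * Monotone energies, decay of the oscillation and behaviour at time 0 *)

Section evolution.
Context {R : realType} {d : nat} (d0 : (0 < d)%N).
Context (u : R -> 'rV[R]_d -> R).
Hypothesis smooth_u : forall t : R, 0 < t -> psmooth (u t).
Hypothesis lip_u : forall t0 T : R, 0 < t0 -> t0 < T -> exists2 K : R, 0 <= K &
  forall (t t' : R) (x : 'rV[R]_d), t0 < t < T -> t0 < t' < T ->
    `|u t x| <= K /\ `|u t x - u t' x| <= K * `|t - t'|.
Hypothesis classical_u : forall (t : R) (x : 'rV[R]_d), 0 < t ->
  is_derive t (1 : R) (fun s => u s x : R^o)
    (u t x * half_laplacian (u t) x - half_laplacian (fun y => u t y ^+ 2) x).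

Let rhs (t : R) (x : 'rV[R]_d) : R := u t x * half_laplacian (u t) x - half_laplacian (fun y => u t y ^+ 2) x.

Lemma is_derive_norm_le (g : R -> R) (t q K r : R) : 0 < r ->
  is_derive t (1 : R) (g : R -> R^o) q ->
  (forall h, `|h| < r -> `|g (t + h) - g t| <= K * `|h|) -> `|q| <= K.
Proof.
move=> r0 [/cvg_ex[/= l Hl] E] H.
have {}E : l = q by rewrite -E; apply/esym/cvg_lim.
rewrite -E; apply/ler_addgt0Pl => e e0.
near (0 : R)^' => h.
have h0 : h != 0 by near: h; exact: nbhs_dnbhs_neq.
have hr : `|h| < r by near: h; exact: dnbhs0_lt.
have he : `|l - h^-1 *: (g (h *: (1 : R) + t) - g t)| <= e.
  by near: h; move/cvgrPdist_le : Hl; apply.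
rewrite [h *: 1]mulr1 [h + t]addrC in he.
rewrite -[l](subrK (h^-1 *: (g (t + h) - g t))).
apply: le_trans (ler_normD _ _) _; apply: lerD => //.
by rewrite normrZ normfV ler_pdivrMl ?normr_gt0 // mulrC H.
Unshelve. all: end_near. Qed.

(** The right-hand side of the equation is the time derivative, so it inherits the Lipschitz
    constant in time. The bound is uniform in [x], as differentiation under the integral
    requires. *)
Lemma rhs_le (t0 T K : R) : 0 < t0 ->
  (forall (t t' : R) (x : 'rV[R]_d), t0 < t < T -> t0 < t' < T ->
    `|u t x| <= K /\ `|u t x - u t' x| <= K * `|t - t'|) ->
  forall (t : R) (x : 'rV[R]_d), t0 < t < T -> `|rhs t x| <= K.
Proof.
move=> t00 HK t x /andP[tl tr].
have r0 : 0 < Num.min (t - t0) (T - t) by rewrite lt_min !subr_gt0 tl tr.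
have dt := classical_u x (lt_trans t00 tl).
apply: (is_derive_norm_le r0 dt) => h; rewrite lt_min => /andP[h1 h2].
have [h3 h4] : - `|h| <= h /\ h <= `|h| by rewrite lerNl -normrN ler_norm normrN ler_norm.
have -> : `|h| = `|t + h - t| by rewrite addrAC subrr add0r.
by apply: (HK _ _ x _ _).2; apply/andP; split; lra.
Qed.

Section energy.
Variables (Phi phi : R -> R) (c : R).
Hypothesis dPhi : forall a : R, is_derive a (1 : R) (Phi : R -> R^o) (phi a).
Hypothesis cphi : continuous phi.
Hypothesis phi_le : forall a : R, `|phi a| <= 2 * `|a| + c.
Hypothesis phi_sign : forall (t : R) (x y : 'rV[R]_d), 0 < t ->
  (u t y - u t x) * (phi (u t x) * u t y - phi (u t y) * u t x) <= 0.

Lemma Phi_continuous : continuous Phi.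
Proof.
move=> a; apply: differentiable_continuous; apply/derivable1_diffP.
by have [] := dPhi a.
Qed.

Lemma cper_energy (t : R) : 0 < t -> cper (fun x => Phi (u t x)).
Proof.
move=> t0; apply: cper_comp; first exact: Phi_continuous.
exact/psmooth_cper/smooth_u.
Qed.

Lemma is_derive_energy (t : R) : 0 < t ->
  is_derive t (1 : R) (fun s => \int[torus d]_x Phi (u s x) : R^o)
    (\int[torus d]_x (phi (u t x) * rhs t x)).
Proof.
move=> t0; have [t1 t2] : 0 < t / 2 /\ t / 2 < t + 1 by split; lra.
have [K K0 HK] := lip_u t1 t2; have HQ := rhs_le t1 HK.
pose f (s : R) (x : 'rV[R]_d) : R := Phi (u s x).
have df (s : R) (x : 'rV[R]_d) : 0 < s -> is_derive s (1 : R) (f ^~ x : R -> R^o) (phi (u s x) * rhs s x).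
  by move=> s0; exact: (is_derive1_comp (dPhi (u s x)) (classical_u x s0)).
have pE (s : R) (x : 'rV[R]_d) : 0 < s -> partial1of2 f s x = phi (u s x) * rhs s x.
  by move=> s0; rewrite partial1of2E; have [_ ->] := df s x s0.
have c0 : 0 <= c by have := phi_le 0; rewrite normr0 mulr0 add0r; apply: le_trans.
have Ia : (`]t / 2, t + 1[%classic : set R) t by rewrite /= in_itv /=; apply/andP; split; lra.
have Ipos (s : R) : (`]t / 2, t + 1[%classic : set R) s -> 0 < s /\ (t / 2 < s < t + 1).
  by rewrite /= in_itv /= => h; split => //; case/andP: h => + _; exact: lt_trans.
pose G : R := (2 * K + c) * K.
have intf (s : R) : (`]t / 2, t + 1[%classic : set R) s -> (torus d).-integrable setT (EFin \o f s).
  by move=> /Ipos [s0 _]; apply: cper_integrable; exact: cper_energy.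
have derf (s : R) (x : 'rV[R]_d) : (`]t / 2, t + 1[%classic : set R) s -> setT x -> derivable (f ^~ x : R -> R^o) s 1.
  by move=> /Ipos [s0 _] _; have [] := df s x s0.
have G0 (x : 'rV[R]_d) : 0 <= (fun=> G) x by rewrite mulr_ge0 // addr_ge0 // mulr_ge0.
have intG : (torus d).-integrable setT (EFin \o (fun=> G)).
  by apply: cper_integrable; exact: cper_cst.
have GH (s : R) (x : 'rV[R]_d) : (`]t / 2, t + 1[%classic : set R) s -> setT x -> `|partial1of2 f s x| <= (fun=> G) x.
  move=> /Ipos [s0 sI] _; rewrite pE // normrM; apply: ler_pM => //.
    apply: le_trans (phi_le _) _; rewrite lerD2r ler_wpM2l //.
    exact: (HK _ _ _ sI sI).1.
  exact: HQ.
have H1 := @differentiation_under_integral R _ _ (torus d) f setT measurableT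
  t _ _ Ia intf derf (fun=> G) G0 intG GH.
have H2 := @derivable_under_integral R _ _ (torus d) f setT measurableT
  t _ _ Ia intf derf (fun=> G) G0 intG GH.
apply: DeriveDef; first exact: H2.
rewrite -derive1E H1; apply: eq_Rintegral => x _.
exact: pE.
Qed.

Lemma energy_nonincreasing (t1 t2 : R) : 0 < t1 -> t1 <= t2 ->
  \int[torus d]_x Phi (u t2 x) <= \int[torus d]_x Phi (u t1 x).
Proof.
move=> t10; rewrite le_eqVlt => /predU1P[->//|t12].
have P (s : R) : t1 <= s -> 0 < s by apply: lt_le_trans.
pose F s := \int[torus d]_x Phi (u s x).
pose F' s := \int[torus d]_x (phi (u s x) * rhs s x).
have cF : {within `[t1, t2], continuous F}.
  apply: derivable_within_continuous => s; rewrite in_itv /= => /andP[h _].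
  by have [] := is_derive_energy (P _ h).
have dF s : s \in `]t1, t2[%R -> is_derive s (1 : R) (F : R -> R^o) (F' s).
  rewrite in_itv /= => /andP[h _]; apply: is_derive_energy; apply: P; exact: ltW.
have [s s12 E] := @MVT R F F' t1 t2 t12 dF cF.
change (F t2 <= F t1).
rewrite -subr_le0 E mulr_le0_ge0 ?subr_ge0 ?(ltW t12) //.
have s0 : 0 < s by apply: P; move: s12; rewrite in_itv /= => /andP[+ _]; exact: ltW.
apply: (energy_dissipation d0 (smooth_u s0) cphi) => x y.
exact: phi_sign.
Qed.

End energy.

Section decay.

Let cper_u (t : R) : 0 < t -> cper (u t).
Proof. by move=> t0; exact/psmooth_cper/smooth_u. Qed.

(** At the extremal points of [u a], passing to [u b] changes each of the two values by at most K |a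
    - b|, so the oscillation is locally Lipschitz with constant [2 * K]. *)
Lemma oscillation_continuous (t : R) : 0 < t ->
  {for t, continuous (fun s => oscillation (u s))}.
Proof.
move=> t0; have [t1 t2] : 0 < t / 2 /\ t / 2 < t + 1 by split; lra.
have [K K0 HK] := lip_u t1 t2.
have lipo (a b : R) : t / 2 < a < t + 1 -> t / 2 < b < t + 1 ->
    oscillation (u a) - oscillation (u b) <= (2 * K) * `|a - b|.
  move=> aI bI; have a0 : 0 < a by case/andP: aI => + _; exact: lt_trans.
  have b0 : 0 < b by case/andP: bI => + _; exact: lt_trans.
  have [x [y [_ _ ->]]] := oscillation_attained (cper_u a0).
  have := le_oscillation x y (cper_u b0).
  have [_] := HK _ _ x aI bI; have [_] := HK _ _ y aI bI.
  by rewrite !ler_norml => /andP[A1 A2] /andP[B1 B2]; lra.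
apply/cvgrPdist_le => e e0.
have K1 : 0 < 2 * K + 1 by lra.
near=> s.
have sI : t / 2 < s < t + 1.
  by apply/andP; split; near: s; [apply: lt_nbhsr|apply: lt_nbhsl]; lra.
have tI : t / 2 < t < t + 1 by apply/andP; split; lra.
have st : `|t - s| <= e / (2 * K + 1).
  by near: s; apply: cvgr_dist_le; [exact: cvg_id|exact: divr_gt0].
have := lipo _ _ tI sI; have := lipo _ _ sI tI; rewrite [X in _ * X]distrC => A1 A2.
have {}st : 2 * K * `|t - s| <= e.
  apply: le_trans (_ : (2 * K + 1) * `|t - s| <= e).
    by rewrite ler_wpM2r // lerDl.
  by move: st; rewrite ler_pdivlMr // mulrC.
by rewrite ler_norml; apply/andP; split; lra.
Unshelve. all: end_near. Qed.

Variables (c m : R).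
Hypothesis m0 : 0 < m.
Hypothesis u_ge : forall (t : R) (x : 'rV[R]_d), 0 < t -> m <= u t x.
Hypothesis c_bounds : forall (f : 'rV[R]_d -> R) (m : R) (x : 'rV[R]_d),
  psmooth f -> 0 < m -> (forall y, m <= f y) ->
  let Q := f x * half_laplacian f x - half_laplacian (fun y => f y ^+ 2) x in
  ((forall y, f y <= f x) -> Q <= - (c * m * \int[torus d]_y (f x - f y))) /\
  ((forall y, f x <= f y) -> c * m * \int[torus d]_y (f y - f x) <= Q).

Let k : R := c * (2 * pi) ^+ d * m.

(** The extremal points may jump in time, so they are frozen at their position at time [t]: the
    difference of the values of [u s] there stays below the oscillation, equals it at [s = t], and
    is differentiable. With the exponential factor its derivative at [t] is at most 0. *)
Lemma exp_oscillation_nonincreasing (t1 t2 : R) : 0 < t1 -> t1 <= t2 ->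
  expR (k * t2) * oscillation (u t2) <= expR (k * t1) * oscillation (u t1).
Proof.
move=> t10 t12.
have P (s : R) : t1 <= s -> 0 < s by apply: lt_le_trans.
have dexp (t : R) : is_derive t (1 : R) (fun s => expR (k * s) : R^o) (expR (k * t) * k).
  apply: (is_derive1_comp (is_derive_expR (k * t))).
  have := is_deriveZ k (is_derive_id t (1 : R)).
  by rewrite /GRing.scale /= mulr1.
apply: (le_of_lower_supports (g := fun s => expR (k * s) * oscillation (u s))) => // t.
  move=> /andP[/P t0 _].
  have hc : {for t, continuous (fun s => expR (k * s))}.
    apply: differentiable_continuous; apply/derivable1_diffP.
    by have [] := dexp t.
  exact: (cvgM hc (oscillation_continuous t0)).
move=> /andP[/ltW/P t0 _].
have [x [y [xM ym oE]]] := oscillation_attained (cper_u t0).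
pose Q z := u t z * half_laplacian (u t) z - half_laplacian (fun y => u t y ^+ 2) z.
exists (fun s => expR (k * s) * (u s x - u s y)).
exists (expR (k * t) * (Q x - Q y) + (u t x - u t y) * (expR (k * t) * k)).
split; first by rewrite oE.
- move=> s /andP[/ltW/P s0 _]; rewrite ler_wpM2l ?expR_ge0 //.
  exact: le_oscillation (cper_u s0).
- have [/(_ xM) Qx _] := c_bounds x (smooth_u t0) m0 (fun y => u_ge y t0).
  have [_ /(_ ym) Qy] := c_bounds y (smooth_u t0) m0 (fun y => u_ge y t0).
  have cu := cper_u t0; have cst a := @cper_cst R d a.
  (* When the two bounds are subtracted the integral of [u t] cancels, leaving (2 pi)^d times the
     oscillation. *)
  rewrite tintegralB // tintegral_cst in Qx.
  rewrite tintegralB // tintegral_cst in Qy.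
  have : Q x - Q y <= - (k * (u t x - u t y)).
    rewrite /k -/(Q x) -/(Q y) in Qx Qy *; move: Qx Qy.
    by move: (\int[_]__ _) => I; move: (Q x) (Q y) => a b Qx Qy; nra.
  move=> h; have := expR_gt0 (k * t); move: (expR _) h => E h E0.
  rewrite [X in _ + X]mulrCA -mulrDr pmulr_rle0 //; lra.
- apply: (is_deriveM (dexp t) (is_deriveB (classical_u x t0) (classical_u y t0))).
Qed.

(** Monotonicity is used between [s] and [t], and [s] tends to 0, where the factor exp (k s) tends
    to 1. *)
Lemma oscillation_decay (A : R) : (forall t, 0 < t -> oscillation (u t) <= A) ->
  forall t, 0 < t -> oscillation (u t) <= A * expR (- (k * t)).
Proof.
move=> HA t t0; rewrite expRN ler_pdivlMr ?expR_gt0 // mulrC.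
have lim : A * expR (k * s) @[s --> (0 : R)^'+] --> A.
  apply: cvg_at_right_filter.
  have h1 : A @[s --> (0 : R)] --> A by exact: cvg_cst.
  have h2 : k @[s --> (0 : R)] --> k by exact: cvg_cst.
  have h3 : k * s @[s --> (0 : R)] --> k * 0 by exact: (cvgM h2 cvg_id).
  have := cvgM h1 (cvg_comp _ _ h3 (@continuous_expR R (k * 0))).
  by rewrite mulr0 expR0 mulr1; exact.
apply: (cvgr_to_ge lim); near=> s.
have s0 : 0 < s by near: s; exact: nbhs_right_gt.
have st : s <= t by near: s; exact: nbhs_right_le.
apply: le_trans (exp_oscillation_nonincreasing s0 st) _.
by rewrite mulrC ler_wpM2r ?expR_ge0 // HA.
Unshelve. all: end_near. Qed.

End decay.

(** * Transfer of the bounds on the initial value to positive times *)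

Context (u0 : 'rV[R]_d -> R).
Hypothesis mu0 : measurable_fun setT (u0 : 'rV[R]_d -> measurableTypeR R).
Hypothesis initial_L2 : L2_norm (u t \- u0) @[t --> 0^'+] --> 0%E.

(** [Phi] stands for a squared excess beyond a bound of [u0], hence is at most the squared distance
    to [u0 x]. Its integral is then at most the squared L^2 distance between [u s] and [u0], which
    tends to 0. *)
Lemma energy_initial (Phi : R -> R) : (forall t : R, 0 < t -> cper (fun x => Phi (u t x))) ->
  (forall a, 0 <= Phi a) ->
  {ae (torus d), forall x, forall a, Phi a <= (a - u0 x) ^+ 2} ->
  forall t e : R, 0 < t -> 0 < e -> exists s : R, [/\ 0 < s, s <= t &
    \int[torus d]_x Phi (u s x) <= e].
Proof.
move=> cP P0 aeP t e t0 e0.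
have se0 : 0 < Num.sqrt e by rewrite sqrtr_gt0.
near (0 : R)^'+ => s.
have s0 : 0 < s by near: s; exact: nbhs_right_gt.
have st : s <= t by near: s; exact: nbhs_right_le.
have sL : (L2_norm (u s \- u0)%R < (Num.sqrt e)%:E)%E.
  near: s; move: initial_L2 => /(_ [set x | (x < (Num.sqrt e)%:E)%E]); apply.
  by apply: open_ereal_lt_ereal => /=; rewrite lte_fin.
exists s; split => //.
have mus : measurable_fun setT (u s : 'rV[R]_d -> measurableTypeR R).
  by apply: continuous_measurable_row; have [] := psmooth_cper (smooth_u s0).
have mPs : measurable_fun setT ((fun x => Phi (u s x)) : 'rV[R]_d -> measurableTypeR R).
  by apply: continuous_measurable_row; have [] := cP s s0.
have le1 : (\int[torus d]_x (Phi (u s x))%:E <= \int[torus d]_x ((u s x - u0 x) ^+ 2)%R%:E)%E.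
  apply: ae_ge0_le_integral => //.
  - by move=> x _; rewrite lee_fin.
  - exact/measurable_EFinP.
  - by move=> x _; rewrite lee_fin sqr_ge0.
  - by apply/measurable_EFinP; apply: measurable_funX; exact: measurable_funB.
  - by apply: filterS aeP => x Hx _; rewrite lee_fin; exact: Hx.
have le2 : (\int[torus d]_x ((u s x - u0 x) ^+ 2)%R%:E <= e%:E)%E.
  have H2 := @powR_Lnorm _ _ R (torus d) (EFin \o (u s \- u0)%R) 2 (lt0r_neq0 (ltr0n _ 2)).
  rewrite (_ : \int[torus d]_x ((u s x - u0 x) ^+ 2)%R%:E =
      \int[torus d]_x `|(EFin \o (u s \- u0)%R) x| `^ 2)%E; last first.
    apply: eq_integral => x _ /=.
    by rewrite powR_mulrn // real_normK ?num_real.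
  rewrite -H2 -[e]sqr_sqrtr ?(ltW e0) // -powR_mulrn ?sqrtr_ge0 // -poweR_EFin.
  apply: gt0_ler_poweR; rewrite ?in_itv /= ?leey ?lee_fin ?sqrtr_ge0 ?Lnorm_ge0 //.
  exact: ltW.
rewrite -lee_fin fineK; first exact: le_trans le1 le2.
apply: integrable_fin_num => //; exact: (cper_integrable (cP s s0)).
Unshelve. all: end_near. Qed.

Variables (m M : R).
Hypothesis m0 : 0 < m.
Hypothesis mM : m <= M.
Hypothesis ae_u0 : {ae (torus d), forall x, m <= u0 x <= M}.

(** A nonincreasing energy that becomes arbitrarily small at small times has nonpositive integral at
    every positive time; continuity in [x] turns this into pointwise vanishing. *)
Lemma energy_zero (Phi phi : R -> R) (c : R) :
  (forall a : R, is_derive a (1 : R) (Phi : R -> R^o) (phi a)) ->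
  continuous phi -> (forall a : R, `|phi a| <= 2 * `|a| + c) ->
  (forall (t : R) (x y : 'rV[R]_d), 0 < t ->
    (u t y - u t x) * (phi (u t x) * u t y - phi (u t y) * u t x) <= 0) ->
  (forall a, 0 <= Phi a) ->
  {ae (torus d), forall x, forall a, Phi a <= (a - u0 x) ^+ 2} ->
  forall (t : R) (x : 'rV[R]_d), 0 < t -> Phi (u t x) = 0.
Proof.
move=> dPhi cphi phile phis P0 aeP t x t0.
have cP s : 0 < s -> cper (fun x => Phi (u s x)) by exact: (cper_energy dPhi).
apply: (tintegral_eq0 (cP t t0)) => //.
apply/ler_addgt0Pl => e e0; rewrite addr0.
have [s [s0 st Hs]] := energy_initial cP P0 aeP t0 e0.
exact: le_trans (energy_nonincreasing dPhi cphi phile phis s0 st) Hs.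
Qed.

Lemma posp_comp_continuous (f : R -> R) : continuous f -> continuous (fun a => posp (f a)).
Proof. by move=> cf a; exact: (cvg_comp _ _ (cf a) (@posp_continuous R (f a))). Qed.

Lemma initial_lower_bound (t : R) (x : 'rV[R]_d) : 0 < t -> m <= u t x.
Proof.
move=> t0.
suff : posp (m - u t x) ^+ 2 = 0.
  by move/eqP; rewrite sqrf_eq0 => /eqP; case: (pospE (m - u t x)) => -[]; lra.
apply: (energy_zero (Phi := fun a => posp (m - a) ^+ 2) (phi := fun a => - (2 * posp (m - a)))
  (c := 2 * `|m|)) => //.
- exact: is_derive_lower.
- have h : continuous (fun a : R => posp (m - a)).
    apply: posp_comp_continuous => b; have h1 : m @[x --> b] --> m by exact: cvg_cst.
    exact: (cvgB h1 cvg_id).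
  move=> a; have h2 : (2 : R) @[x --> a] --> (2 : R) by exact: cvg_cst.
  exact: (cvgN (cvgM h2 (h a))).
- move=> a; rewrite normrN normrM ger0_norm // ger0_norm ?posp_ge0 // -mulrDr.
  rewrite ler_wpM2l //; apply: le_trans (posp_le_norm _) _.
  by rewrite [leRHS]addrC; exact: ler_normB.
- by move=> s y z s0; apply: lower_sign; exact: ltW.
- by move=> a; exact: sqr_ge0.
apply: filterS ae_u0 => y /andP[h _] a.
rewrite -(sqrrN (a - u0 y)) opprB.
by case: (pospE (m - a)) => -[-> ha]; rewrite ?expr0n ?sqr_ge0 //= lerXn2r ?nnegrE //; lra.
Qed.

Lemma initial_upper_bound (t : R) (x : 'rV[R]_d) : 0 < t -> u t x <= M.
Proof.
move=> t0.
suff : posp (u t x - M) ^+ 2 = 0.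
  by move/eqP; rewrite sqrf_eq0 => /eqP; case: (pospE (u t x - M)) => -[]; lra.
have M0 : 0 <= M by exact: le_trans (ltW m0) mM.
have up s y : 0 < s -> 0 <= u s y.
  by move=> s0; apply: le_trans (ltW m0) (initial_lower_bound y s0).
apply: (energy_zero (Phi := fun a => posp (a - M) ^+ 2) (phi := fun a => 2 * posp (a - M))
  (c := 2 * `|M|)) => //.
- exact: is_derive_upper.
- have h : continuous (fun a : R => posp (a - M)).
    apply: posp_comp_continuous => b; have h1 : M @[x --> b] --> M by exact: cvg_cst.
    exact: (cvgB cvg_id h1).
  move=> a; have h2 : (2 : R) @[x --> a] --> (2 : R) by exact: cvg_cst.
  exact: (cvgM h2 (h a)).
- move=> a; rewrite normrM ger0_norm // ger0_norm ?posp_ge0 // -mulrDr.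
  rewrite ler_wpM2l //; apply: le_trans (posp_le_norm _) _.
  exact: ler_normB.
- by move=> s y z s0; apply: upper_sign => //; exact: up.
- by move=> a; exact: sqr_ge0.
apply: filterS ae_u0 => y /andP[_ h] a.
by case: (pospE (a - M)) => -[-> ha]; rewrite ?expr0n ?sqr_ge0 //= lerXn2r ?nnegrE //; lra.
Qed.

End evolution.

(** * What is drawn from the regularity properties *)

Section regularity.
Context {R : realType} {d : nat}.
Implicit Types (u : R -> 'rV[R]_d -> R).

(** The order 0 norm is a sum of two suprema; each is bounded by [C] once the other is known to be
    nonnegative. *)
Lemma lip_norm0_bound u (t0 T C : R) : t0 < T -> (lip_norm 0 t0 T u <= C%:E)%E ->
  forall (t t' : R) (x : 'rV[R]_d), t0 < t < T -> t0 < t' < T ->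
    `|u t x| <= C /\ `|u t x - u t' x| <= C * `|t - t'|.
Proof.
rewrite /lip_norm; set S1 := [set _ | _]; set S2 := [set _ | _] => t0T le t t' x tI t'I.
have tI' (s : R) : t0 < s < T -> (`]t0, T[%classic : set R) s by rewrite /= in_itv.
have S1t : S1 (`|u t x|%:E) by exists [tuple], t, x; split => //; exact: tI'.
have S1_ge0 : (0 <= ereal_sup S1)%E.
  by apply: le_trans (ereal_sup_ubound S1t); rewrite lee_fin.
have S2_le (s : R) : t0 < s < T -> t != s ->
    S2 ((`|u t x - u s x| / `|t - s|)%:E).
  move=> sI ts; exists [tuple], t, s, x, x; split; [exact: tI'|split; [exact: tI'|split]].
    by apply: contra ts => /eqP[->].
  congr (_ / _)%:E; rewrite subrr /enorm /dot big1 ?sqrtr0 ?expr0n /= ?addr0 ?sqrtr_sqr //.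
  by move=> i _; rewrite mxE mul0r.
(* The supremum of an empty set is -oo, so a second time is needed to exhibit an element of [S2] and
   make its supremum nonnegative. *)
have [s sI ts] : exists2 s, t0 < s < T & t != s.
  case/andP: tI => t1 t2; exists ((t0 + t) / 2); first by apply/andP; split; lra.
  by apply/eqP => E; lra.
have S2_ge0 : (0 <= ereal_sup S2)%E.
  by apply: le_trans (ereal_sup_ubound (S2_le _ sI ts)); rewrite lee_fin.
split.
  rewrite -lee_fin; apply: le_trans (ereal_sup_ubound S1t) _; apply: le_trans le.
  exact: leeDl.
have [->|tt'] := eqVneq t t'; first by rewrite !subrr normr0 mulr0.
rewrite -ler_pdivrMr ?normr_gt0 ?subr_eq0 // -lee_fin.
apply: le_trans (ereal_sup_ubound (S2_le _ t'I tt')) _; apply: le_trans le.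
exact: leeDr.
Qed.

Variables (C : nat -> R -> R -> R -> R -> R) (u0 : 'rV[R]_d -> R) (u : R -> 'rV[R]_d -> R).
Hypothesis Pu : properties_P C u0 u.

Lemma properties_P_smooth (t : R) : 0 < t -> psmooth (u t).
Proof.
move=> t0; split; last exact: (P_periodic Pu (ltW t0)).
have T0 : 0 < t + 1 by lra.
move=> k; have [alpha [_ H]] := P_regular Pu k T0.
have [|Hk _ _] := H (t / 2); first by apply/andP; split; lra.
by apply: Hk; apply/andP; split; lra.
Qed.

Lemma properties_P_lip (t0 T : R) : 0 < t0 -> t0 < T -> exists2 K : R, 0 <= K &
  forall (t t' : R) (x : 'rV[R]_d), t0 < t < T -> t0 < t' < T ->
    `|u t x| <= K /\ `|u t x - u t' x| <= K * `|t - t'|.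
Proof.
move=> t00 t0T; have [alpha [_ H]] := P_regular Pu 0 (lt_trans t00 t0T).
have [|_ _ HL] := H t0; first by rewrite t00.
have HK := lip_norm0_bound t0T HL; eexists; last exact: HK.
have mI : t0 < (t0 + T) / 2 < T by apply/andP; split; lra.
by have [+ _] := HK _ _ 0 mI mI; apply: le_trans.
Qed.

End regularity.

Lemma ess_bounds {R : realType} {d : nat} (u0 : 'rV[R]_d -> R) :
  Linfty_torus u0 -> 0 < ess_min u0 ->
  ess_min u0 <= ess_max u0 /\
  {ae (torus d), forall x, ess_min u0 <= u0 x <= ess_max u0}.
Proof.
move=> [_ u0L]; rewrite /ess_min /ess_max => m0.
have T0 : (0 < torus d (setT : set 'rV[R]_d))%E.
  by rewrite torus_setT lte_fin exprn_gt0 // mulr_gt0 ?pi_gt0.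
have := set_mem (sub_Lfun_finLfun u0L); rewrite /= /finite_norm unlock T0 => ufin.
(* [fine] sends infinite values to 0, so a positive [ess_min u0] forces the essential infimum to be
   finite. *)
have fmin : ess_inf (torus d) (EFin \o u0) \is a fin_num.
  by case: (ess_inf _ _) m0 => //=; rewrite ltxx.
have inf_le := ess_inf_le (torus d) (EFin \o u0).
have sup_ge := ess_sup_ge (torus d) (EFin \o u0).
(* The torus has positive measure, so two properties true almost everywhere hold at a common point.
   It gives the order of the two bounds and excludes -oo as essential supremum. *)
have [x xI xS] : exists2 x, (ess_inf (torus d) (EFin \o u0) <= (u0 x)%:E)%E &
    ((u0 x)%:E <= ess_sup (torus d) (EFin \o u0))%E.
  have F := @ae_properfilter_algebraOfSetsType _ _ R (torus d) T0.
  by have [x [h1 h2]] := filter_ex (filterI inf_le sup_ge); exists x.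
have fmax : ess_sup (torus d) (EFin \o u0) \is a fin_num.
  rewrite fin_numE; apply/andP; split.
    by rewrite -ltNye; apply: lt_le_trans xS; exact: ltNyr.
  rewrite -ltey; apply: le_lt_trans ufin.
  by apply: le_ess_sup; apply: nearW => y /=; rewrite lee_fin ler_norm.
split; first by rewrite -lee_fin !fineK // (le_trans xI xS).
apply: filterS2 inf_le sup_ge => y; rewrite -[ess_inf _ _]fineK // -[ess_sup _ _]fineK //.
by rewrite /= !lee_fin => -> ->.
Qed.

Theorem lemma3p1 (R : realType) (d : nat) (hd : (0 < d)%N)
    (c_d : R) (hc_d : is_kernel_constant d c_d) :
  exists c : R, 0 < c /\
    forall (C : nat -> R -> R -> R -> R -> R)
           (u0 : 'rV[R]_d -> R) (u : R -> 'rV[R]_d -> R),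
    Linfty_torus u0 ->
    0 < ess_min u0 ->
    weak_solution c_d u0 u ->
    properties_P C u0 u ->
    forall t : R, 0 < t ->
      amplitude u t <=
        (ess_max u0 - ess_min u0) * expR (- c * ess_min u0 * t).
Proof.
have [c c0 Hc] := @extremum_bounds R d hd.
(* The factor is the volume of the torus, produced by adding the estimates at the maximum and at the
   minimum. *)
exists (c * (2 * pi) ^+ d); split; first by rewrite mulr_gt0 // exprn_gt0 // mulr_gt0 ?pi_gt0.
move=> C u0 u Lu0 m0 _ Pu t t0.
have [mM ae_u0] := ess_bounds Lu0 m0.
have mu0 : measurable_fun setT (u0 : 'rV[R]_d -> measurableTypeR R).
  by have := set_mem (sub_Lfun_mfun Lu0.2).
have su := properties_P_smooth Pu; have lu := properties_P_lip Pu.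
have cu := P_classical Pu; have iu := P_initial_L2 Pu.
have lower (s : R) x := initial_lower_bound hd su lu cu mu0 iu m0 ae_u0 (t := s) x.
have upper (s : R) x := initial_upper_bound hd su lu cu mu0 iu m0 mM ae_u0 (t := s) x.
have := oscillation_decay su lu cu m0 lower Hc (A := ess_max u0 - ess_min u0) _ t0.
rewrite mulNr mulNr; apply => s s0.
apply: oscillation_le => [|x]; first exact/psmooth_cper/su.
by rewrite lower ?upper.
Qed.
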